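(* Let $\hat K\cong I_{2,10}$, let $\Gamma=\operatorname{Aut}\hat K$ be its isometry group, and let $\mathcal{D}\subset P(\hat K\otimes\mathbb{C})$ be the set of points having a representative vector $v$ with $\langle v|v\rangle=0$ and $\langle v|\bar v\rangle>0$. Let $H=\bigcup_\ell H_\ell$, where $\ell$ varies over the vectors of $\hat K$ of norm $\langle\ell|\ell\rangle=-1$ and $H_\ell$ is the set of points of $\mathcal{D}$ represented by vectors orthogonal to $\ell$. Then $H/\Gamma$ is an irreducible divisor of $\mathcal{D}/\Gamma$.
   Context: $I_{2,10}$ is the lattice (free $\mathbb{Z}$-module with symmetric bilinear form $\langle\,|\,\rangle$) with an orthogonal basis consisting of 2 vectors of norm $+1$ and 10 vectors of norm $-1$, where the norm of $v$ is $\langle v|v\rangle$. The form is extended $\mathbb{C}$-bilinearly to $\hat K\otimes\mathbb{C}$. $\mathcal{D}$ is the Hermitian symmetric space for $O(2,10)$, and $\Gamma$ acts on it through its linear action on $\hat K\otimes\mathbb{C}$; the quotient $\mathcal{D}/\Gamma$ is a complex analytic (indeed quasiprojective) variety. *)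

(* Defs.v *)
From HB Require Import structures.
From mathcomp Require Import all_boot all_order all_algebra.
From mathcomp Require Import all_classical all_reals all_analysis.
From mathcomp Require Import complex.

Set Implicit Arguments.
Unset Strict Implicit.
Unset Printing Implicit Defensive.

Import Order.TTheory GRing.Theory Num.Theory.
Import numFieldNormedType.Exports.

Local Open Scope classical_set_scope.
Local Open Scope ring_scope.

(** * Lattices *)

(* A lattice of rank n is given by the Gram matrix of a basis: the free module
   is 'rV[int]_n, with the form below. Scalars are extended by [map_mx]. *)
Definition bform (A : comNzRingType) n (G : 'M[A]_n) (x y : 'rV[A]_n) : A :=
  (x *m G *m y^T) 0 0.

Definition lattice_isom n (G G' : 'M[int]_n) (g : 'M[int]_n) : Prop :=
  g \in unitmx /\
  forall x y : 'rV[int]_n, bform G' (x *m g) (y *m g) = bform G x y.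

Definition isometric n (G G' : 'M[int]_n) : Prop :=
  exists g, lattice_isom G G' g.

Definition Aut n (G : 'M[int]_n) : set 'M[int]_n := lattice_isom G G.

Definition lattice_I p q : 'M[int]_(p + q) :=
  diag_mx (row_mx (const_mx 1) (const_mx (- 1))).

(** * Complex analytic geometry *)

(* f is the sum of an absolutely convergent power series on a polydisc
   centred at w. The partial sums run over the multi-indices in {0..N-1}^n. *)
Definition analytic_at (C : numClosedFieldType) n
    (f : 'rV[C]_n -> C) (w : 'rV[C]_n) : Prop :=
  exists (r : C) (c : ('I_n -> nat) -> C),
    [/\ 0 < r,
        (exists M : C, forall N : nat,
           \sum_(a : {ffun 'I_n -> 'I_N})
              `|c (fun i => a i)| * \prod_i r ^+ a i <= M)
      & forall z : 'rV[C]_n, (forall i, `|z 0 i - w 0 i| < r) ->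
          (fun N : nat => \sum_(a : {ffun 'I_n -> 'I_N})
              c (fun i => a i) * \prod_i (z 0 i - w 0 i) ^+ a i)
            @ \oo --> f z].

(* Reduced complex spaces, presented as spaces with a sheaf of C-valued
   functions: [hol X U f] says that the restriction of f to the open set U is
   a section of the structure sheaf. The values of f outside U are junk. *)
Record fspace (C T : Type) := FSpace {
  points : set T;
  is_open : set (set T);
  hol : set T -> (T -> C) -> Prop }.

Definition affine_space (C : numClosedFieldType) n : fspace C 'rV[C]_n :=
  FSpace setT (fun U => open U)
         (fun U f => forall w, U w -> analytic_at f w).

(* Structure induced on S: functions are local restrictions. *)
Definition subspace_of (C T : Type) (X : fspace C T) (S : set T) :
    fspace C T :=
  FSpace (points X `&` S)
    (fun W => exists2 U, is_open X U & W = U `&` S)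
    (fun W f => forall x, W x -> exists U F,
       [/\ is_open X U, U x, hol X U F & forall y, U y -> W y -> f y = F y]).

(* Quotient structure on the image of p: functions on W are the functions
   whose pullback by p is a function on the preimage of W. *)
Definition quotient_of (C T T' : Type) (X : fspace C T) (p : T -> T') :
    fspace C T' :=
  FSpace (p @` points X)
    (fun W => W `<=` p @` points X /\ is_open X (points X `&` p @^-1` W))
    (fun W f => hol X (points X `&` p @^-1` W) (f \o p)).

(* Germ at x of an analytic set: A is, on some open neighbourhood of x, the
   common zero locus of finitely many holomorphic functions. *)
Definition analytic_germ (C : nmodType) T (X : fspace C T) (x : T)
    (A : set T) : Prop :=
  exists U k (f : 'I_k -> T -> C),
    [/\ is_open X U, U x, forall i, hol X U (f i)
      & A `&` U = [set y | U y /\ forall i, f i y = 0]].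

Definition analytic_subset (C : nmodType) T (X : fspace C T) (Z : set T) :
    Prop :=
  Z `<=` points X /\ forall x, points X x -> analytic_germ X x Z.

Definition irreducible_subset (C : nmodType) T (X : fspace C T) (Z : set T) :
    Prop :=
  Z !=set0 /\
  forall Z1 Z2, analytic_subset X Z1 -> analytic_subset X Z2 ->
    Z = Z1 `|` Z2 -> Z = Z1 \/ Z = Z2.

Definition germ_le (C : Type) T (X : fspace C T) (x : T) (A B : set T) : Prop :=
  exists U, [/\ is_open X U, U x & A `&` U `<=` B].

Definition germ_lt (C : Type) T (X : fspace C T) (x : T) (A B : set T) : Prop :=
  germ_le X x A B /\ ~ germ_le X x B A.

Definition germ_eq (C : Type) T (X : fspace C T) (x : T) (A B : set T) : Prop :=
  germ_le X x A B /\ germ_le X x B A.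

Definition irreducible_germ (C : nmodType) T (X : fspace C T) (x : T)
    (A : set T) : Prop :=
  [/\ A x, analytic_germ X x A
    & forall A1 A2, analytic_germ X x A1 -> analytic_germ X x A2 ->
        germ_eq X x A (A1 `|` A2) -> germ_eq X x A A1 \/ germ_eq X x A A2].

Definition germ_component (C : nmodType) T (X : fspace C T) (x : T)
    (Z A : set T) : Prop :=
  [/\ irreducible_germ X x A, germ_le X x A Z
    & forall B, irreducible_germ X x B -> germ_le X x B Z ->
        germ_le X x A B -> germ_eq X x A B].

(* There are irreducible germs A = A_0 < A_1 < ... < A_n at x. Such chains
   correspond to chains of prime ideals descending from the ideal of A in the
   local ring at x. *)
Fixpoint germ_chain (C : nmodType) T (X : fspace C T) (x : T) (n : nat)
    (A : set T) : Prop :=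
  irreducible_germ X x A /\
  if n is m.+1 then exists2 B, germ_lt X x A B & germ_chain X x m B else True.

Definition germ_codim (C : nmodType) T (X : fspace C T) (x : T) (A : set T)
    (n : nat) : Prop :=
  germ_chain X x n A /\ ~ germ_chain X x n.+1 A.

Definition pure_codim (C : nmodType) T (X : fspace C T) (Z : set T) (n : nat) :
    Prop :=
  forall x A, Z x -> germ_component X x Z A -> germ_codim X x A n.

Definition irreducible_divisor (C : nmodType) T (X : fspace C T) (Z : set T) :
    Prop :=
  [/\ analytic_subset X Z, irreducible_subset X Z & pure_codim X Z 1].

(** * The period domain and its quotient *)

Section PeriodDomain.
Variables (C : numClosedFieldType) (n : nat) (G : 'M[int]_n).

Local Notation V := 'rV[C]_n.
Local Notation extC := (map_mx (intr : int -> C)).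

(* Points of the projective space P(V) are the lines <[v]> of V. *)
Definition projective_space : fspace C {vspace V} :=
  quotient_of (subspace_of (affine_space C n) [set v : V | v != 0])
              (fun v => <[v]>%VS).

Definition formC (v w : V) : C := bform (extC G) v w.

Definition conjV (v : V) : V := map_mx Num.conj v.

Definition domD : set {vspace V} :=
  [set L | exists v : V,
     [/\ L = <[v]>%VS, formC v v = 0 & 0 < formC v (conjV v)]].

Definition space_D : fspace C {vspace V} := subspace_of projective_space domD.

Definition hyperplane (l : 'rV[int]_n) : set {vspace V} :=
  [set L | domD L /\ exists v : V, L = <[v]>%VS /\ formC v (extC l) = 0].

Definition divH : set {vspace V} :=
  \bigcup_(l in [set l : 'rV[int]_n | bform G l l = - 1]) hyperplane l.

Definition Gamma_act (g : 'M[int]_n) (L : {vspace V}) : {vspace V} :=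
  (linfun (mulmxr (extC g)) @: L)%VS.

Definition Gamma_orbit (L : {vspace V}) : set {vspace V} :=
  [set Gamma_act g L | g in Aut G].

Definition space_D_mod_Gamma : fspace C (set {vspace V}) :=
  quotient_of space_D Gamma_orbit.

Definition divH_mod_Gamma : set (set {vspace V}) := Gamma_orbit @` divH.

End PeriodDomain.

Arguments space_D_mod_Gamma C {n} G.
Arguments divH_mod_Gamma C {n} G.

(* Main.v *)
(* Near the orbit of v, the quotient of D by Gamma is the quotient of the slice
   <y, conj v> = <v, conj v> of the cone over D by the finite stabiliser of the
   line of v, and a holomorphic function on the slice defines an analytic germ
   of the quotient after symmetrisation. Proper discontinuity of Gamma and local
   finiteness of the hyperplanes come from the majorant
     P_v(x) = (2 / <v, conj v>) (|<x, v>|^2 + |<x, conj v>|^2) - <x, conj x>,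
   which is positive definite because the signature is (2, 10). So H / Gamma is
   locally the image of finitely many hyperplanes, and dividing holomorphic
   functions by their linear equations shows that it has codimension one.
   For irreducibility, Eichler transformations built from two hyperbolic planes
   act transitively on the vectors of norm -1, so that H / Gamma is the image of
   a single H_l. Up to an isometry exchanging its two components, H_l is the
   image of a tube domain; the latter is convex, and on a segment an analytic
   subset is everything or discrete, so one of two analytic subsets covering the
   tube domain is the whole of it. *)

From HB Require Import structures.
From mathcomp Require Import all_boot all_order all_algebra.
From mathcomp Require Import all_classical all_reals all_analysis.
From mathcomp Require Import complex.
From mathcomp Require Import -(notations) mpoly.
From mathcomp Require Import ring lra zify.
Require Import Defs.

Set Implicit Arguments.
Unset Strict Implicit.
Unset Printing Implicit Defensive.

Import Order.TTheory GRing.Theory Num.Theory.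
Import numFieldNormedType.Exports.

Local Open Scope classical_set_scope.
Local Open Scope ring_scope.

(** * Absolutely convergent power series *)

(** Germs on the quotient are germs of sets of orbits, with no coordinates of their own. The
    polynomial retraction [kap] of the ambient space onto the quadric slice turns a germ statement
    at [orb v] into a statement near [v] in affine space, where three facts of function theory
    suffice: zeros in one variable are isolated, germs have no zero divisors, and the order of
    vanishing along a hyperplane is defined. Since codimension is defined by chains of germs, no
    dimension theory is involved: it is enough that an irreducible germ strictly containing the germ
    of one [H_l] is full. The field is kept abstract, and completeness enters through [seq_complete]
    and [monotone_cauchy]. The lattice enters through a [frame], whose eight vectors [u k] have odd
    norm; this is the obstacle in the orbit computation, because an Eichler transformation wants a
    vector of even norm. *)

Definition monom n (a : 'I_n -> nat) : multinom n := Multinom [tuple a i | i < n].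

Lemma monomE n (a : 'I_n -> nat) i : monom a i = a i.
Proof. by rewrite multinomE tnth_mktuple. Qed.

Section MajorantNorm.
Variables (C : numFieldType).
Implicit Types (r B c : C).

(** [B] bounds the weighted l1 norm of the coefficients at radius [r]. Repeated monomials in [s] are
    allowed, so sums and products need no collecting of terms. *)
Definition majorant n r (p : mpoly n C) B :=
  exists2 s : seq (C * multinom n),
    p = \sum_(x <- s) x.1 *: mpolyX C x.2 &
    \sum_(x <- s) `|x.1| * r ^+ mdeg x.2 <= B.

Variables (n : nat) (r : C).
Hypothesis r_ge0 : 0 <= r.
Implicit Types (p q : mpoly n C).

Lemma majorant_ge0 p B : majorant r p B -> 0 <= B.
Proof.
by case=> s _; apply: le_trans; apply: sumr_ge0 => x _; rewrite mulr_ge0 ?exprn_ge0.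
Qed.

Lemma majorantW p B B' : majorant r p B -> B <= B' -> majorant r p B'.
Proof. by case=> s ps sB BB'; exists s => //; exact: le_trans BB'. Qed.

Lemma majorant_radius r' p B : 0 <= r' <= r -> majorant r p B -> majorant r' p B.
Proof.
case/andP=> r'0 r'r [s ps sB]; exists s => //; apply: le_trans sB.
by apply: ler_sum => x _; rewrite ler_wpM2l// lerXn2r// nnegrE.
Qed.

Lemma majorantZX c (m : multinom n) : majorant r (c *: mpolyX C m) (`|c| * r ^+ mdeg m).
Proof. by exists [:: (c, m)]; rewrite !big_seq1. Qed.

Lemma majorant0 : majorant r (0 : mpoly n C) 0.
Proof. by exists [::]; rewrite !big_nil. Qed.

Lemma majorantD p q B B' :
  majorant r p B -> majorant r q B' -> majorant r (p + q) (B + B').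
Proof.
case=> s -> sB [t -> tB']; exists (s ++ t); rewrite !big_cat//=.
exact: lerD.
Qed.

Lemma majorantZ c p B : majorant r p B -> majorant r (c *: p) (`|c| * B).
Proof.
case=> s -> sB; exists [seq (c * x.1, x.2) | x <- s]; rewrite !big_map/=.
  by rewrite scaler_sumr; apply: eq_bigr => x _; rewrite scalerA.
under eq_bigr do rewrite normrM -mulrA.
by rewrite -mulr_sumr ler_wpM2l.
Qed.

Lemma majorantN p B : majorant r p B -> majorant r (- p) B.
Proof. by move/(majorantZ (-1)); rewrite scaleN1r normrN1 mul1r. Qed.

Lemma majorant_sum (I : Type) (s : seq I) (P : pred I) (F : I -> mpoly n C) (b : I -> C) :
  (forall i, P i -> majorant r (F i) (b i)) ->
  majorant r (\sum_(i <- s | P i) F i) (\sum_(i <- s | P i) b i).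
Proof.
move=> H; elim/big_ind2 : _ => //; first exact: majorant0.
by move=> *; exact: majorantD.
Qed.

Lemma majorantM p q B B' :
  majorant r p B -> majorant r q B' -> majorant r (p * q) (B * B').
Proof.
move=> pB qB'; have B0 := majorant_ge0 pB; have B'0 := majorant_ge0 qB'.
case: pB qB' => s -> sB [t -> tB'].
rewrite mulr_suml.
apply: (@majorantW _ (\sum_(x <- s) \sum_(y <- t)
    (`|x.1| * r ^+ mdeg x.2) * (`|y.1| * r ^+ mdeg y.2))).
  apply: majorant_sum => x _; rewrite mulr_sumr; apply: majorant_sum => y _.
  rewrite -scalerAl -scalerAr scalerA -mpolyXD.
  apply: majorantW (majorantZX _ _) _.
  by rewrite normrM mdegD exprD mulrACA lexx.
under eq_bigr do rewrite -mulr_sumr.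
rewrite -mulr_suml; apply: ler_pM => //.
- by apply: sumr_ge0 => x _; rewrite mulr_ge0 ?exprn_ge0.
- by apply: sumr_ge0 => x _; rewrite mulr_ge0 ?exprn_ge0.
Qed.

Lemma majorantC c : majorant r (mpolyC n c) `|c|.
Proof.
have := majorantZX c (@mnm0 n).
by rewrite mdeg0 expr0 mulr1 mpolyX0 alg_mpolyC.
Qed.

Lemma majorantX (i : 'I_n) : majorant r (mpolyX C (mnm1 i)) r.
Proof. by have := majorantZX 1 (mnm1 i); rewrite mdeg1 expr1 normr1 mul1r scale1r. Qed.

Lemma majorantXn p B k : majorant r p B -> majorant r (p ^+ k) (B ^+ k).
Proof.
move=> pB; elim: k => [|k IH]; last by rewrite !exprS; exact: majorantM.
by rewrite !expr0; have := majorantC 1; rewrite normr1.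
Qed.

Lemma majorant_prod (I : Type) (s : seq I) (P : pred I) (F : I -> mpoly n C) (b : I -> C) :
  (forall i, P i -> majorant r (F i) (b i)) ->
  majorant r (\prod_(i <- s | P i) F i) (\prod_(i <- s | P i) b i).
Proof.
move=> H; elim/big_ind2 : _ => //; last by move=> *; exact: majorantM.
by have := majorantC 1; rewrite normr1.
Qed.

Lemma majorant_meval p B z :
  majorant r p B -> (forall i, `|z i| <= r) -> `|meval z p| <= B.
Proof.
case=> s -> sB zr; rewrite raddf_sum /=; apply: le_trans sB.
apply: (le_trans (ler_norm_sum _ _ _)); apply: ler_sum => x _.
rewrite mevalZ normrM ler_wpM2l// mevalX normr_prod mdegE -prodrXr.
by apply: ler_prod => i _; rewrite normr_ge0 normrX lerXn2r// nnegrE.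
Qed.

(** Passing from a representation with repetitions to the true coefficients is the triangle
    inequality; a monomial with an exponent at least [N] meets no index of the box. *)
Lemma majorant_coef p B N : majorant r p B ->
  \sum_(a : {ffun 'I_n -> 'I_N})
     `|mcoeff (monom (fun i => a i)) p| * \prod_i r ^+ a i <= B.
Proof.
case=> s -> sB; apply: le_trans sB.
under eq_bigr do rewrite raddf_sum /=.
apply: (@le_trans _ _ (\sum_(a : {ffun 'I_n -> 'I_N}) \sum_(x <- s)
   (`|x.1| * r ^+ mdeg x.2) *+ (x.2 == (monom (fun i => a i))))).
  apply: ler_sum => a _.
  have -> : \prod_i r ^+ a i = r ^+ mdeg (monom (fun i => a i)).
    by rewrite mdegE -prodrXr; apply: eq_bigr => i _; rewrite monomE.
  apply: le_trans (_ : _ <= (\sum_(x <- s) `|x.1| *+ (x.2 == (monom (fun i => a i))))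
      * r ^+ mdeg (monom (fun i => a i))) _.
    rewrite ler_wpM2r ?exprn_ge0//; apply: le_trans (ler_norm_sum _ _ _) _.
    apply: ler_sum => x _; rewrite mcoeffZ mcoeffX.
    by case: eqP; rewrite ?mulr1 ?mulr0 ?normr0.
  rewrite mulr_suml; apply: ler_sum => x _.
  by case: eqP => [->|]; rewrite ?mulr1n ?mulr0n ?mul0r.
rewrite exchange_big; apply: ler_sum => x _ /=.
have [a xa|nx] := pickP (fun a : {ffun 'I_n -> 'I_N} => x.2 == (monom (fun i => a i))).
  rewrite (bigD1 a)//= xa big1 ?addr0// => b ba.
  case: eqP => // xb; case/eqP: ba; apply/ffunP => i; apply/val_inj.
  by move/eqP: xa; rewrite xb => /mnmP/(_ i); rewrite !monomE.
by rewrite big1 ?mulr_ge0 ?exprn_ge0// => a _; rewrite nx.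
Qed.

End MajorantNorm.

Section MajorantComp.
Variables (C : numFieldType) (n k : nat) (r rho : C).
Hypotheses (r_ge0 : 0 <= r) (rho_ge0 : 0 <= rho).

Lemma majorant_comp (p : mpoly n C) (q : n.-tuple (mpoly k C)) B :
  majorant r p B -> (forall i, majorant rho (tnth q i) r) ->
  majorant rho (comp_mpoly q p) B.
Proof.
case=> s -> sB qr; rewrite raddf_sum /=; apply: majorantW sB => //.
apply: majorant_sum => // x _; rewrite comp_mpolyZ; apply: majorantZ => //.
rewrite comp_mpolyX mdegE -prodrXr.
by apply: majorant_prod => // i _; exact: majorantXn.
Qed.

End MajorantComp.

(** Without constant term every monomial carries a factor [d' <= 1], so the norm at radius [d'] is
    at most [B * d']; the choice [e / (B + e)] is at most 1 and makes this at most [e]. *)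
Lemma majorant_small (C : numFieldType) n (q : mpoly n C) (e : C) :
  0 < e -> mcoeff (@mnm0 n) q = 0 ->
  exists2 d : C, 0 < d & forall d', 0 <= d' <= d -> majorant d' q e.
Proof.
move=> e0 q0; pose B := \sum_(m <- msupp q) `|mcoeff m q|.
have B0 : 0 <= B by apply: sumr_ge0.
have Be : 0 < B + e by rewrite ltr_wpDl.
exists (e / (B + e)); first by rewrite divr_gt0.
move=> d /andP[d0 dB].
have d1 : d <= 1 by apply: le_trans dB _; rewrite ler_pdivrMr// mul1r lerDr.
rewrite [q]mpolyE.
apply: (@majorantW _ _ _ _ (\sum_(m <- msupp q) `|mcoeff m q| * d ^+ mdeg m)).
  by apply: majorant_sum => m _; exact: majorantZX.
apply: (@le_trans _ _ (B * d)).
  rewrite mulr_suml big_seq [leRHS]big_seq; apply: ler_sum => m mq.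
  rewrite ler_wpM2l//; case: (posnP (mdeg m)) => [/eqP|m0].
    rewrite mdeg_eq0 => /eqP m0; move: mq; rewrite m0 mcoeff_msupp q0 eqxx //.
  by rewrite -{2}(expr1 d) ler_wiXn2l.
apply: (@le_trans _ _ (B * (e / (B + e)))); first by rewrite ler_wpM2l.
by rewrite mulrCA ler_piMr ?(ltW e0)// ler_pdivrMr// mul1r lerDl (ltW e0).
Qed.

(** * Convergence of sequences in an abstract numeric field *)

Section Sequences.
Variable C : numFieldType.
Implicit Types (u v : nat -> C).

Definition cauchy_seq u :=
  forall e : C, 0 < e -> exists N, forall i j, (N <= i)%N -> (N <= j)%N -> `|u i - u j| <= e.

Definition tends u l :=
  forall e : C, 0 < e -> exists N, forall i, (N <= i)%N -> `|u i - l| <= e.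

Definition seq_complete := forall u, cauchy_seq u -> exists l, tends u l.

(** Plays the part of the Archimedean property: geometric sequences tend to 0 and the integers are
    unbounded. *)
Definition monotone_cauchy := forall u M,
  (forall i j, (i <= j)%N -> u i <= u j) -> (forall i, 0 <= u i <= M) -> cauchy_seq u.

(** The sign conditions make [x] and [y] comparable, the order of [C] being partial. *)
Lemma le_eps (x y : C) : 0 <= y -> 0 <= x -> (forall e : C, 0 < e -> x <= y + e) -> x <= y.
Proof.
move=> y0 x0 H; apply/negPn/negP => nxy.
have xy : y < x by rewrite real_ltNge ?ger0_real.
have := H ((x - y) / 2); rewrite divr_gt0 ?subr_gt0// => /(_ isT).
apply/negP; rewrite -real_ltNge ?realD ?ger0_real ?divr_ge0 ?subr_ge0// ?(ltW xy)//.
rewrite -ltrBrDl ltr_pdivrMr ?ltr0n// mulr_natr mulr2n ltrDl subr_gt0//.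
Qed.

Lemma norm_eps (x y : C) : (forall e : C, 0 < e -> `|x - y| <= e) -> x = y.
Proof.
move=> H; apply/eqP; rewrite -subr_eq0 -normr_eq0 eq_le normr_ge0 andbT.
by apply: le_eps => // e e0; rewrite add0r H.
Qed.

Lemma tends_unique u l l' : tends u l -> tends u l' -> l = l'.
Proof.
move=> ul ul'; apply: norm_eps => e e0.
have [N HN] := ul _ (divr_gt0 e0 (ltr0n C 2)).
have [N' HN'] := ul' _ (divr_gt0 e0 (ltr0n C 2)).
rewrite -(subrK (u (maxn N N')) l) -addrA.
apply: le_trans (ler_normD _ _) _; rewrite [leRHS](splitr e) distrC.
by rewrite lerD ?HN ?HN' ?leq_maxl ?leq_maxr.
Qed.

Lemma tends_cst c : tends (fun=> c) c.
Proof. by move=> e e0; exists 0%N => i _; rewrite subrr normr0 ltW. Qed.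

Lemma tends_ext u v l : (forall i, u i = v i) -> tends u l -> tends v l.
Proof. by move=> uv ul e /ul[N HN]; exists N => i /HN; rewrite uv. Qed.

Lemma tendsD u v l l' : tends u l -> tends v l' -> tends (fun i => u i + v i) (l + l').
Proof.
move=> ul vl' e e0.
have [N HN] := ul _ (divr_gt0 e0 (ltr0n C 2)).
have [N' HN'] := vl' _ (divr_gt0 e0 (ltr0n C 2)).
exists (maxn N N') => i; rewrite geq_max => /andP[Ni N'i].
by rewrite opprD addrACA (splitr e) (le_trans (ler_normD _ _))// lerD ?HN ?HN'.
Qed.

Lemma tendsZ c u l : tends u l -> tends (fun i => c * u i) (c * l).
Proof.
move=> ul e e0; have c1 : 0 < `|c| + 1 by rewrite ltr_wpDl.
have [N HN] := ul _ (divr_gt0 e0 c1).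
exists N => i /HN H; rewrite -mulrBr normrM.
apply: (@le_trans _ _ ((`|c| + 1) * (e / (`|c| + 1)))); last by rewrite mulrC divfK ?gt_eqF.
by rewrite ler_pM// lerDl.
Qed.

Lemma tends_bounded u l : tends u l -> exists2 M : C, 0 < M & exists N, forall i, (N <= i)%N -> `|u i| <= M.
Proof.
move=> ul; have [N HN] := ul 1 ltr01; exists (`|l| + 1); first by rewrite ltr_wpDl.
by exists N => i /HN H; rewrite -(subrK l (u i)) addrC (le_trans (ler_normD _ _))// lerD2l.
Qed.

Lemma tendsM u v l l' : tends u l -> tends v l' -> tends (fun i => u i * v i) (l * l').
Proof.
move=> ul vl'.
have [M M0 [K HK]] := tends_bounded vl'.
have H : tends (fun i => (u i - l) * v i) 0.
  move=> e e0; have [N HN] := ul _ (divr_gt0 e0 M0).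
  exists (maxn N K) => i; rewrite geq_max => /andP[Ni Ki].
  have -> : e = e / M * M by rewrite divfK// gt_eqF.
  by rewrite subr0 normrM ler_pM ?HN ?HK.
have := tendsD H (tendsZ l vl'); rewrite add0r; apply: tends_ext => i.
by rewrite mulrBl subrK.
Qed.

Lemma tends_bound u l B N : tends u l -> 0 <= B -> (forall i, (N <= i)%N -> `|u i| <= B) -> `|l| <= B.
Proof.
move=> ul B0 uB; apply: le_eps => // e /ul[K HK].
rewrite -(subrK (u (maxn N K)) l) addrC; apply: le_trans (ler_normD _ _) _.
by rewrite lerD ?uB ?leq_maxl// distrC HK ?leq_maxr.
Qed.

Lemma tends_shift u l k : tends u l -> tends (fun i => u (k + i)%N) l.
Proof. by move=> ul e /ul[N HN]; exists N => i Ni; rewrite HN// (leq_trans Ni) ?leq_addl. Qed.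

(** Consecutive differences of [r ^+ k] are [r ^+ k * (1 - r)], so a Cauchy bound on them already
    bounds [r ^+ k]; the sequence [1 - r ^+ k] is used because it increases. *)
Lemma geometric_tends0 (r : C) : monotone_cauchy -> 0 <= r < 1 -> tends (fun k => r ^+ k) 0.
Proof.
move=> mc /andP[r0 r1].
have H : cauchy_seq (fun k => 1 - r ^+ k).
  apply: (mc _ 1).
- move=> i j ij; rewrite lerD2l lerN2 ler_wiXn2l ?(ltW r1)//.
- by move=> i; rewrite subr_ge0 exprn_ile1 ?(ltW r1)// gerBl exprn_ge0.
move=> e e0.
have r1' : 0 < 1 - r by rewrite subr_gt0.
have [|N HN] := H (e * (1 - r)); first by rewrite mulr_gt0.
exists N => i Ni; rewrite subr0 ger0_norm ?exprn_ge0//.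
have := HN i i.+1 Ni (leqW Ni).
have -> : 1 - r ^+ i - (1 - r ^+ i.+1) = - (r ^+ i * (1 - r)) by rewrite exprS; ring.
by rewrite normrN normrM (gtr0_norm r1') ler_pM2r// ger0_norm ?exprn_ge0.
Qed.

End Sequences.

(** * Cauchy sequences of polynomials for the majorant norm *)

Section CauchyPolynomials.
Variables (C : numFieldType) (n : nat) (r : C).
Hypothesis r_ge0 : 0 <= r.
Implicit Types (p q : nat -> mpoly n C).

Definition poly_cauchy p :=
  forall e : C, 0 < e -> exists N, forall i j, (N <= i)%N -> (N <= j)%N ->
    majorant r (p i - p j) e.

Lemma poly_cauchy_cst (c : mpoly n C) : poly_cauchy (fun=> c).
Proof.
move=> e e0; exists 0%N => i j _ _; rewrite subrr.
by apply: majorantW (ltW e0) => //; exact: majorant0.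
Qed.

Lemma poly_cauchy_ext p q : p =1 q -> poly_cauchy p -> poly_cauchy q.
Proof. by move=> pq pc e /pc[N HN]; exists N => *; rewrite -!pq; exact: HN. Qed.

Lemma poly_cauchyD p q : poly_cauchy p -> poly_cauchy q -> poly_cauchy (fun i => p i + q i).
Proof.
move=> cp cq e e0; have e2 : 0 < e / 2 by rewrite divr_gt0.
have [N HN] := cp _ e2; have [K HK] := cq _ e2.
exists (maxn N K) => i j; rewrite !geq_max => /andP[Ni Ki] /andP[Nj Kj].
by rewrite opprD addrACA (splitr e); apply: majorantD => //; [exact: HN|exact: HK].
Qed.

Lemma poly_cauchyM p q B B' : (forall i, majorant r (p i) B) -> (forall i, majorant r (q i) B') ->
  poly_cauchy p -> poly_cauchy q -> poly_cauchy (fun i => p i * q i).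
Proof.
move=> pB qB' cp cq e e0.
have B0 := majorant_ge0 r_ge0 (pB 0%N); have B'0 := majorant_ge0 r_ge0 (qB' 0%N).
have D0 : 0 < B + B' + 1 by rewrite ltr_wpDl ?addr_ge0.
have e2 : 0 < e / (B + B' + 1) by rewrite divr_gt0.
have [N HN] := cp _ e2; have [K HK] := cq _ e2.
exists (maxn N K) => i j; rewrite !geq_max => /andP[Ni Ki] /andP[Nj Kj].
have -> : p i * q i - p j * q j = p i * (q i - q j) + (p i - p j) * q j by ring.
apply: majorantW (majorantD (majorantM r_ge0 (pB i) (HK i j Ki Kj))
  (majorantM r_ge0 (HN i j Ni Nj) (qB' j))) _ => //.
rewrite [leLHS](_ : _ = (B + B') * (e / (B + B' + 1))); last by ring.
by rewrite mulrCA ler_piMr ?(ltW e0)// ler_pdivrMr// mul1r lerDl.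
Qed.

End CauchyPolynomials.

Section CauchyComp.
Variables (C : numFieldType) (n k : nat) (r : C).
Hypothesis r_ge0 : 0 <= r.

Lemma poly_cauchy_comp (p : mpoly n C) (q : nat -> n.-tuple (mpoly k C)) B :
  (forall l i, majorant r (tnth (q l) i) B) -> (forall i, poly_cauchy r (fun l => tnth (q l) i)) ->
  poly_cauchy r (fun l => comp_mpoly (q l) p).
Proof.
move=> qB qc.
have qM f g b b' : (forall l, majorant r (f l) b) -> (forall l, majorant r (g l) b') ->
    poly_cauchy r f -> poly_cauchy r g -> poly_cauchy r (fun l => f l * g l : mpoly k C).
  exact: poly_cauchyM.
have cst c : poly_cauchy r (fun=> c : mpoly k C) by exact: poly_cauchy_cst.
have prodc m (s : seq 'I_n) : poly_cauchy r (fun l => \prod_(i <- s) tnth (q l) i ^+ m i) /\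
    exists B', forall l, majorant r (\prod_(i <- s) tnth (q l) i ^+ m i) B'.
  elim: s => [|i s [IHc [B' IHB]]].
    split; last by exists `|1| => l; rewrite big_nil; exact: majorantC.
    by apply: poly_cauchy_ext (cst 1) => l; rewrite big_nil.
  have expB t l : majorant r (tnth (q l) i ^+ t) (B ^+ t) by exact: majorantXn.
  have expc t : poly_cauchy r (fun l => tnth (q l) i ^+ t).
    elim: t => [|t IHt]; first exact: cst.
    by apply: poly_cauchy_ext (qM _ _ _ _ (fun l => qB l i) (expB t) (qc i) IHt) => l; rewrite exprS.
  split; first by apply: poly_cauchy_ext (qM _ _ _ _ (expB _) IHB (expc (m i)) IHc) => l; rewrite big_cons.
  by exists (B ^+ m i * B') => l; rewrite big_cons; exact: majorantM.
apply: (@poly_cauchy_ext _ _ _ (fun l => \sum_(m <- msupp p) mcoeff m p *: \prod_(i < n) tnth (q l) i ^+ m i)).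
  by move=> l; rewrite comp_mpolyE.
elim: (msupp p) => [|m s IH]; first by apply: poly_cauchy_ext (cst 0) => l; rewrite big_nil.
have [c [B' HB]] := prodc m (index_enum 'I_n).
have H := qM _ _ _ _ (fun=> majorantC k r (mcoeff m p)) HB (cst (mpolyC k (mcoeff m p))) c.
by apply: poly_cauchy_ext (poly_cauchyD H IH) => l; rewrite big_cons -mul_mpolyC.
Qed.

End CauchyComp.

Definition near_pt (C : numFieldType) n (e : C) (w z : 'rV[C]_n) : Prop :=
  forall i, `|z 0 i - w 0 i| < e.

Definition meval_at (C : numFieldType) n (w z : 'rV[C]_n) (p : mpoly n C) : C :=
  meval (fun i => z 0 i - w 0 i) p.

(** * Analytic germs as limits of polynomials *)

Section Approx.
Variables (C : numFieldType).
Hypothesis Cmono : monotone_cauchy C.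

(* Limits of polynomials for the majorant norm are stable under sums, products
   and composition, and over a complete field they are the sums of power series
   of [analytic_at]. *)
Definition appr n (w : 'rV[C]_n) (r : C) (f : 'rV[C]_n -> C) (B : C) :=
  exists p : nat -> mpoly n C,
  [/\ forall j, majorant r (p j) B, poly_cauchy r p
    & forall z, near_pt r w z -> tends (fun j => meval_at w z (p j)) (f z)].

Lemma appr_ge0 n (w : 'rV[C]_n) (r : C) f B : 0 <= r -> appr w r f B -> 0 <= B.
Proof. by move=> r0 [p [/(_ 0%N) /(majorant_ge0 r0)]]. Qed.

Lemma appr_bound n (w : 'rV[C]_n) (r : C) f B z : 0 <= r -> appr w r f B -> near_pt r w z -> `|f z| <= B.
Proof.
move=> r0 [p [pB _ pf]] wz; apply: (tends_bound (N := 0) (pf z wz)).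
  exact: majorant_ge0 (pB 0%N).
by move=> i _; apply: majorant_meval (pB i) _ => // j; apply: ltW.
Qed.

Lemma appr_radius n (w : 'rV[C]_n) (r : C) (r' : C) f B : 0 <= r' <= r -> appr w r f B -> appr w r' f B.
Proof.
move=> rr' [p [pB pc pf]]; have r0 : 0 <= r by case/andP: rr' => /le_trans H /H.
exists p; split.
- by move=> j; apply: majorant_radius (pB j).
- by move=> e /pc[N HN]; exists N => i j Ni Nj; apply: majorant_radius (HN i j Ni Nj).
- move=> z wz; apply: pf => i; apply: lt_le_trans (wz i) _; by case/andP: rr'.
Qed.

Lemma appr_ext n (w : 'rV[C]_n) (r : C) f g B : (forall z, near_pt r w z -> f z = g z) ->
  appr w r f B -> appr w r g B.
Proof. by move=> fg [p [pB pc pf]]; exists p; split => // z wz; rewrite -fg// ; exact: pf. Qed.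

Lemma apprW n (w : 'rV[C]_n) (r : C) f B B' : B <= B' -> appr w r f B -> appr w r f B'.
Proof. by move=> BB' [p [pB pc pf]]; exists p; split => // j; apply: majorantW BB'. Qed.

Lemma appr_cst n (w : 'rV[C]_n) (r : C) c : 0 <= r -> appr w r (fun=> c) `|c|.
Proof.
move=> r0; exists (fun=> mpolyC n c); split.
- by move=> j; exact: majorantC.
- exact: poly_cauchy_cst.
- by move=> z _; rewrite /meval_at mevalC; exact: tends_cst.
Qed.

Lemma appr_coord n (w : 'rV[C]_n) (r : C) i : 0 <= r -> appr w r (fun z => z 0 i - w 0 i) r.
Proof.
move=> r0; exists (fun=> mpolyX C (mnm1 i)); split.
- by move=> j; exact: majorantX.
- exact: poly_cauchy_cst.
- by move=> z _; rewrite /meval_at mevalXU; exact: tends_cst.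
Qed.

Lemma apprD n (w : 'rV[C]_n) (r : C) f g B B' : 0 <= r ->
  appr w r f B -> appr w r g B' -> appr w r (fun z => f z + g z) (B + B').
Proof.
move=> r0 [p [pB pc pf]] [q [qB qc qf]]; exists (fun i => p i + q i); split.
- by move=> j; exact: majorantD.
- exact: poly_cauchyD.
- move=> z wz; apply: tends_ext (tendsD (pf z wz) (qf z wz)) => i.
  by rewrite /meval_at mevalD.
Qed.

Lemma apprM n (w : 'rV[C]_n) (r : C) f g B B' : 0 <= r ->
  appr w r f B -> appr w r g B' -> appr w r (fun z => f z * g z) (B * B').
Proof.
move=> r0 [p [pB pc pf]] [q [qB qc qf]]; exists (fun i => p i * q i); split.
- by move=> j; exact: majorantM.
- exact: poly_cauchyM pB qB pc qc.
- move=> z wz; apply: tends_ext (tendsM (pf z wz) (qf z wz)) => i.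
  by rewrite /meval_at mevalM.
Qed.

Lemma tends_meval n (p : mpoly n C) (u : nat -> 'I_n -> C) (v : 'I_n -> C) :
  (forall i, tends (fun l => u l i) (v i)) -> tends (fun l => meval (u l) p) (meval v p).
Proof.
move=> uv; rewrite mevalE; apply: (@tends_ext _ (fun l =>
  \sum_(m <- msupp p) mcoeff m p * \prod_i u l i ^+ m i)) => [l|]; first by rewrite mevalE.
elim: (msupp p) => [|m s IH].
  by rewrite big_nil; apply: (tends_ext _ (tends_cst 0)) => l; rewrite big_nil.
rewrite big_cons; apply: (tends_ext _ (tendsD (tendsZ _ _) IH)); first by move=> l; rewrite big_cons.
elim: (index_enum _) => [|i t IHt].
  by rewrite big_nil; apply: (tends_ext _ (tends_cst 1)) => l; rewrite big_nil.
rewrite big_cons; apply: (tends_ext _ (tendsM _ IHt)); first by move=> l; rewrite big_cons.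
elim: (m i) => [|j IHj]; first by apply: (tends_ext _ (tends_cst 1)) => l; rewrite expr0.
by rewrite exprS; apply: (tends_ext _ (tendsM (uv i) IHj)) => l; rewrite exprS.
Qed.

Lemma eps_seq : exists2 e : nat -> C, (forall i, 0 < e i) & tends e 0.
Proof.
exists (fun i => 2^-1 ^+ i); first by move=> i; rewrite exprn_gt0// invr_gt0.
apply: geometric_tends0 => //; rewrite invr_ge0 ler0n invf_lt1 ?ltr1n//.
Qed.

(** The strict inequality [r' < r] keeps the values of the inner functions inside the open polydisc
    on which [f] is the limit of its polynomials. *)
Lemma appr_comp n k (w : 'rV[C]_n) (u : 'rV[C]_k) (r r' rho : C) f (h : 'I_n -> 'rV[C]_k -> C) B :
  0 <= r' -> r' < r -> 0 <= rho ->
  appr w r f B -> (forall i, appr u rho (h i) r') ->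
  appr u rho (fun z => f (w + \row_i h i z)) B.
Proof.
move=> r'0 r'r rho0 [p [pB pc pf]] hA.
have r0 : 0 <= r by apply: le_trans r'0 (ltW r'r).
have [q Hq] := choice hA.
pose Q l := [tuple q i l | i < n].
have QE l i : tnth (Q l) i = q i l by rewrite tnth_mktuple.
have QB l i : majorant rho (tnth (Q l) i) r' by rewrite QE; case: (Hq i).
have Qr l i : majorant rho (tnth (Q l) i) r by apply: majorantW (ltW r'r).
have Qc j : poly_cauchy rho (fun l => comp_mpoly (Q l) (p j)).
  apply: (poly_cauchy_comp rho0 _ QB) => i.
  by case: (Hq i) => _ qc _ e /qc[N HN]; exists N => a b Na Nb; rewrite !QE; exact: HN.
have [e e0 et] := eps_seq.
(* Diagonal choice: from the index [L j] on, the inner polynomials change the composite with [p j]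
   by at most [e j]. *)
have [L HL] := choice (fun j => Qc j (e j) (e0 j)).
exists (fun j => comp_mpoly (Q (L j)) (p j)); split.
- by move=> j; apply: majorant_comp (pB j) _.
- move=> d d0; have d3 : 0 < d / 3 by rewrite divr_gt0.
  have [N HN] := pc _ d3; have [K HK] := et _ d3.
  exists (maxn N K) => i j; rewrite !geq_max => /andP[Ni Ki] /andP[Nj Kj].
  (* Both composites are compared through the common inner approximation [l]. *)
  set l := maxn (L i) (L j).
  have -> : comp_mpoly (Q (L i)) (p i) - comp_mpoly (Q (L j)) (p j) =
    (comp_mpoly (Q (L i)) (p i) - comp_mpoly (Q l) (p i)) + comp_mpoly (Q l) (p i - p j)
    + (comp_mpoly (Q l) (p j) - comp_mpoly (Q (L j)) (p j)).
    by rewrite comp_mpolyB !addrA !subrK.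
  have -> : d = d / 3 + d / 3 + d / 3 by field.
  have He a : (K <= a)%N -> e a <= d / 3.
    by move=> /HK; rewrite subr0 ger0_norm// ltW.
  apply: majorantD => //; first apply: majorantD => //.
  + by apply: majorantW (He i Ki) => //; apply: HL; rewrite ?leq_maxl.
  + by apply: majorant_comp (HN i j Ni Nj) _.
  + by apply: majorantW (He j Kj) => //; apply: HL; rewrite ?leq_maxr.
- move=> z uz.
  have hz i : `|h i z| <= r' by case: (Hq i) => qB qc qh; apply: appr_bound uz => //; exists (q i).
  have wz : near_pt r w (w + \row_i h i z).
    by move=> i; rewrite !mxE addrAC subrr add0r; apply: le_lt_trans (hz i) _.
  have pt := pf _ wz.
  have qt j : tends (fun l => meval_at u z (comp_mpoly (Q l) (p j))) (meval_at w (w + \row_i h i z) (p j)).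
    have := @tends_meval n (p j) (fun l i => meval_at u z (q i l)) (fun i => h i z).
    move=> H; have {}H : tends (fun l => meval (fun i => meval_at u z (q i l)) (p j)) (meval (fun i => h i z) (p j)).
      by apply: H => i; case: (Hq i) => _ _; exact.
    rewrite /meval_at (meval_eq (v2 := fun i => h i z)); last first.
      by move=> i; rewrite !mxE addrAC subrr add0r.
    apply: tends_ext H => l; rewrite comp_mpoly_meval; apply: meval_eq => i.
    by rewrite QE.
  move=> d d0; have d2 : 0 < d / 2 by rewrite divr_gt0.
  have [N HN] := pt _ d2; have [K HK] := et _ d2.
  exists (maxn N K) => j; rewrite geq_max => /andP[Nj Kj].
  rewrite -(subrK (meval_at w (w + \row_i h i z) (p j)) (meval_at u z _)) -addrA.
  apply: le_trans (ler_normD _ _) _; rewrite (splitr d); apply: lerD; last exact: HN.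
  apply: (@le_trans _ _ (e j)); last by have := HK j Kj; rewrite subr0 ger0_norm// ltW.
  have t := tendsD (tends_cst (meval_at u z (comp_mpoly (Q (L j)) (p j)))) (tendsZ (-1) (qt j)).
  rewrite mulN1r in t; apply: (tends_bound (N := L j) t); first exact: ltW.
  move=> i Li; rewrite mulN1r /meval_at -mevalB.
  by apply: (majorant_meval rho0 (HL j _ _ (leqnn _) Li)) => a; apply: ltW.
Qed.

Lemma min_pos (e e' : C) : 0 < e -> 0 < e' -> exists2 d : C, 0 < d & d <= e /\ d <= e'.
Proof.
move=> e0 e'0; have [ee|ee] := real_leP (gtr0_real e0) (gtr0_real e'0).
  by exists e.
by exists e' => //; split=> //; exact: ltW.
Qed.

Lemma finite_min (I : eqType) (s : seq I) (P : I -> C -> Prop) :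
  (forall i, i \in s -> exists2 d : C, 0 < d & P i d) ->
  (forall i (d d' : C), d' <= d -> P i d -> P i d') ->
  exists2 d : C, 0 < d & forall i, i \in s -> P i d.
Proof.
move=> H mono; elim: s H => [|a s IH] H; first by exists 1.
have [|d d0 Hd] := IH; first by move=> i si; apply: H; rewrite inE si orbT.
have [d' d'0 Hd'] := H a (mem_head _ _); have [c c0 [cd cd']] := min_pos d0 d'0.
exists c => // i; rewrite inE => /predU1P[->|si]; first exact: mono Hd'.
by apply: mono (Hd i si).
Qed.

Lemma finite_radius (I : finType) (P : I -> C -> Prop) :
  (forall i, exists2 rho : C, 0 < rho & forall d, 0 <= d <= rho -> P i d) ->
  exists2 rho : C, 0 < rho & forall i d, 0 <= d <= rho -> P i d.
Proof.
move=> H; have [i _|i d d' dd Hd c /andP[c0 cd]|rho rho0 HP] :=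
  @finite_min _ (enum I) (fun i rho => forall d, 0 <= d <= rho -> P i d).
- exact: H.
- by apply: Hd; rewrite c0 (le_trans cd).
- by exists rho => // i; apply: HP; rewrite mem_enum.
Qed.

Lemma finite_bound (I : finType) (r : C) (a : I -> C) : 0 < r -> (forall i, 0 <= a i < r) ->
  exists2 M : C, 0 <= M < r & forall i, a i <= M.
Proof.
move=> r0 H.
have : exists2 M : C, 0 <= M < r & forall i, i \in enum I -> a i <= M.
  elim: (enum I) => [|i s [M /andP[M0 Mr] IH]]; first by exists 0; rewrite ?lexx.
  have /andP[a0 ar] := H i.
  have [aM|Ma] := real_leP (ger0_real a0) (ger0_real M0).
    exists M; rewrite ?M0// => j; rewrite inE => /predU1P[->//|]; exact: IH.
  exists (a i); rewrite ?a0// => j; rewrite inE => /predU1P[->//|/IH /le_trans]; apply; exact: ltW.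
by case=> M ? HM; exists M => // i; apply: HM; rewrite mem_enum.
Qed.

Definition an n (w : 'rV[C]_n) (f : 'rV[C]_n -> C) := exists2 r : C, 0 < r & exists B, appr w r f B.

Definition locally n (w : 'rV[C]_n) (P : 'rV[C]_n -> Prop) :=
  exists2 e : C, 0 < e & forall z, near_pt e w z -> P z.

Lemma near_ptW n (e e' : C) (w z : 'rV[C]_n) : e <= e' -> near_pt e w z -> near_pt e' w z.
Proof. by move=> ee' H i; apply: lt_le_trans (H i) _. Qed.

Lemma near_pt_refl n (e : C) (w : 'rV[C]_n) : 0 < e -> near_pt e w w.
Proof. by move=> e0 i; rewrite subrr normr0. Qed.

Lemma locallyI n (w : 'rV[C]_n) P Q : locally w P -> locally w Q -> locally w (fun z => P z /\ Q z).
Proof.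
move=> [e e0 eP] [e' e'0 eQ]; have [d d0 [de de']] := min_pos e0 e'0.
exists d => // z wz; split; [apply: eP|apply: eQ]; exact: near_ptW wz.
Qed.

Lemma locallyS n (w : 'rV[C]_n) (P Q : _ -> Prop) : (forall z, P z -> Q z) -> locally w P -> locally w Q.
Proof. by move=> PQ [e e0 eP]; exists e => // z /eP /PQ. Qed.

Lemma locally_pt n (w : 'rV[C]_n) P : locally w P -> P w.
Proof. by case=> e e0; apply; exact: near_pt_refl. Qed.

Lemma locallyT n (w : 'rV[C]_n) (P : _ -> Prop) : (forall z, P z) -> locally w P.
Proof. by move=> H; exists 1. Qed.

Lemma locally_fin n (w : 'rV[C]_n) (I : finType) (P : I -> 'rV[C]_n -> Prop) :
  (forall i, locally w (P i)) -> locally w (fun z => forall i, P i z).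
Proof.
move=> H; have [i|rho r0 Hr] := @finite_radius I (fun i d => forall z, near_pt d w z -> P i z).
  have [e e0 He] := H i; exists e => // d /andP[d0 de] z wz; apply: He; exact: near_ptW wz.
by exists rho => // z wz i; apply: Hr wz; rewrite lexx ltW.
Qed.

Lemma locally_seq n (w : 'rV[C]_n) (I : eqType) (s : seq I) (P : I -> 'rV[C]_n -> Prop) :
  (forall i, i \in s -> locally w (P i)) -> locally w (fun z => forall i, i \in s -> P i z).
Proof.
elim: s => [|a s IH] H; first exact: locallyT.
have Hs i : i \in s -> locally w (P i) by move=> si; apply: H; rewrite inE si orbT.
have := locallyI (H a (mem_head _ _)) (IH Hs).
apply: locallyS => z [Pa Ps] i.
by rewrite inE => /predU1P[->//|]; exact: Ps.
Qed.

Lemma an_ext n (w : 'rV[C]_n) f g : locally w (fun z => f z = g z) -> an w f -> an w g.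
Proof.
case=> e e0 fg [r r0 [B fB]]; have [d d0 [de dr]] := min_pos e0 r0.
exists d => //; exists B; apply: (@appr_ext _ _ _ f).
  by move=> z wz; apply: fg; exact: near_ptW wz.
by apply: appr_radius fB; rewrite dr ltW.
Qed.

Lemma an_cst n (w : 'rV[C]_n) c : an w (fun=> c).
Proof. by exists 1 => //; exists `|c|; exact: appr_cst. Qed.

Lemma an_coord n (w : 'rV[C]_n) i : an w (fun z => z 0 i).
Proof.
exists 1 => //; exists (1 + `|w 0 i|).
apply: appr_ext (apprD ler01 (appr_coord w i ler01) (appr_cst w (w 0 i) ler01)) => z _.
by rewrite subrK.
Qed.

Lemma an_binop n (w : 'rV[C]_n) f g : an w f -> an w g ->
  exists2 r : C, 0 < r & exists B B', appr w r f B /\ appr w r g B'.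
Proof.
case=> [r r0 [B fB]] [r' r'0 [B' gB']]; have [d d0 [de dr]] := min_pos r0 r'0.
exists d => //; exists B, B'; split; [apply: appr_radius fB|apply: appr_radius gB'].
  by rewrite de ltW.
by rewrite dr ltW.
Qed.

Lemma anD n (w : 'rV[C]_n) f g : an w f -> an w g -> an w (fun z => f z + g z).
Proof.
move=> /an_binop H /H[r r0 [B [B' [fB gB']]]]; exists r => //; exists (B + B').
by apply: apprD => //; exact: ltW.
Qed.

Lemma anM n (w : 'rV[C]_n) f g : an w f -> an w g -> an w (fun z => f z * g z).
Proof.
move=> /an_binop H /H[r r0 [B [B' [fB gB']]]]; exists r => //; exists (B * B').
by apply: apprM => //; exact: ltW.
Qed.

Lemma anZ n (w : 'rV[C]_n) c f : an w f -> an w (fun z => c * f z).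
Proof. exact: (anM (an_cst w c)). Qed.

Lemma anN n (w : 'rV[C]_n) f : an w f -> an w (fun z => - f z).
Proof. by move/(anZ (-1)); apply: an_ext; apply: locallyT => z; rewrite mulN1r. Qed.

Lemma anB n (w : 'rV[C]_n) f g : an w f -> an w g -> an w (fun z => f z - g z).
Proof. by move=> fa /anN; exact: anD. Qed.

Lemma an_sum n (w : 'rV[C]_n) (I : eqType) (s : seq I) (f : I -> 'rV[C]_n -> C) :
  (forall i, i \in s -> an w (f i)) -> an w (fun z => \sum_(i <- s) f i z).
Proof.
elim: s => [|i s IH] H.
  by apply: an_ext (an_cst w 0); apply: locallyT => z; rewrite big_nil.
apply: an_ext (anD (H i (mem_head _ _)) (IH _)).
  by apply: locallyT => z; rewrite big_cons.
by move=> j js; apply: H; rewrite inE js orbT.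
Qed.

Lemma an_prod n (w : 'rV[C]_n) (I : eqType) (s : seq I) (f : I -> 'rV[C]_n -> C) :
  (forall i, i \in s -> an w (f i)) -> an w (fun z => \prod_(i <- s) f i z).
Proof.
elim: s => [|i s IH] H.
  by apply: an_ext (an_cst w 1); apply: locallyT => z; rewrite big_nil.
apply: an_ext (anM (H i (mem_head _ _)) (IH _)).
  by apply: locallyT => z; rewrite big_cons.
by move=> j js; apply: H; rewrite inE js orbT.
Qed.

Lemma anX n (w : 'rV[C]_n) k f : an w f -> an w (fun z => f z ^+ k).
Proof.
move=> fa; elim: k => [|k IH]; first exact: an_cst.
by apply: an_ext (anM fa IH); apply: locallyT => z; rewrite exprS.
Qed.

Lemma an_linear n (w : 'rV[C]_n) (a : 'cV[C]_n) : an w (fun z => (z *m a) 0 0).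
Proof.
apply: (@an_ext _ _ (fun z => \sum_(i <- index_enum 'I_n) a i 0 * z 0 i)).
  by apply: locallyT => z; rewrite mxE; apply: eq_bigr => i _; rewrite mulrC.
by apply: an_sum => i _; apply: anZ; exact: an_coord.
Qed.

Lemma meval_at_pt n (w : 'rV[C]_n) (p : mpoly n C) : meval_at w w p = mcoeff (@mnm0 n) p.
Proof.
rewrite /meval_at (meval_eq (v2 := fun=> 0)); last by move=> i; rewrite subrr.
rewrite mevalE [in RHS](mpolyE p) raddf_sum /=; apply: eq_bigr => m _.
rewrite mcoeffZ mcoeffX; congr (_ * _); case: eqP => [->|/eqP m0].
  by rewrite big1// => i _; rewrite multinomE tnth_mktuple expr0.
have [i mi|mi] := pickP (fun i => m i != 0%N).
  by rewrite (bigD1 i)//= expr0n (negPf mi) mul0r.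
case/eqP: m0; apply/mnmP => i; rewrite [RHS]multinomE tnth_mktuple.
by move/negbT: (mi i); rewrite negbK => /eqP.
Qed.

(** After subtraction of the constant term, a late approximant [q L] is small on a small polydisc
    and the later ones stay within [e / 2] of it. This continuity in the majorant norm, stronger
    than continuity of values, lets an inner function fit into the polydisc of an outer one. *)
Lemma an_shrink n (w : 'rV[C]_n) f : an w f -> forall e : C, 0 < e ->
  exists2 rho : C, 0 < rho & forall d, 0 <= d <= rho -> appr w d (fun z => f z - f w) e.
Proof.
move=> [r r0 [B [p [pB pc pf]]]] e e0.
pose q j := p j - mpolyC n (mcoeff (@mnm0 n) (p j)).
have q0 j : mcoeff (@mnm0 n) (q j) = 0 by rewrite mcoeffB mcoeffC eqxx mulr1 subrr.
have e4 : 0 < e / 4 by rewrite divr_gt0.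
have e2 : 0 < e / 2 by rewrite divr_gt0.
have qf z : near_pt r w z -> tends (fun j => meval_at w z (q j)) (f z - f w).
  move=> wz; have := tendsD (pf z wz) (tendsZ (-1) (pf w (near_pt_refl w r0))).
  rewrite mulN1r; apply: tends_ext => j.
  by rewrite mulN1r meval_at_pt /meval_at mevalB mevalC.
have qc : poly_cauchy r q.
  move=> d d0; have d2 : 0 < d / 2 by rewrite divr_gt0.
  have [N HN] := pc _ d2; exists N => i j Ni Nj.
  rewrite (_ : q i - q j = (p i - p j) + (- mpolyC n (mcoeff (@mnm0 n) (p i - p j)))); last first.
    rewrite /q mcoeffB mpolyCB; ring.
  rewrite (splitr d); apply: majorantD; first exact: HN.
  apply: majorantN; apply: (@majorantW _ _ r _ `|mcoeff (@mnm0 n) (p i - p j)|); first exact: majorantC.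
  rewrite -(meval_at_pt w) /meval_at; apply: majorant_meval (HN i j Ni Nj) _ => [|a]; first exact: ltW.
  by rewrite subrr normr0 ltW.
have [L HL] := qc _ e2.
have [d0 d00 Hd] := majorant_small e2 (q0 L).
have [d d_gt0 [dd0 dr]] := min_pos d00 r0.
exists d => // t /andP[t0 td]; exists (fun j => q (L + j)%N); split.
- move=> j; rewrite -(subrK (q L) (q (L + j)%N)) (splitr e); apply: majorantD.
    apply: majorant_radius (HL _ _ (leq_addr _ _) (leqnn _)); first exact: ltW.
    by rewrite t0 (le_trans td).
  by apply: Hd; rewrite t0 (le_trans td).
- move=> d1 /qc[N HN]; exists N => i j Ni Nj.
  apply: majorant_radius (HN _ _ _ _); first exact: ltW.
  - by rewrite t0 (le_trans td).
  - by rewrite (leq_trans Ni) ?leq_addl.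
  - by rewrite (leq_trans Nj) ?leq_addl.
- move=> z wz; apply: (tends_shift L (qf z _)).
  by apply: near_ptW wz; exact: le_trans dr.
Qed.

Lemma an_continuous n (w : 'rV[C]_n) f : an w f -> forall e : C, 0 < e ->
  locally w (fun z => `|f z - f w| <= e).
Proof.
move=> fa e e0; have [rho rho0 H] := an_shrink fa e0.
by exists rho => // z wz; apply: appr_bound (H rho _) wz; rewrite ?lexx ltW.
Qed.

Lemma an_neq0 n (w : 'rV[C]_n) f : an w f -> f w != 0 -> locally w (fun z => f z != 0).
Proof.
move=> fa f0; have e0 : 0 < `|f w| / 2 by rewrite divr_gt0// normr_gt0.
apply: locallyS (an_continuous fa e0) => z; apply: contraTneq => ->.
rewrite sub0r normrN ler_pdivlMr// ger_pMr ?normr_gt0//.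
by rewrite -real_ltNge ?realn// ltr1n.
Qed.

Lemma an_comp n k (u : 'rV[C]_k) f (g : 'I_n -> 'rV[C]_k -> C) :
  an (\row_i g i u) f -> (forall i, an u (g i)) -> an u (fun z => f (\row_i g i z)).
Proof.
move=> [r r0 [B fB]] ga; have r2 : 0 < r / 2 by rewrite divr_gt0.
have [rho rho0 H] := finite_radius (fun i => an_shrink (ga i) r2).
exists rho => //; exists B.
apply: appr_ext (@appr_comp _ _ _ _ _ (r / 2) rho _ (fun i z => g i z - g i u) _ _ _ _ fB _).
- by move=> z _; congr f; apply/rowP => i; rewrite !mxE addrC subrK.
- exact: ltW.
- by rewrite ltr_pdivrMr// ltr_pMr// ltr1n.
- exact: ltW.
- by move=> i; apply: H; rewrite lexx ltW.
Qed.

Lemma an_compose n k (z : 'rV[C]_k) (g : 'rV[C]_n -> C) (M : 'rV[C]_k -> 'rV[C]_n) :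
  (forall i, an z (fun z => M z 0 i)) -> an (M z) g -> an z (fun z => g (M z)).
Proof.
move=> Ma ga; have rowK y : (\row_i M y 0 i) = M y by apply/rowP => i; rewrite mxE.
apply: an_ext (@an_comp _ _ z g (fun i y => M y 0 i) _ Ma); last by rewrite rowK.
by apply: locallyT => y; rewrite rowK.
Qed.

Lemma locally_comp n k (z : 'rV[C]_k) (M : 'rV[C]_k -> 'rV[C]_n) P :
  (forall i, an z (fun z => M z 0 i)) -> locally (M z) P -> locally z (fun y => P (M y)).
Proof.
move=> Ma [e e0 He]; have e2 : 0 < e / 2 by rewrite divr_gt0.
have [d d0 Hd] := locally_fin (fun i => an_continuous (Ma i) e2).
exists d => // y zy; apply: He => i; apply: le_lt_trans (Hd y zy i) _.
by rewrite ltr_pdivrMr// ltr_pMr// ltr1n.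
Qed.

(** Re-expansion at [u] is composition with a translation. The radius [r / 4] plus a displacement
    below [r / 4] stays below [r / 2 < r], as [appr_comp] requires. *)
Lemma an_open n (w : 'rV[C]_n) f : an w f -> locally w (fun u => an u f).
Proof.
case=> r r0 [B fB]; have r4 : 0 < r / 4 by rewrite divr_gt0.
exists (r / 4) => // u wu; exists (r / 4) => //; exists B.
apply: appr_ext (@appr_comp _ _ _ u _ (r / 2) (r / 4) _ (fun i z => z 0 i - w 0 i) _ _ _ _ fB _).
- by move=> z _; congr f; apply/rowP => i; rewrite !mxE addrC subrK.
- by rewrite divr_ge0// ltW.
- by rewrite ltr_pdivrMr// ltr_pMr// ltr1n.
- exact: ltW.
move=> i; apply: (@apprW _ _ _ _ (r / 4 + `|u 0 i - w 0 i|)).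
  rewrite (_ : r / 2 = r / 4 + r / 4); last by field.
  by rewrite lerD2l ltW.
apply: appr_ext (apprD (ltW r4) (appr_coord u i (ltW r4)) (appr_cst u (u 0 i - w 0 i) (ltW r4))) => z _.
by rewrite addrA subrK.
Qed.

Lemma geometric_sum (A : comNzRingType) (x : A) j : (1 - x) * \sum_(k < j) x ^+ k = 1 - x ^+ j.
Proof.
elim: j => [|j IH]; first by rewrite big_ord0 mulr0 expr0 subrr.
by rewrite big_ord_recr/= mulrDr IH exprS; ring.
Qed.

Lemma an_geometric : an (0 : 'rV[C]_1) (fun z => (1 - z 0 0)^-1).
Proof.
have h0 : (0 : C) < 2^-1 by rewrite invr_gt0.
have h1 : 0 <= (2^-1 : C) < 1 by rewrite (ltW h0) invf_lt1// ltr1n.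
pose X : mpoly 1 C := mpolyX C (mnm1 0).
have S2 j : \sum_(k < j) (2^-1 : C) ^+ k <= 2.
  have := geometric_sum (2^-1 : C) j.
  rewrite (_ : 1 - 2^-1 = 2^-1); last by field.
  move=> E; rewrite -(ler_pM2l h0) E mulVf ?pnatr_eq0//.
have XB j : majorant 2^-1 (\sum_(k < j) X ^+ k) 2.
  apply: majorantW (S2 j); apply: majorant_sum => k _.
  by apply: majorantXn; [exact: ltW|apply: majorantX].
exists (2^-1) => //; exists 2, (fun j => \sum_(k < j) X ^+ k); split=> //.
- move=> e e0; have [N HN] := geometric_tends0 Cmono h1 (divr_gt0 e0 (ltr0n C 2)).
  have key i j : (N <= i)%N -> (i <= j)%N -> majorant 2^-1 (\sum_(k < j) X ^+ k - \sum_(k < i) X ^+ k) e.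
    move=> Ni ij; rewrite -(subnKC ij) big_split_ord/= addrAC subrr add0r.
    under eq_bigr do rewrite exprD.
    rewrite -mulr_sumr; apply: (@majorantW _ _ _ _ (2^-1 ^+ i * 2)).
      apply: majorantM; [exact: ltW| |exact: XB].
      by apply: majorantXn; [exact: ltW|apply: majorantX].
    rewrite -ler_pdivlMr//; have := HN i Ni.
    by rewrite subr0 ger0_norm// exprn_ge0// ltW.
  exists N => i j Ni Nj; case: (leqP j i) => ij; first exact: key.
  by rewrite -opprB; apply: majorantN; apply: key => //; exact: ltnW.
- move=> z wz; have z2 : `|z 0 0| < 2^-1 by have := wz 0; rewrite mxE subr0.
  have z1 : `|z 0 0| < 1 by apply: lt_trans z2 _; case/andP: h1.
  have z1' : 1 - z 0 0 != 0.
    by apply: contraTneq z1 => /subr0_eq <-; rewrite normr1 ltxx.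
  have t0 : tends (fun j => z 0 0 ^+ j) 0.
    have := geometric_tends0 Cmono (r := `|z 0 0|); rewrite normr_ge0 z1 => /(_ isT) H e /H[N HN].
    by exists N => i /HN; rewrite !subr0 !normrX normr_id.
  have := tendsZ (1 - z 0 0)^-1 (tendsD (tends_cst 1) (tendsZ (-1) t0)).
  rewrite mulr0 addr0 mulr1; apply: tends_ext => j.
  rewrite mulN1r -(geometric_sum (z 0 0) j) mulKf// /meval_at raddf_sum/=.
  by apply: eq_bigr => k _; rewrite rmorphXn/= mevalXU mxE subr0.
Qed.

Lemma anV n (w : 'rV[C]_n) f : an w f -> f w != 0 -> an w (fun z => (f z)^-1).
Proof.
move=> fa f0; have fa0 := locallyI (an_neq0 fa f0) (locallyT w (fun=> I)).
(* With [t = 1 - f z / f w], which vanishes at [w], the inverse becomes [(f w)^-1 * (1 - t)^-1], a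
   geometric series. *)
apply: (@an_ext _ _ (fun z => (f w)^-1 * (1 - (1 - f z / f w))^-1)).
  case: fa0 => e e0 H; exists e => // z /H[fz _].
  by rewrite subKr invf_div mulrA mulVf// mul1r.
apply: anZ.
have := @an_comp 1 n w (fun t => (1 - t 0 0)^-1) (fun _ z => 1 - f z / f w).
set R := \row_i _; have -> : R = 0.
  by apply/rowP => i; rewrite !mxE divff ?subrr.
move=> /(_ an_geometric) H; apply: an_ext (H _) => [|_].
  by apply: locallyT => z; rewrite !mxE.
apply: anB; first exact: an_cst.
by apply: anM fa _; exact: an_cst.
Qed.

(** * Division by a coordinate and order of vanishing along a hyperplane *)

Definition kill_var n (i0 : 'I_n) : n.-tuple (mpoly n C) :=
  [tuple if i == i0 then 0 else mpolyX C (mnm1 i) | i < n].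

Lemma kill_varX n (i0 : 'I_n) (m : multinom n) :
  comp_mpoly (kill_var i0) (mpolyX C m) = if m i0 == 0%N then mpolyX C m else 0.
Proof.
rewrite comp_mpolyX; case: ifPn => [/eqP m0|m0].
  rewrite -[RHS]comp_mpoly_id comp_mpolyX; apply: eq_bigr => i _.
  by rewrite !tnth_mktuple; case: eqP => // ->; rewrite m0 !expr0.
by rewrite (bigD1 i0)//= tnth_mktuple eqxx expr0n (negPf m0) mul0r.
Qed.

(** Substituting 0 for the variable [i0] removes exactly the monomials that contain it, so the
    difference consists of these; cancelling one factor of the variable divides the weights by
    [r]. *)
Lemma majorant_div n (i0 : 'I_n) (r : C) (p : mpoly n C) B : 0 < r -> majorant r p B ->
  exists2 q, p - comp_mpoly (kill_var i0) p = mpolyX C (mnm1 i0) * q & majorant r q (B / r).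
Proof.
move=> r0 [s -> sB].
exists (\sum_(x <- s | x.2 i0 != 0%N) x.1 *: mpolyX C (mnm_sub x.2 (mnm1 i0))).
  rewrite (raddf_sum (comp_mpoly (kill_var i0)))/=.
  rewrite mulr_sumr [RHS]big_mkcond/=; etransitivity; first exact: esym (sumrB _ _ _ _).
  apply: eq_bigr => x _; rewrite comp_mpolyZ kill_varX.
  case: eqP => x0 /=; first by rewrite subrr.
  rewrite scaler0 subr0 -scalerAr -mpolyXD addmC submK//.
  by rewrite lep1mP; apply/eqP.
apply: (@majorantW _ _ _ _ (\sum_(x <- s | x.2 i0 != 0%N) `|x.1| * r ^+ mdeg (mnm_sub x.2 (mnm1 i0)))).
  by apply: majorant_sum => x _; exact: majorantZX.
rewrite ler_pdivlMr// mulr_suml; apply: le_trans sB.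
rewrite [leRHS](bigID (fun x : C * multinom n => x.2 i0 != 0%N))/= ler_wpDr//.
  by apply: sumr_ge0 => x _; rewrite mulr_ge0// exprn_ge0// ltW.
apply: ler_sum => x x0; rewrite -mulrA -exprSr -[X in r ^+ X.+1]addn0 -addnS -(mdeg1 i0) -mdegD submK//.
by rewrite lep1mP.
Qed.

Lemma mpolyX_cancel n (i0 : 'I_n) (p q : mpoly n C) :
  mpolyX C (mnm1 i0) * p = mpolyX C (mnm1 i0) * q -> p = q.
Proof. by apply: mulfI; rewrite -msupp_eq0 msuppX. Qed.

Hypothesis Ccomp : seq_complete C.

(** Division by a variable is additive and unique, so the quotients of the approximating polynomials
    form a Cauchy sequence; completeness supplies its limit [h]. *)
Lemma appr_div n (w : 'rV[C]_n) (r : C) f B (i0 : 'I_n) : 0 < r -> appr w r f B ->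
  (forall z, near_pt r w z -> z 0 i0 = w 0 i0 -> f z = 0) ->
  exists2 h, appr w r h (B / r) & forall z, near_pt r w z -> f z = (z 0 i0 - w 0 i0) * h z.
Proof.
move=> r0 [p [pB pc pf]] f0.
have qex j : exists q, p j - comp_mpoly (kill_var i0) (p j) = mpolyX C (mnm1 i0) * q /\ majorant r q (B / r).
  by have [q ? ?] := majorant_div i0 r0 (pB j); exists q.
have [q Hq] := choice qex.
have qc : poly_cauchy r q.
  move=> e e0; have [N HN] := pc _ (mulr_gt0 e0 r0); exists N => i j Ni Nj.
  have [q' Eq' q'B] := majorant_div i0 r0 (HN i j Ni Nj).
  suff -> : q i - q j = q' by apply: majorantW q'B _; rewrite mulfK// gt_eqF.
  apply: (@mpolyX_cancel _ i0).
  by rewrite mulrBr -!(proj1 (Hq _)) -Eq' comp_mpolyB; ring.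
have qcv z : near_pt r w z -> exists l, tends (fun j => meval_at w z (q j)) l.
  move=> wz; apply: Ccomp => e /qc[N HN]; exists N => i j Ni Nj.
  rewrite /meval_at -mevalB; apply: majorant_meval (HN i j Ni Nj) _ => [|a]; first exact: ltW.
  exact: ltW (wz a).
have hex z : exists l, near_pt r w z -> tends (fun j => meval_at w z (q j)) l.
  have [wz|nwz] := pselect (near_pt r w z); last by exists 0.
  by have [l Hl] := qcv z wz; exists l.
have [h Hh] := choice hex.
exists h; first by exists q; split => // j; case: (Hq j).
(* [z'] is the projection of [z] to the hyperplane. The remainder of [p j] at [z] is the value of
   [p j] at [z'], which tends to [f z' = 0]. *)
move=> z wz; pose z' := \row_i (if i == i0 then w 0 i else z 0 i).
have wz' : near_pt r w z'.
  by move=> i; rewrite mxE; case: eqP => // _; rewrite subrr normr0.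
have T := tendsD (pf _ wz) (tendsZ (-1) (pf _ wz')).
rewrite (f0 z' wz') ?mulr0 ?addr0 in T; last by rewrite mxE eqxx.
apply: tends_unique T _; apply: tends_ext (tendsZ _ (Hh z wz)) => j.
have := congr1 (meval_at w z) (proj1 (Hq j)).
rewrite /meval_at mevalM mevalXU mevalB => <-; rewrite mulN1r; congr (_ - _).
rewrite comp_mpoly_meval; apply: meval_eq => i; rewrite tnth_mktuple !mxE.
by case: eqP => [->|_]; rewrite ?meval0 ?subrr// mevalXU.
Qed.

(** If the division never stops, [f] is bounded by [t ^+ m * B] for every [m], where [t < 1] is the
    size of the coordinate relative to [r]; hence it vanishes. [P] is the condition under which one
    more division is possible. *)
Lemma appr_div_iter n (w : 'rV[C]_n) (r : C) f B (i0 : 'I_n) (P : ('rV[C]_n -> C) -> Prop) :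
  0 < r -> appr w r f B ->
  (forall h B', appr w r h B' -> P h -> forall z, near_pt r w z -> z 0 i0 = w 0 i0 -> h z = 0) ->
  (forall z, near_pt r w z -> f z = 0) \/
  exists m h, [/\ appr w r h (B / r ^+ m),
    (forall z, near_pt r w z -> f z = (z 0 i0 - w 0 i0) ^+ m * h z) & ~ P h].
Proof.
move=> r0 fB HP; have [|nH] := pselect (exists m h, [/\ appr w r h (B / r ^+ m),
    (forall z, near_pt r w z -> f z = (z 0 i0 - w 0 i0) ^+ m * h z) & ~ P h]); first by right.
left.
have H m : exists2 h, appr w r h (B / r ^+ m) &
    forall z, near_pt r w z -> f z = (z 0 i0 - w 0 i0) ^+ m * h z.
  elim: m => [|m [h hB fh]].
    by exists f => [|z _]; rewrite expr0 ?divr1// mul1r.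
  have Ph : P h by apply: contrapT => nPh; apply: nH; exists m, h.
  have [h' h'B hh'] := appr_div r0 hB (HP h _ hB Ph).
  exists h'; first by rewrite exprSr invfM mulrA.
  by move=> z wz; rewrite fh// hh'// exprSr mulrA.
have B0 := appr_ge0 (ltW r0) fB.
move=> z wz; apply: norm_eps => e e0; rewrite subr0.
pose t := `|z 0 i0 - w 0 i0| / r.
have t1 : 0 <= t < 1.
  by rewrite divr_ge0 ?(ltW r0)//= ltr_pdivrMr// mul1r.
have B1 : 0 < B + 1 by rewrite ltr_wpDl.
have [N HN] := geometric_tends0 Cmono t1 (divr_gt0 e0 B1).
have [h hB fh] := H N; rewrite fh// normrM normrX.
have t0 : 0 <= t by case/andP: t1.
have tN : t ^+ N <= e / (B + 1).
  by have := HN N (leqnn _); rewrite subr0 normrX (ger0_norm t0).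
apply: (@le_trans _ _ (t ^+ N * B)).
  rewrite expr_div_n -mulrA ler_wpM2l ?exprn_ge0// mulrC.
  exact: appr_bound (ltW r0) hB wz.
apply: (@le_trans _ _ (e / (B + 1) * (B + 1))); last by rewrite divfK ?gt_eqF.
by rewrite ler_pM ?exprn_ge0 ?lerDl.
Qed.

Lemma appr_an n (w : 'rV[C]_n) (r : C) f B : 0 < r -> appr w r f B -> an w f.
Proof. by move=> r0 fB; exists r => //; exists B. Qed.

Lemma near_pt1 (r : C) (w z : 'rV[C]_1) : `|z 0 0 - w 0 0| < r -> near_pt r w z.
Proof. by move=> H i; rewrite ord1. Qed.

(** In one variable the hyperplane is the point [w] itself, so iterated division yields the order of
    vanishing. The first alternative covers the whole disc of radius [r], which is what propagates
    vanishing. *)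
Lemma appr1_dichotomy (w : 'rV[C]_1) (r : C) f B : 0 < r -> appr w r f B ->
  (forall z, near_pt r w z -> f z = 0) \/
  locally w (fun z => z != w -> f z != 0).
Proof.
move=> r0 fB.
have [h B' hB h0 z _ zw|//|[m [h [hB fh h0]]]] :=
  @appr_div_iter _ _ _ _ _ 0 (fun h => h w = 0) r0 fB.
- by rewrite (_ : z = w)//; apply/rowP => i; rewrite ord1.
- by left.
right; move/eqP/(an_neq0 (appr_an r0 hB)) : h0 => [e e0 He].
have [d d0 [de dr]] := min_pos e0 r0.
exists d => // z wz zw; rewrite fh; last exact: near_ptW wz.
rewrite mulf_neq0 ?He//; last exact: near_ptW wz.
rewrite expf_neq0// subr_eq0; apply: contraNneq zw => zw.
by apply/eqP/rowP => i; rewrite ord1.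
Qed.

Lemma an1_dichotomy (w : 'rV[C]_1) f : an w f ->
  locally w (fun z => f z = 0) \/ locally w (fun z => z != w -> f z != 0).
Proof.
move=> [r r0 [B fB]]; case: (appr1_dichotomy r0 fB); last by right.
by left; exists r.
Qed.

Lemma punctured1 (w : 'rV[C]_1) P : locally w P -> exists2 z, P z & z != w.
Proof.
move=> [e e0 He]; exists (w + const_mx (e / 2)).
  apply: He => i; rewrite !mxE addrAC subrr add0r gtr0_norm ?divr_gt0//.
  by rewrite ltr_pdivrMr// ltr_pMr// ltr1n.
apply/eqP => /rowP/(_ 0); rewrite !mxE => /eqP; rewrite addrC -subr_eq0 addrK.
by rewrite mulf_eq0 gt_eqF//= invr_eq0 pnatr_eq0.
Qed.

(** On the complex line through [w] and [z], [f] becomes a function of one variable that vanishes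
    near 0, hence on its whole disc, which contains the parameter 1 of [z]. *)
Lemma line_identity n (w z : 'rV[C]_n) (r : C) f B : 0 < r -> appr w r f B -> near_pt r w z ->
  (exists2 e : C, 0 < e & forall t, `|t| < e -> f (w + t *: (z - w)) = 0) -> f z = 0.
Proof.
move=> r0 fB wz [e e0 He].
have [i|M /andP[M0 Mr] HM] := @finite_bound _ r (fun i => `|z 0 i - w 0 i|) r0.
  by rewrite normr_ge0 wz.
have Mr0 : 0 < M + r by rewrite ltr_wpDl.
(* Chosen with [1 < rho] and [rho * M < r]: the disc contains the parameter 1 while the line stays
   in the polydisc. *)
pose rho := 2 * r / (M + r).
have rho0 : 0 < rho by rewrite divr_gt0// mulr_gt0.
have rho1 : 1 < rho by rewrite ltr_pdivlMr// mul1r mulr_natl mulr2n ltrD2r.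
have gB : appr (0 : 'rV[C]_1) rho (fun t => f (w + t 0 0 *: (z - w))) B.
  apply: appr_ext (@appr_comp n 1 w 0 r (rho * M) rho f (fun i t => t 0 0 * (z 0 i - w 0 i)) B _ _ _ fB _).
  - by move=> t _; congr f; congr (w + _); apply/rowP => i; rewrite !mxE.
  - by rewrite mulr_ge0// ltW.
  - rewrite /rho mulrAC ltr_pdivrMr// mulrC [ltRHS]mulrC -mulrCA.
    by rewrite mulrA ltr_pM2r// mulr_natl mulr2n ltrD2l.
  - exact: ltW.
  move=> i; apply: (@apprW _ _ _ _ (rho * `|z 0 i - w 0 i|)); first by rewrite ler_wpM2l// ltW.
  have := apprM (ltW rho0) (appr_coord (0 : 'rV[C]_1) 0 (ltW rho0)) (appr_cst 0 (z 0 i - w 0 i) (ltW rho0)).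
  by apply: appr_ext => t _; rewrite mxE subr0.
case: (appr1_dichotomy rho0 gB) => [H|[d d0 Hd]].
  have := H (const_mx 1); rewrite mxE scale1r addrC subrK; apply.
  by move=> i; rewrite !mxE subr0 normr1.
exfalso; have [|t [te td] t0] := @punctured1 0 (fun t => near_pt e 0 t /\ near_pt d 0 t).
  by apply: locallyI; [exists e|exists d].
have := Hd t td t0; rewrite He ?eqxx//.
by have := te 0; rewrite mxE subr0.
Qed.

(** A quotient that vanishes on the hyperplane near [w] vanishes on it throughout the polydisc, by
    [line_identity] along lines inside the hyperplane; so [appr_div] applies once more, and the
    process stops only where vanishing fails locally. *)
Lemma appr_factor n (w : 'rV[C]_n) (r : C) f B (i0 : 'I_n) : 0 < r -> appr w r f B ->
  (forall z, near_pt r w z -> f z = 0) \/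
  exists m h, [/\ appr w r h (B / r ^+ m),
    (forall z, near_pt r w z -> f z = (z 0 i0 - w 0 i0) ^+ m * h z)
    & ~ locally w (fun z => z 0 i0 = w 0 i0 -> h z = 0)].
Proof.
move=> r0 fB; apply: appr_div_iter => // h B' hB' [e e0 He] z wz zi.
apply: (line_identity r0 hB' wz); exists (e / r) => [|t te]; first by rewrite divr_gt0.
apply: He => [i|]; last by rewrite !mxE zi subrr mulr0 addr0.
rewrite !mxE addrAC subrr add0r normrM.
have [->|zi0] := eqVneq (z 0 i) (w 0 i); first by rewrite subrr normr0 mulr0.
apply: (@lt_trans _ _ (e / r * `|z 0 i - w 0 i|)).
  by rewrite ltr_pM2r// normr_gt0 subr_eq0.
by rewrite mulrAC ltr_pdivrMr// ltr_pM2l.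
Qed.

Lemma an_factor_linear n (w : 'rV[C]_n) f (a : 'cV[C]_n) : an w f -> a != 0 -> (w *m a) 0 0 = 0 ->
  locally w (fun z => f z = 0) \/
  exists m h, [/\ an w h, locally w (fun z => f z = (z *m a) 0 0 ^+ m * h z)
    & ~ locally w (fun z => (z *m a) 0 0 = 0 -> h z = 0)].
Proof.
move=> fa a0 wa.
have [i0 ai0] : exists i0, a i0 0 != 0.
  apply: contrapT => H; case/eqP: a0; apply/colP => i; rewrite mxE.
  by apply/eqP/negPn/negP => ai; apply: H; exists i.
pose lam (z : 'rV[C]_n) : C := (z *m a) 0 0.
(* L is a change of coordinates turning the linear form a into the coordinate i0. *)
pose L (z : 'rV[C]_n) : 'rV[C]_n := \row_i (if i == i0 then lam z else z 0 i).
pose L' (z : 'rV[C]_n) : 'rV[C]_n :=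
  \row_i (if i == i0 then (z 0 i0 - (lam z - a i0 0 * z 0 i0)) / a i0 0 else z 0 i).
have lamE z : lam z = a i0 0 * z 0 i0 + \sum_(i | i != i0) z 0 i * a i 0.
  by rewrite /lam mxE (bigD1 i0)//= mulrC.
have lamL' z : lam (L' z) = z 0 i0.
  rewrite lamE mxE eqxx [lam z]lamE mulrC divfK//.
  have -> : \sum_(i | i != i0) L' z 0 i * a i 0 = \sum_(i | i != i0) z 0 i * a i 0.
    by apply: eq_bigr => i /negPf ii; rewrite mxE ii.
  by ring.
have LK z : L' (L z) = z.
  apply/rowP => i; rewrite mxE; case: eqP => [->|ii]; last by rewrite mxE; case: eqP.
  rewrite !lamE mxE eqxx.
  have -> : \sum_(i1 | i1 != i0) L z 0 i1 * a i1 0 = \sum_(i1 | i1 != i0) z 0 i1 * a i1 0.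
    by apply: eq_bigr => j /negPf ij; rewrite mxE ij.
  by rewrite [lam z]lamE; field.
have L'K z : L (L' z) = z.
  apply/rowP => i; rewrite mxE lamL'; case: eqP => [->//|ii].
  by rewrite mxE; case: eqP.
have lama z : an z lam by exact: an_linear.
have La z i : an z (fun z => L z 0 i).
  apply: (@an_ext _ _ (fun z => if i == i0 then lam z else z 0 i)).
    by apply: locallyT => y; rewrite mxE.
  by case: (i == i0) => //; exact: an_coord.
have L'a z i : an z (fun z => L' z 0 i).
  apply: (@an_ext _ _ (fun z => if i == i0 then (z 0 i0 - (lam z - a i0 0 * z 0 i0)) / a i0 0 else z 0 i)).
    by apply: locallyT => y; rewrite mxE.
  case: (i == i0); last exact: an_coord.
  apply: anM (an_cst _ _); apply: anB; first exact: an_coord.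
  by apply: anB (lama _) _; apply: anZ; exact: an_coord.
have LE y : L y 0 i0 = lam y by rewrite mxE eqxx.
have fLa : an (L w) (fun z => f (L' z)) by apply: an_compose => //; rewrite LK.
case: fLa => r r0 [B fB].
have [f0|[m [h [hB fh h0]]]] := appr_factor i0 r0 fB.
  left; have : locally (L w) (fun z => f (L' z) = 0) by exists r.
  by move/(locally_comp (La w)); apply: locallyS => z; rewrite LK.
right; exists m, (fun z => h (L z)); split.
- by apply: an_compose => //; exact: appr_an hB.
- have : locally (L w) (fun z => f (L' z) = (z 0 i0 - L w 0 i0) ^+ m * h z) by exists r.
  move/(locally_comp (La w)); apply: locallyS => z; rewrite LK.
  by rewrite !LE [lam w]wa subr0.
- move=> H; apply: h0.
  have : locally (L' (L w)) (fun z => lam z = 0 -> h (L z) = 0) by rewrite LK.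
  move/(locally_comp (L'a _)); apply: locallyS => z.
  by rewrite lamL' L'K LE [lam w]wa.
Qed.

(** * Real segments, and analytic subsets along paths *)

Lemma tends_ge0 (u : nat -> C) l : tends u l -> (forall i, 0 <= u i) -> 0 <= l.
Proof.
move=> ul u0; suff -> : l = `|l| by [].
apply: norm_eps => e e0; have [N HN] := ul _ (divr_gt0 e0 (ltr0n C 2)).
rewrite -(subrK (u N) l) -addrA; apply: le_trans (ler_normD _ _) _.
rewrite (splitr e) lerD//; first by rewrite distrC HN.
rewrite subrK -{1}(ger0_norm (u0 N)); apply: le_trans (ler_dist_dist _ _) _; exact: HN.
Qed.

(** In the order of [C] the inequality [0 <= t] forces [t] to be real, so this is the real unit
    interval inside [C]. *)
Definition unit_itv (t : C) := 0 <= t <= 1.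

(** Halving keeps [A] at the left end and [B] at the right end. The common limit of the ends
    satisfies one of the two, and the other still occurs arbitrarily near it, against the
    hypotheses. *)
Lemma bisection (A B : C -> Prop) (a0 b0 : C) :
  (forall t, unit_itv t -> A t \/ B t) ->
  (forall t, unit_itv t -> A t -> exists2 e : C, 0 < e & forall s, unit_itv s -> `|s - t| < e -> ~ B s) ->
  (forall t, unit_itv t -> B t -> exists2 e : C, 0 < e & forall s, unit_itv s -> `|s - t| < e -> ~ A s) ->
  0 <= a0 -> a0 <= b0 -> b0 <= 1 -> A a0 -> B b0 -> False.
Proof.
move=> AB Ao Bo a00 ab0 b01 Aa Bb.
pose step (p : C * C) := let m := (p.1 + p.2) / 2 in if `[< A m >] then (m, p.2) else (p.1, m).
pose p k := iter k step (a0, b0).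
have inv k : [/\ 0 <= (p k).1, (p k).1 <= (p k).2, (p k).2 <= 1, A (p k).1 & B (p k).2].
  elim: k => [//|k [H0 H1 H2 H3 H4]]; rewrite /p iterS -/(p k) /step.
  have m1 : (p k).1 <= ((p k).1 + (p k).2) / 2.
    by rewrite ler_pdivlMr// mulr_natr mulr2n lerD2l.
  have m2 : ((p k).1 + (p k).2) / 2 <= (p k).2.
    by rewrite ler_pdivrMr// mulr_natr mulr2n lerD2r.
  case: asboolP => Am /=; split => //.
  - exact: le_trans m1.
  - exact: le_trans H2.
  - have [|//|//] := AB (((p k).1 + (p k).2) / 2); rewrite /unit_itv (le_trans H0 m1)/=.
    exact: le_trans H2.
have dif k : (p k).2 - (p k).1 = 2^-1 ^+ k * (b0 - a0).
  elim: k => [|k IH]; first by rewrite expr0 mul1r.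
  rewrite exprS -mulrA -IH /p iterS -/(p k) /step.
  by case: asboolP => _ /=; field.
have mono i j : (i <= j)%N -> (p i).1 <= (p j).1.
  move=> /subnKC <-; elim: (j - i)%N => [|k IH]; first by rewrite addn0.
  apply: le_trans IH _; rewrite addnS /p iterS -/(p (i + k)%N) /step.
  case: (inv (i + k)%N) => _ H _ _ _; case: asboolP => _ //=.
  by rewrite ler_pdivlMr// mulr_natr mulr2n lerD2l.
have [c cl] : exists c, tends (fun k => (p k).1) c.
  apply: Ccomp; apply: (Cmono (M := 1)) => // i; case: (inv i) => H0 H1 H2 _ _.
  by rewrite H0 (le_trans H1).
have h1 : 0 <= (2^-1 : C) < 1 by rewrite invr_ge0 ler0n invf_lt1// ltr1n.
have dl := tendsZ (b0 - a0) (geometric_tends0 Cmono h1); rewrite mulr0 in dl.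
have cu : tends (fun k => (p k).2) c.
  have := tendsD cl dl; rewrite addr0; apply: tends_ext => k.
  by rewrite mulrC -dif addrC subrK.
have c01 : unit_itv c.
  rewrite /unit_itv (tends_ge0 cl)/=; last by move=> i; case: (inv i).
  rewrite -subr_ge0; apply: (tends_ge0 (u := fun k => 1 - (p k).1)); last first.
    by move=> i; case: (inv i) => _ H1 H2 _ _; rewrite subr_ge0 (le_trans H1).
  have := tendsD (tends_cst 1) (tendsZ (-1) cl); rewrite mulN1r.
  by apply: tends_ext => i; rewrite mulN1r.
have e2 (e : C) : 0 < e -> 0 < e / 2 by move=> ?; rewrite divr_gt0.
have e2' (e : C) : 0 < e -> e / 2 < e by move=> ?; rewrite ltr_pdivrMr// ltr_pMr// ltr1n.
case: (AB c c01) => Hc.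
  have [e e0 He] := Ao c c01 Hc; have [N HN] := cu _ (e2 _ e0).
  case: (inv N) => H0 H1 H2 H3 H4; apply: (He (p N).2) => //.
    by rewrite /unit_itv H2 (le_trans H0).
  by apply: le_lt_trans (HN _ (leqnn _)) (e2' _ e0).
have [e e0 He] := Bo c c01 Hc; have [N HN] := cl _ (e2 _ e0).
case: (inv N) => H0 H1 H2 H3 H4; apply: (He (p N).1) => //.
  by rewrite /unit_itv H0 (le_trans H1).
by apply: le_lt_trans (HN _ (leqnn _)) (e2' _ e0).
Qed.

Lemma unit_itv_connected (A B : C -> Prop) :
  (forall t, unit_itv t -> A t \/ B t) ->
  (forall t, unit_itv t -> A t -> exists2 e : C, 0 < e & forall s, unit_itv s -> `|s - t| < e -> ~ B s) ->
  (forall t, unit_itv t -> B t -> exists2 e : C, 0 < e & forall s, unit_itv s -> `|s - t| < e -> ~ A s) ->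
  (forall t, unit_itv t -> A t) \/ (forall t, unit_itv t -> B t).
Proof.
move=> AB Ao Bo.
have [|nA] := pselect (forall t, unit_itv t -> A t); first by left.
right=> b b01; have [Ab|//] := AB b b01.
exfalso; apply: nA => a a01; have [//|Ba] := AB a a01; exfalso.
have [/andP[b0 b1] /andP[a0 a1]] := (b01, a01).
have [ab|ba] := real_leP (ger0_real a0) (ger0_real b0).
  by apply: (@bisection B A a b) => // t /AB[]; [right|left].
exact: (@bisection A B b a AB Ao Bo b0 (ltW ba) a1).
Qed.

Definition analytic_along n (gam : C -> 'rV[C]_n) (S : C -> Prop) (t : C) :=
  exists k (F : 'I_k -> 'rV[C]_n -> C), (forall i, an (gam t) (F i)) /\
  exists2 e : C, 0 < e & forall s, unit_itv s -> `|s - t| < e -> (S s <-> forall i, F i (gam s) = 0).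

Lemma unit_itv_near (t e : C) : unit_itv t -> 0 < e ->
  exists s, [/\ unit_itv s, s != t & `|s - t| < e].
Proof.
move=> /andP[t0 t1] e0; have [d d0 [de d1]] := min_pos e0 (ltr01 : 0 < 1 :> C).
have d2 : 0 < d / 2 by rewrite divr_gt0.
have d2e : d / 2 < e by apply: lt_le_trans de; rewrite ltr_pdivrMr// ltr_pMr// ltr1n.
have d2h : d / 2 <= 1 / 2 by rewrite ler_pM2r// invr_gt0.
have hr : (1 / 2 : C) \is Num.real by rewrite ger0_real// divr_ge0.
have [th|th] := real_leP (ger0_real t0) hr.
  exists (t + d / 2); split.
  - rewrite /unit_itv addr_ge0// ?(ltW d2)//=.
    by apply: (le_trans (lerD th d2h)); rewrite -splitr.
  - by rewrite -subr_eq0 addrAC subrr add0r gt_eqF.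
  - by rewrite addrAC subrr add0r gtr0_norm.
exists (t - d / 2); split.
- rewrite /unit_itv subr_ge0 (le_trans d2h (ltW th))/=.
  by apply: le_trans t1; rewrite gerBl ltW.
- by rewrite -subr_eq0 addrAC subrr add0r oppr_eq0 gt_eqF.
- by rewrite addrAC subrr add0r normrN gtr0_norm.
Qed.

(* Along an analytic path an analytic subset is either everything or discrete. *)
Lemma path_cover n (gam : C -> 'rV[C]_n) (S1 S2 : C -> Prop) :
  (forall t i, an (const_mx t : 'rV[C]_1) (fun z => gam (z 0 0) 0 i)) ->
  (forall t, unit_itv t -> analytic_along gam S1 t) ->
  (forall t, unit_itv t -> analytic_along gam S2 t) ->
  (forall t, unit_itv t -> S1 t \/ S2 t) ->
  (forall t, unit_itv t -> S1 t) \/ (forall t, unit_itv t -> S2 t).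
Proof.
move=> ga a1 a2 S12.
pose full (S : C -> Prop) t := exists2 e : C, 0 < e & forall s, unit_itv s -> `|s - t| < e -> S s.
pose discr (S : C -> Prop) t := exists2 e : C, 0 < e &
  forall s, unit_itv s -> s != t -> `|s - t| < e -> ~ S s.
have dich S : (forall t, unit_itv t -> analytic_along gam S t) ->
    (forall t, unit_itv t -> S t) \/ (forall t, unit_itv t -> discr S t).
  move=> aS.
  (* Being full near [t] and being discrete near [t] are open conditions that exclude each other,
     and the one-variable dichotomy gives one of them; connectedness makes the choice uniform in
     [t]. *)
  suff : (forall t, unit_itv t -> full S t) \/ (forall t, unit_itv t -> discr S t).
    case=> H; last by right.
    by left=> t t01; have [e e0] := H t t01; apply => //; rewrite subrr normr0.
  apply: unit_itv_connected => t t01.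
  - have [k [F [Fa [e e0 He]]]] := aS t t01.
    have Fg i : an (const_mx t : 'rV[C]_1) (fun z => F i (gam (z 0 0))).
      by apply: an_compose => //; rewrite mxE.
    have [[i ni]|H] := pselect (exists i, locally (const_mx t : 'rV[C]_1)
        (fun z => z != const_mx t -> F i (gam (z 0 0)) != 0)).
      right; have [d d0 Hd] := ni; have [c c0 [cd ce]] := min_pos d0 e0.
      exists c => // s s01 st sc /(proj1 (He s s01 (lt_le_trans sc ce)))/(_ i) /eqP.
      have := Hd (const_mx s); rewrite mxE => /(_ _ _)/negP; apply.
        by apply: near_pt1; rewrite !mxE (lt_le_trans sc).
      by apply/eqP => /rowP/(_ 0); rewrite !mxE => /eqP; rewrite (negPf st).
    left; have H' i : locally (const_mx t : 'rV[C]_1) (fun z => F i (gam (z 0 0)) = 0).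
      by case: (an1_dichotomy (Fg i)) => // Hi; exfalso; apply: H; exists i.
    have [d d0 Hd] := locally_fin H'; have [c c0 [cd ce]] := min_pos d0 e0.
    exists c => // s s01 sc; apply/(He s s01 (lt_le_trans sc ce)) => i.
    have := Hd (const_mx s); rewrite mxE; apply.
    by apply: near_pt1; rewrite !mxE (lt_le_trans sc).
  - move=> [e e0 He]; exists (e / 2) => [|s s01 se [d d0 Hd]]; first by rewrite divr_gt0.
    have [c c0 [ce cd]] := min_pos (divr_gt0 e0 (ltr0n C 2)) d0.
    have [u [u01 us uc]] := unit_itv_near s01 c0.
    apply: (Hd u u01 us (lt_le_trans uc cd)); apply: He => //.
    rewrite -(subrK s u) -addrA (splitr e); apply: le_lt_trans (ler_normD _ _) _.
    by rewrite ltrD// (lt_le_trans uc).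
  - move=> [e e0 He]; exists e => // s s01 se [d d0 Hd].
    have [st|st] := eqVneq s t.
      have [c c0 [ce cd]] := min_pos e0 d0.
      have [u [u01 us uc]] := unit_itv_near s01 c0.
      apply: (He u u01); first by rewrite -st.
        by rewrite -st (lt_le_trans uc).
      by apply: Hd => //; rewrite (lt_le_trans uc).
    by apply: (He s s01 st se); apply: Hd => //; rewrite subrr normr0.
have [|d1] := dich _ a1; first by left.
have [|d2] := dich _ a2; first by right.
(* Two sets that are discrete at 0 cannot cover a neighbourhood of 0 in the interval. *)
exfalso; have z01 : unit_itv 0 by rewrite /unit_itv lexx ler01.
have [e e0 He] := d1 0 z01; have [d d0 Hd] := d2 0 z01.
have [c c0 [ce cd]] := min_pos e0 d0.
have [u [u01 us uc]] := unit_itv_near z01 c0.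
case: (S12 u u01); [apply: He|apply: Hd] => //; exact: lt_le_trans uc _.
Qed.

Lemma box_split (n : nat) (A : nmodType) (phi : ('I_n -> nat) -> A) (N M : nat) : (N <= M)%N ->
  \sum_(a : {ffun 'I_n -> 'I_M}) phi (fun i => a i) =
  \sum_(a : {ffun 'I_n -> 'I_N}) phi (fun i => a i) +
  \sum_(a : {ffun 'I_n -> 'I_M} | ~~ [forall i, a i < N]%N) phi (fun i => a i).
Proof.
move=> NM; rewrite (bigID (fun a : {ffun 'I_n -> 'I_M} => [forall i, a i < N]%N))/=; congr (_ + _).
pose h (a : {ffun 'I_n -> 'I_N}) : {ffun 'I_n -> 'I_M} := [ffun i => widen_ord NM (a i)].
have hinj : injective h.
  move=> a b /ffunP ab; apply/ffunP => i; have := ab i; rewrite !ffunE => /(congr1 val)/= H.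
  exact: val_inj.
rewrite (reindex_omap h (fun b => [pick a | h a == b]))/=.
  apply: eq_big => [a|a _].
    have -> : [forall i, h a i < N]%N by apply/forallP => i; rewrite ffunE/=.
    case: pickP => [b /eqP/hinj -> |/(_ a)]; last by rewrite eqxx.
    by rewrite eqxx.
  by congr phi; apply: funext => i; rewrite ffunE.
move=> b /forallP bN; case: pickP => [a /eqP <-//|] /(_ [ffun i => Ordinal (bN i)]).
by move/eqP; case; apply/ffunP => i; rewrite !ffunE; exact: val_inj.
Qed.

End Approx.

(** * Agreement of polynomial limits with convergent power series *)

Section AnalyticAt.
Variable C : numClosedFieldType.
Hypotheses (Cmono : monotone_cauchy C) (Ccomp : seq_complete C).

Lemma cvg_tends (u : nat -> C) (l : C) : (u @ \oo --> l)%classic <-> tends u l.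
Proof.
split.
- move=> /cvgrPdist_le H e e0; have [N _ HN] := H e e0.
  by exists N => i Ni; rewrite distrC; exact: HN.
- move=> H; apply/cvgrPdist_le => e e0; have [N HN] := H e e0.
  by exists N => // i /= Ni; rewrite distrC; exact: HN.
Qed.

Lemma meval_box n (p : mpoly n C) : exists N0, forall N (x : 'I_n -> C), (N0 <= N)%N ->
  meval x p = \sum_(a : {ffun 'I_n -> 'I_N}) mcoeff (monom (fun i => a i)) p * \prod_i x i ^+ a i.
Proof.
exists (msize p) => N x Np; rewrite mevalE.
transitivity (\sum_(m <- msupp p) \sum_(a : {ffun 'I_n -> 'I_N} | m == monom (fun i => a i))
   mcoeff (monom (fun i => a i)) p * \prod_i x i ^+ a i).
  rewrite big_seq [RHS]big_seq; apply: eq_bigr => m mp.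
  have mN i : (m i < N)%N.
    apply: leq_trans (leq_trans (msize_mdeg_lt mp) Np); rewrite ltnS mdegE (bigD1 i)//=.
    exact: leq_addr.
  rewrite (big_pred1 [ffun i => Ordinal (mN i)]) => [|a].
    have -> : monom (fun i => [ffun i => Ordinal (mN i)] i) = m.
      by apply/mnmP => i; rewrite monomE ffunE.
    by congr (_ * _); apply: eq_bigr => i _; rewrite ffunE.
  apply/eqP/eqP => [E|->].
    by apply/ffunP => i; rewrite ffunE; apply: val_inj; rewrite /= E monomE.
  by apply/mnmP => i; rewrite monomE ffunE.
rewrite (exchange_big_dep predT)//=; apply: eq_bigr => a _.
rewrite -big_filter; have [ap|nap] := boolP (monom (fun i => a i) \in msupp p).
  rewrite (_ : [seq m <- msupp p | m == _] = [:: monom (fun i => a i)]) ?big_seq1//.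
  by apply/esym; rewrite (filter_pred1_uniq (msupp_uniq p) ap).
rewrite big_filter big1_seq ?(memN_msupp_eq0 nap) ?mul0r// => m /andP[/eqP-> H].
Qed.

(** A coefficient times the corresponding power of [r] is bounded by the majorant norm, so the
    coefficients of the approximants converge; their limits are the coefficients of the power
    series. *)
Lemma an_analytic_at n (f : 'rV[C]_n -> C) (w : 'rV[C]_n) : an w f -> analytic_at f w.
Proof.
move=> [r r0 [B [p [pB pc pf]]]].
have lim_ex (a : 'I_n -> nat) : exists l, tends (fun j => mcoeff (monom a) (p j)) l.
  apply: Ccomp => e e0; have ra : 0 < r ^+ mdeg (monom a) by rewrite exprn_gt0.
  have [N HN] := pc _ (mulr_gt0 e0 ra); exists N => i j Ni Nj.
  rewrite -mcoeffB -(ler_pM2r ra).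
  have [s -> sB] := HN i j Ni Nj; apply: le_trans sB.
  rewrite raddf_sum/= -[X in _ * X]ger0_norm ?exprn_ge0 ?(ltW r0)// -normrM mulr_suml.
  apply: le_trans (ler_norm_sum _ _ _) _; apply: ler_sum => x _.
  rewrite mcoeffZ mcoeffX; case: eqP => [->|_].
    by rewrite mulr1 normrM (ger0_norm (ltW ra)).
  by rewrite mulr0 mul0r normr0 mulr_ge0// exprn_ge0// ltW.
have [c Hc] := choice lim_ex.
have sum_tends (I : finType) (u : I -> nat -> C) (l : I -> C) :
    (forall i, tends (u i) (l i)) -> tends (fun j => \sum_i u i j) (\sum_i l i).
  move=> H; elim: (index_enum I) => [|i s IH].
    by rewrite big_nil; apply: (tends_ext _ (tends_cst 0)) => j; rewrite big_nil.
  by rewrite big_cons; apply: (tends_ext _ (tendsD (H i) IH)) => j; rewrite big_cons.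
have norm_tends (u : nat -> C) l : tends u l -> tends (fun j => `|u j|) `|l|.
  move=> ul e /ul[N HN]; exists N => i /HN; apply: le_trans.
  exact: ler_dist_dist.
exists r, c; split=> //.
- exists B => N.
  have := sum_tends _ _ _ (fun a : {ffun 'I_n -> 'I_N} =>
    tendsZ (\prod_i r ^+ a i) (norm_tends _ _ (Hc (fun i => a i)))).
  move=> T; rewrite -subr_ge0.
  have {}T := tendsD (tends_cst B) (tendsZ (-1) T); rewrite mulN1r in T.
  have Bge j : 0 <= B + -1 * \sum_(a : {ffun 'I_n -> 'I_N}) \prod_i r ^+ a i * `|mcoeff (monom (fun i => a i)) (p j)|.
    rewrite mulN1r subr_ge0; under eq_bigr do rewrite mulrC.
    by apply: majorant_coef (pB j); exact: ltW.
  have := tends_ge0 T Bge; rewrite !subr_ge0; under eq_bigr do rewrite mulrC.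
  by [].
- move=> z wz; apply/cvg_tends => e e0.
  have e3 : 0 < e / 3 by rewrite divr_gt0.
  have [N HN] := pc _ e3; have [N0 HN0] := meval_box (p N).
  have [K HK] := pf z wz _ e3.
  exists N0 => M MN0.
  set S := \sum_(a : {ffun 'I_n -> 'I_M}) _.
  have H1 : `|S - meval_at w z (p N)| <= e / 3.
    rewrite /meval_at (HN0 M _ MN0) /S -sumrB.
    under eq_bigr do rewrite -mulrBl.
    have T := sum_tends _ _ _ (fun a : {ffun 'I_n -> 'I_M} =>
       tendsZ (\prod_i (z 0 i - w 0 i) ^+ a i)
        (tendsD (Hc (fun i => a i)) (tends_cst (- mcoeff (monom (fun i => a i)) (p N))))).
    under eq_bigr do rewrite mulrC.
    apply: (tends_bound (N := N) T); first exact: ltW.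
    move=> i Ni; have := HN i N Ni (leqnn _) => /(majorant_coef (ltW r0) M); apply: le_trans.
    apply: le_trans (ler_norm_sum _ _ _) _; apply: ler_sum => a _.
    rewrite -mcoeffB mulrC normrM ler_wpM2l// normr_prod; apply: ler_prod => j _.
    by rewrite normr_ge0 normrX lerXn2r ?nnegrE ?(ltW r0)// ltW.
  set L := maxn N K.
  have H2 : `|meval_at w z (p N) - meval_at w z (p L)| <= e / 3.
    rewrite /meval_at -mevalB.
    apply: majorant_meval (HN N L (leqnn _) (leq_maxl _ _)) _ => [|a]; first exact: ltW.
    exact: ltW (wz a).
  have H3 : `|meval_at w z (p L) - f z| <= e / 3 by apply: HK; exact: leq_maxr.
  have -> : S - f z = (S - meval_at w z (p N)) + (meval_at w z (p N) - meval_at w z (p L)) +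
      (meval_at w z (p L) - f z) by ring.
  have -> : e = e / 3 + e / 3 + e / 3 by field.
  by rewrite (le_trans (ler_normD _ _))// lerD// (le_trans (ler_normD _ _))// lerD.
Qed.

Lemma analytic_at_an n (f : 'rV[C]_n -> C) (w : 'rV[C]_n) : analytic_at f w -> an w f.
Proof.
move=> [r [c [r0 [M HM] Hf]]]; exists r => //; exists M.
exists (fun N => \sum_(a : {ffun 'I_n -> 'I_N}) c (fun i => a i) *: mpolyX C (monom (fun i => a i))).
have prodE (a : 'I_n -> nat) : \prod_i r ^+ a i = r ^+ mdeg (monom a).
  by rewrite mdegE -prodrXr; apply: eq_bigr => i _; rewrite monomE.
split.
- move=> N; apply: majorantW (HM N); apply: majorant_sum => a _.
  by rewrite prodE; exact: majorantZX.
- pose s N := \sum_(a : {ffun 'I_n -> 'I_N}) `|c (fun i => a i)| * \prod_i r ^+ a i.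
  have term0 (a : 'I_n -> nat) : 0 <= `|c a| * \prod_i r ^+ a i.
    by rewrite mulr_ge0// prodr_ge0// => i _; rewrite exprn_ge0// ltW.
  have smono i j : (i <= j)%N -> s i <= s j.
    move=> ij; rewrite [leRHS](@box_split n _ (fun a => `|c a| * \prod_i r ^+ a i) i j ij).
    by rewrite lerDl sumr_ge0.
  (* The box sums of absolute values increase and are bounded by [M], hence are Cauchy; their
     differences majorise those of the partial sums. *)
  have sc : cauchy_seq s.
    apply: (Cmono smono (M := M)) => N; rewrite HM andbT.
    by apply: sumr_ge0 => a _; exact: term0.
  move=> e e0; have [N HN] := sc _ e0; exists N.
  have key i j : (N <= i)%N -> (i <= j)%N -> majorant r
    (\sum_(a : {ffun 'I_n -> 'I_j}) c (fun i => a i) *: mpolyX C (monom (fun i => a i)) -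
     \sum_(a : {ffun 'I_n -> 'I_i}) c (fun i => a i) *: mpolyX C (monom (fun i => a i))) e.
    move=> Ni ij.
    rewrite (@box_split n _ (fun a => c a *: mpolyX C (monom a)) i j ij) addrAC subrr add0r.
    apply: (@majorantW _ _ _ _ (\sum_(a : {ffun 'I_n -> 'I_j} | ~~ [forall k, a k < i]%N)
       `|c (fun i => a i)| * \prod_i r ^+ a i)).
      by apply: majorant_sum => a _; rewrite prodE; exact: majorantZX.
    have := HN j i (leq_trans Ni ij) Ni.
    rewrite /s [\sum_(a : {ffun 'I_n -> 'I_j}) _](@box_split n _ (fun a => `|c a| * \prod_i r ^+ a i) i j ij).
    by rewrite addrAC subrr add0r ger0_norm// sumr_ge0.
  move=> i j Ni Nj; case: (leqP j i) => ij; first exact: key.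
  by rewrite -opprB; apply: majorantN; apply: key => //; exact: ltnW.
- move=> z wz; have /cvg_tends := Hf z wz; apply: tends_ext => N.
  rewrite /meval_at raddf_sum/=; apply: eq_bigr => a _.
  by rewrite mevalZ mevalX; congr (_ * _); apply: eq_bigr => i _; rewrite monomE.
Qed.

End AnalyticAt.

(** * Orbit spaces of isotropic vectors *)

Section Forms.
Variables (A : comNzRingType) (n : nat) (G : 'M[A]_n).
Implicit Types x y z : 'rV[A]_n.

Lemma bformDl x y z : bform G (x + y) z = bform G x z + bform G y z.
Proof. by rewrite /bform !mulmxDl mxE. Qed.

Lemma bformDr x y z : bform G x (y + z) = bform G x y + bform G x z.
Proof. by rewrite /bform linearD/= mulmxDr mxE. Qed.

Lemma bformZl c x y : bform G (c *: x) y = c * bform G x y.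
Proof. by rewrite /bform -!scalemxAl mxE. Qed.

Lemma bformZr c x y : bform G x (c *: y) = c * bform G x y.
Proof. by rewrite /bform linearZ/= -scalemxAr mxE. Qed.

Lemma bformNl x y : bform G (- x) y = - bform G x y.
Proof. by rewrite -scaleN1r bformZl mulN1r. Qed.

Lemma bformNr x y : bform G x (- y) = - bform G x y.
Proof. by rewrite -scaleN1r bformZr mulN1r. Qed.

Lemma bform0l x : bform G 0 x = 0.
Proof. by rewrite -(scale0r 0) bformZl mul0r. Qed.

Lemma bform_sym x y : G^T = G -> bform G x y = bform G y x.
Proof.
move=> Gs; rewrite /bform; have -> M : (M : 'M[A]_1) 0 0 = M^T 0 0 by rewrite mxE.
by rewrite !trmx_mul trmxK Gs mulmxA.
Qed.

Lemma bform_delta i j : bform G (delta_mx 0 i) (delta_mx 0 j) = G i j.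
Proof.
rewrite /bform -rowE trmx_delta mxE (bigD1 j)//= !mxE !eqxx mulr1 big1 ?addr0// => k kj.
by rewrite !mxE (negPf kj) mulr0.
Qed.

Lemma bform_mul x y (g : 'M[A]_n) : bform G (x *m g) (y *m g) = bform (g *m G *m g^T) x y.
Proof. by rewrite /bform trmx_mul !mulmxA. Qed.

End Forms.

Lemma bform_map (A B : comNzRingType) (f : {rmorphism A -> B}) n (G : 'M[A]_n) x y :
  bform (map_mx f G) (map_mx f x) (map_mx f y) = f (bform G x y).
Proof. by rewrite /bform matrix.map_trmx -!map_mxM mxE. Qed.

Lemma lattice_isomP n (G G' g : 'M[int]_n) :
  lattice_isom G G' g <-> g \in unitmx /\ g *m G' *m g^T = G.
Proof.
split=> -[gu H]; split=> //; last by move=> x y; rewrite bform_mul H.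
by apply/matrixP => i j; rewrite -!bform_delta -bform_mul H.
Qed.

Lemma lattice_isom_id n (G : 'M[int]_n) : lattice_isom G G 1%:M.
Proof. by apply/lattice_isomP; rewrite unitmx1 trmx1 mulmx1 mul1mx. Qed.

Lemma lattice_isom_mul n (G G' G'' g h : 'M[int]_n) :
  lattice_isom G G' g -> lattice_isom G' G'' h -> lattice_isom G G'' (g *m h).
Proof.
move=> [gu gH] [hu hH]; split; first by rewrite unitmx_mul gu.
by move=> x y; rewrite !mulmxA hH gH.
Qed.

Lemma lattice_isom_inv n (G G' g : 'M[int]_n) : lattice_isom G G' g -> lattice_isom G' G (invmx g).
Proof.
move=> [gu H]; split; first by rewrite unitmx_inv.
by move=> x y; rewrite -H !mulmxKV.
Qed.

Lemma open_locally (C : numClosedFieldType) n (U : set 'rV[C]_n) :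
  open U <-> forall v, U v -> locally v U.
Proof.
split.
- move=> oU v Uv; have /nbhs_ballP[e e0 He] : nbhs v U by exact: open_nbhs_nbhs.
  exists e => // z vz; apply: He; split=> // i j; rewrite ord1 /ball/= distrC; exact: vz.
- move=> H; rewrite openE => v Uv; have [e e0 He] := H v Uv.
  apply/nbhs_ballP; exists e => // z [_ vz]; apply: He => i.
  by have := vz 0 i; rewrite /ball/= distrC.
Qed.

Lemma vline_eqP (C : fieldType) n (u v : 'rV[C]_n) : v != 0 ->
  (<[u]> = <[v]>)%VS <-> exists2 c, c != 0 & u = c *: v.
Proof.
move=> v0; split.
- move=> uv; have : u \in <[v]>%VS by rewrite -uv memv_line.
  move/vlineP => [c uc]; exists c => //; apply: contra_neq v0 => c0.
  have : v \in <[u]>%VS by rewrite uv memv_line.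
  by move/vlineP => [d ->]; rewrite uc c0 scale0r scaler0.
- move=> [c c0 ->]; apply/eqP; rewrite eqEsubv -!memvE.
  rewrite memvZ ?memv_line//=; apply/vlineP; exists c^-1.
  by rewrite scalerA mulVf// scale1r.
Qed.

Lemma locally_near_pt (C : numFieldType) n (e : C) (v z : 'rV[C]_n) : near_pt e v z -> 0 < e -> locally z (near_pt e v).
Proof.
move=> vz e0.
have [i|M /andP[M0 Me] HM] := @finite_bound C _ e (fun i => `|z 0 i - v 0 i|) e0.
  by rewrite normr_ge0 vz.
exists (e - M) => [|y zy i]; first by rewrite subr_gt0.
rewrite -(subrK (z 0 i) (y 0 i)) -addrA; apply: le_lt_trans (ler_normD _ _) _.
by rewrite -(subrK M e) ltr_leD.
Qed.

Definition locally_analytic (C : numFieldType) n (v : 'rV[C]_n) (S : 'rV[C]_n -> Prop) :=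
  exists k (F : 'I_k -> 'rV[C]_n -> C), (forall i, an v (F i)) /\ locally v (fun u => S u <-> forall i, F i u = 0).

(** Points of [E] near [v] where [S1] fails and where [S2] fails are joined by a segment in [E],
    which contradicts [path_cover]. With [E] the whole space or a hyperplane this is the
    irreducibility of a linear germ. *)
Lemma local_cover (C : numFieldType) n (v : 'rV[C]_n) (E S1 S2 : 'rV[C]_n -> Prop) :
  monotone_cauchy C -> seq_complete C ->
  (forall u w t, E u -> E w -> E (u + t *: (w - u))) ->
  locally_analytic v S1 -> locally_analytic v S2 ->
  locally v (fun u => E u -> S1 u \/ S2 u) ->
  locally v (fun u => E u -> S1 u) \/ locally v (fun u => E u -> S2 u).
Proof.
move=> Cmono Ccomp Econv [k1 [F1 [F1a S1F]]] [k2 [F2 [F2a S2F]]] H.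
have l1 := locally_fin (fun i => an_open Cmono (F1a i)).
have l2 := locally_fin (fun i => an_open Cmono (F2a i)).
have [e e0 He] := locallyI (locallyI (locallyI l1 S1F) (locallyI l2 S2F)) H.
have [H1|/existsNP[p]] := pselect (forall u, near_pt e v u -> E u -> S1 u); first by left; exists e.
move=> /not_implyP[vp /not_implyP[Ep nS1]].
right; exists e => // q vq Eq; apply: contrapT => nS2.
pose gam (t : C) := p + t *: (q - p).
have vgam t : unit_itv t -> near_pt e v (gam t).
  move=> /andP[t0 t1] i; rewrite !mxE.
  have -> : p 0 i + t * (q 0 i - p 0 i) - v 0 i = (1 - t) * (p 0 i - v 0 i) + t * (q 0 i - v 0 i) by ring.
  apply: le_lt_trans (ler_normD _ _) _; rewrite !normrM (ger0_norm t0) ger0_norm ?subr_ge0//.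
  have [->|tn0] := eqVneq t 0; first by rewrite subr0 mul1r mul0r addr0; exact: vp.
  have -> : e = (1 - t) * e + t * e by ring.
  apply: ler_ltD.
    by rewrite ler_wpM2l ?subr_ge0//; apply: ltW; exact: vp.
  have tp : 0 < t by rewrite lt_def tn0.
  by rewrite ltr_pM2l//; exact: vq.
have ga t i : an (const_mx t : 'rV[C]_1) (fun z : 'rV[C]_1 => gam (z 0 0) 0 i).
  apply: (@an_ext _ _ _ (fun z : 'rV[C]_1 => p 0 i + z 0 0 * (q - p) 0 i)).
    by apply: locallyT => z; rewrite !mxE.
  apply: anD; first exact: an_cst.
  by apply: anM; [exact: an_coord|exact: an_cst].
have gcont t : unit_itv t -> locally (const_mx t : 'rV[C]_1) (fun z => near_pt e v (gam (z 0 0))).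
  move=> t01; apply: (locally_comp (M := fun z : 'rV[C]_1 => gam (z 0 0))) => //.
  by rewrite mxE; apply: locally_near_pt => //; exact: vgam.
have along S k (F : 'I_k -> 'rV[C]_n -> C) :
    (forall u, near_pt e v u -> (forall i, an u (F i)) /\ (S u <-> forall i, F i u = 0)) ->
    forall t, unit_itv t -> analytic_along gam (fun t => S (gam t)) t.
  move=> HF t t01; exists k, F; split; first by case: (HF _ (vgam t t01)).
  have [d d0 Hd] := gcont t t01; exists d => // s s01 st.
  have := Hd (const_mx s); rewrite mxE => /(_ _)/HF[]; last by [].
  by apply: near_pt1; rewrite !mxE.
have [|||K|K] := @path_cover C Cmono Ccomp n gam (fun t => S1 (gam t)) (fun t => S2 (gam t)) ga.
- by apply: (along S1 k1 F1) => u /He[[[]]].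
- by apply: (along S2 k2 F2) => u /He[[_ []]].
- by move=> t t01; case: (He _ (vgam t t01)) => _; apply; exact: Econv.
- by apply: nS1; have := K 0; rewrite /gam scale0r addr0; apply; rewrite /unit_itv lexx ler01.
- by apply: nS2; have := K 1; rewrite /gam scale1r addrC subrK; apply; rewrite /unit_itv lexx ler01.
Qed.

Lemma locally_analytic1 (C : numFieldType) n (v : 'rV[C]_n) (f : 'rV[C]_n -> C) : an v f ->
  locally_analytic v (fun u => f u = 0).
Proof.
move=> fa; exists 1%N, (fun=> f); split=> //; apply: locallyT => u.
by split=> // /(_ 0).
Qed.

Lemma an_integral (C : numFieldType) n (v : 'rV[C]_n) (f g : 'rV[C]_n -> C) :
  monotone_cauchy C -> seq_complete C -> an v f -> an v g ->
  locally v (fun u => f u * g u = 0) -> locally v (fun u => f u = 0) \/ locally v (fun u => g u = 0).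
Proof.
move=> Cmono Ccomp fa ga H.
have [||K|K] := @local_cover _ _ v (fun=> True) _ _ Cmono Ccomp _ (locally_analytic1 fa) (locally_analytic1 ga).
- by [].
- by apply: locallyS H => u /eqP; rewrite mulf_eq0 => /orP[]/eqP ? _; [left|right].
- by left; apply: locallyS K => u; apply.
- by right; apply: locallyS K => u; apply.
Qed.

(** * The cone over the period domain and its orbit space *)

Section Period.
Variables (C : numClosedFieldType) (n : nat) (G : 'M[int]_n).
Hypotheses (Cmono : monotone_cauchy C) (Ccomp : seq_complete C) (Gsym : G^T = G).
Local Notation V := 'rV[C]_n.
Local Notation extC := (map_mx (intr : int -> C)).
Local Notation X := (space_D_mod_Gamma C G).
Implicit Types (u v w y z : V) (g : 'M[int]_n).

Definition coneD v := formC G v v = 0 /\ 0 < formC G v (conjV v).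

Definition orb v := Gamma_orbit G <[v]>%VS.

Lemma formC_sym v w : formC G v w = formC G w v.
Proof. by apply: bform_sym; rewrite matrix.map_trmx Gsym. Qed.

Lemma formCDl u v w : formC G (u + v) w = formC G u w + formC G v w.
Proof. exact: bformDl. Qed.

Lemma formCDr u v w : formC G u (v + w) = formC G u v + formC G u w.
Proof. exact: bformDr. Qed.

Lemma formCZl c v w : formC G (c *: v) w = c * formC G v w.
Proof. exact: bformZl. Qed.

Lemma formCZr c v w : formC G v (c *: w) = c * formC G v w.
Proof. exact: bformZr. Qed.

Lemma conjVZ c v : conjV (c *: v) = Num.conj c *: conjV v.
Proof. by apply/rowP => i; rewrite !mxE rmorphM. Qed.

Lemma conjVD u v : conjV (u + v) = conjV u + conjV v.
Proof. by apply/rowP => i; rewrite !mxE rmorphD. Qed.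

Lemma conjVK v : conjV (conjV v) = v.
Proof. by apply/rowP => i; rewrite !mxE conjCK. Qed.

Lemma conjV_int (l : 'rV[int]_n) : conjV (extC l : V) = extC l.
Proof. by apply/rowP => i; rewrite !mxE rmorph_int. Qed.

Lemma conjV_mul v g : conjV (v *m extC g) = conjV v *m extC g.
Proof.
rewrite /conjV map_mxM; congr (_ *m _); apply/matrixP => i j; rewrite !mxE.
by rewrite rmorph_int.
Qed.

Lemma formC_conj v w : formC G (conjV v) (conjV w) = Num.conj (formC G v w).
Proof.
rewrite /formC -(bform_map Num.conj) /conjV; congr (bform _ _ _).
by apply/matrixP => i j; rewrite !mxE rmorph_int.
Qed.

Lemma formC_Aut g v w : Aut G g -> formC G (v *m extC g) (w *m extC g) = formC G v w.
Proof.
move/lattice_isomP => [_ H]; rewrite /formC bform_mul; congr (bform _ _ _).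
by rewrite matrix.map_trmx -!map_mxM/= H.
Qed.

Lemma coneD_neq0 v : coneD v -> v != 0.
Proof. by case=> _; apply: contraTneq => ->; rewrite [formC _ _ _]bform0l ltxx. Qed.

Lemma coneDZ c v : c != 0 -> coneD v -> coneD (c *: v).
Proof.
move=> c0 [v0 vp]; split; first by rewrite formCZl formCZr v0 !mulr0.
by rewrite formCZl conjVZ formCZr mulrA -normCK mulr_gt0// exprn_gt0// normr_gt0.
Qed.

Lemma coneD_Aut g v : Aut G g -> coneD v -> coneD (v *m extC g).
Proof. by move=> ga [v0 vp]; split; rewrite ?conjV_mul formC_Aut. Qed.

Lemma domDP v : v != 0 -> domD G <[v]>%VS <-> coneD v.
Proof.
move=> v0; split=> [[w [vw w0 wp]]|[v00 vp]]; last by exists v.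
have wn0 : w != 0 by apply: coneD_neq0.
by have [c c0 ->] := (vline_eqP v wn0).1 vw; apply: coneDZ.
Qed.

Lemma Gamma_act_vline g v : Gamma_act g <[v]>%VS = <[v *m extC g]>%VS.
Proof. by rewrite /Gamma_act limg_line lfunE. Qed.

Lemma orb_self v : orb v <[v]>%VS.
Proof.
exists 1%:M; first exact: lattice_isom_id.
by rewrite Gamma_act_vline map_mx1 mulmx1.
Qed.

Lemma orb_Aut g v : Aut G g -> orb (v *m extC g) = orb v.
Proof.
move=> ga; apply/seteqP; split=> L [h ha <-] /=; rewrite Gamma_act_vline.
  exists (g *m h); first exact: lattice_isom_mul ha.
  by rewrite Gamma_act_vline map_mxM mulmxA.
exists (invmx g *m h); first by apply: lattice_isom_mul ha; exact: lattice_isom_inv.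
rewrite Gamma_act_vline -mulmxA -map_mxM mulmxA mulmxV ?mul1mx//.
by case: ga.
Qed.

Lemma orbZ c v : c != 0 -> orb (c *: v) = orb v.
Proof.
move=> c0; rewrite /orb; have [->|v0] := eqVneq v 0; first by rewrite scaler0.
by congr Gamma_orbit; apply/(vline_eqP _ v0); exists c.
Qed.

Lemma orb_eqP v w : w != 0 -> orb v = orb w -> exists g c, [/\ Aut G g, c != 0 & v *m extC g = c *: w].
Proof.
move=> w0 vw; have := orb_self w; rewrite -vw => -[g ga]; rewrite Gamma_act_vline.
by move/(vline_eqP _ w0) => [c c0 E]; exists g, c.
Qed.

Lemma points_projective L : points (projective_space C n) L <-> exists2 v, v != 0 & L = <[v]>%VS.
Proof.
split=> [[v [_ v0] <-]|[v v0 ->]]; first by exists v.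
by exists v.
Qed.

Lemma points_DP L : points (space_D C G) L <-> exists2 v, coneD v & L = <[v]>%VS.
Proof.
split=> [[/points_projective[v v0 ->]]|[v vD ->]]; first by move/(domDP v0); exists v.
have v0 := coneD_neq0 vD.
by split; [apply/points_projective; exists v|apply/domDP].
Qed.

Lemma points_XP (O : set {vspace V}) : points X O <-> exists2 v, coneD v & O = orb v.
Proof.
split=> [[L /points_DP[v vD ->] <-]|[v vD ->]]; first by exists v.
by exists <[v]>%VS => //; apply/points_DP; exists v.
Qed.

Lemma locally_neq0 v : v != 0 -> locally v (fun y => y != 0).
Proof.
move=> v0; have [i vi] : exists i, v 0 i != 0.
  apply: contrapT => K; case/eqP: v0; apply/rowP => i; rewrite mxE.
  by apply/eqP/negPn/negP => vi; apply: K; exists i.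
have := an_neq0 (an_coord v i) vi.
by apply: locallyS => y; apply: contra_neq => ->; rewrite mxE.
Qed.

Lemma open_projective (U : set {vspace V}) : is_open (projective_space C n) U <->
  (forall L, U L -> exists2 v, v != 0 & L = <[v]>%VS) /\
  (forall v, v != 0 -> U <[v]>%VS -> locally v (fun y => y != 0 -> U <[y]>%VS)).
Proof.
split.
- move=> [UP [W /open_locally oW WU]]; split=> [L /UP/points_projective//|v v0 Uv].
  have : (W `&` [set v : V | v != 0]) v by rewrite -WU; do 2?split.
  move=> [Wv _]; apply: locallyS (oW v Wv) => y Wy y0.
  have : (W `&` [set v : V | v != 0]) y by [].
  by rewrite -WU => -[].
- move=> [UP H]; split=> [L /UP/points_projective//|].
  exists [set v | v != 0 /\ U <[v]>%VS].
    apply/open_locally => v [v0 Uv].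
    by apply: locallyS (locallyI (locally_neq0 v0) (H v v0 Uv)) => y [y0 /(_ y0)].
  by apply/seteqP; split=> v /=; [case=> -[_ v0] Uv|case=> -[v0 Uv] _]; do 2?split.
Qed.

Lemma open_X_locally W v : is_open X W -> coneD v -> W (orb v) ->
  locally v (fun y => coneD y -> W (orb y)).
Proof.
move=> [WX [U /open_projective[UP oU] WU]] vD Wv.
have v0 := coneD_neq0 vD.
have : (points (space_D C G) `&` Gamma_orbit G @^-1` W) <[v]>%VS.
  by split=> //; apply/points_DP; exists v.
rewrite WU => -[Uv _]; apply: locallyS (oU v v0 Uv) => y Uy yD.
have y0 := coneD_neq0 yD.
have : (U `&` domD G) <[y]>%VS by split; [exact: Uy|apply/domDP].
by rewrite -WU => -[].
Qed.

Lemma an_scaled_linear (u : V) (a : 'cV[C]_n) (M : 'M[C]_n) (k : C) i : (u *m a) 0 0 != 0 ->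
  an u (fun z => ((k / (z *m a) 0 0) *: (z *m M)) 0 i).
Proof.
move=> ua; apply: (@an_ext _ _ _ (fun z => k * ((z *m a) 0 0)^-1 * (z *m col i M) 0 0)).
  apply: locallyT => z; rewrite [in RHS]mxE; congr (_ * _).
  by rewrite !mxE; apply: eq_bigr => j _; rewrite !mxE.
apply: anM; last exact: an_linear.
by apply: anZ; apply: anV => //; exact: an_linear.
Qed.

Lemma an_scale c v i : an v (fun z => (c *: z) 0 i).
Proof.
by apply: an_ext (anZ c (an_coord v i)); apply: locallyT => z; rewrite mxE.
Qed.

Lemma an_mulmx k (M : 'M[C]_(n, k)) v i : an v (fun z => (z *m M) 0 i).
Proof.
apply: an_ext (an_linear v (col i M)); apply: locallyT => z.
by rewrite !mxE; apply: eq_bigr => j _; rewrite !mxE.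
Qed.

Lemma open_X W : (forall o, W o -> exists2 v, coneD v & o = orb v) ->
  (forall v, coneD v -> W (orb v) -> locally v (fun y => coneD y -> W (orb y))) ->
  is_open X W.
Proof.
move=> WP WO; split=> [x /WP/points_XP//|].
(* An open set of projective space also contains lines off D: these are the lines meeting some
   polydisc whose points in the cone all have their orbits in [W]. *)
exists [set L | exists u v e, [/\ u != 0, L = <[u]>%VS, 0 < e, near_pt e v u &
    forall y, near_pt e v y -> coneD y -> W (orb y)]].
  apply/open_projective; split=> [L [u [v [e [u0 -> _ _ _]]]]|u u0]; first by exists u.
  move=> [u' [v [e [u'0 /(vline_eqP _ u'0)[c c0 uu'] e0 vu' H]]]].
  have E : u' = c^-1 *: u by rewrite uu' scalerA mulVf// scale1r.
  have := locally_near_pt vu' e0; rewrite E => /(locally_comp (an_scale c^-1 u)).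
  apply: locallyS => y vy y0; exists (c^-1 *: y), v, e; split=> //.
    by rewrite scaler_eq0 invr_eq0 negb_or c0.
  by apply/(vline_eqP _ _); [rewrite scaler_eq0 invr_eq0 negb_or c0|exists c => //; rewrite scalerA divff// scale1r].
apply/seteqP; split=> L /=.
- move=> [/points_DP[v vD ->] Wv]; have v0 := coneD_neq0 vD.
  split; last by apply/domDP.
  have [e e0 He] := WO v vD Wv.
  by exists v, v, e; split=> //; exact: near_pt_refl.
- move=> [[u [v [e [u0 -> e0 vu H]]]] /(domDP u0) uD].
  by split; [apply/points_DP; exists u|exact: H].
Qed.

Lemma hol_X_an W (f : set {vspace V} -> C) v : hol X W f -> is_open X W -> coneD v -> W (orb v) ->
  exists2 F, an v F & locally v (fun y => coneD y -> W (orb y) /\ f (orb y) = F y).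
Proof.
move=> fW oW vD Wv; have v0 := coneD_neq0 vD.
have [|U [F [oU Uv FU fF]]] := fW <[v]>%VS.
  by split=> //; apply/points_DP; exists v.
have [|U' [F' [oU' U'v F'a FF']]] := FU v.
  by split=> //; split.
exists F'; first by apply: analytic_at_an => //; apply: F'a.
have [_ /(_ v v0 Uv) lU] := (open_projective U).1 oU.
have lU' := (open_locally _).1 oU' v U'v.
apply: locallyS (locallyI (locallyI lU lU') (open_X_locally oW vD Wv)) => y [[Uy U'y] Wy] yD.
have y0 := coneD_neq0 yD; split; first exact: Wy.
rewrite -FF'//=; last by split; [split|apply: Uy].
apply: (fF <[y]>%VS); first exact: Uy.
by split; [apply/points_DP; exists y|exact: Wy].
Qed.

(* The second hypothesis only constrains f on the slice where the linear form a
   is constant: homogeneity does the rest. *)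
Lemma hol_X W (f : set {vspace V} -> C) :
  (forall o, W o -> exists v F (a : 'cV[C]_n), [/\ coneD v, o = orb v, (v *m a) 0 0 != 0, an v F &
     locally v (fun y => coneD y -> (y *m a) 0 0 = (v *m a) 0 0 -> W (orb y) -> f (orb y) = F y)]) ->
  hol X W f.
Proof.
move=> H L [/points_DP[v0 v0D ->] Wv0].
have [v [F [a [vD ov va Fa fF]]]] := H _ Wv0.
have vn0 := coneD_neq0 vD; have v0n0 := coneD_neq0 v0D.
have [g [c [ga c0 vg]]] := orb_eqP vn0 ov.
pose M : 'M[C]_n := c^-1 *: extC g.
have Mv0 : v0 *m M = v by rewrite -scalemxAr vg scalerA mulVf// scale1r.
have MD y : coneD y -> coneD (y *m M).
  by move=> yD; rewrite -scalemxAr; apply: coneDZ; [rewrite invr_eq0|exact: coneD_Aut].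
have Morb y : orb (y *m M) = orb y by rewrite -scalemxAr orbZ ?invr_eq0// orb_Aut.
have [e e0 He] := locallyI (an_open Cmono Fa) fF.
pose k := (v *m a) 0 0.
(* [nu] rescales [z *m M] into the slice where the linear form [a] equals [k]; it is homogeneous of
   degree 0, so it depends only on the line of [z]. *)
pose nu z : V := (k / (z *m (M *m a)) 0 0) *: (z *m M).
have nua u i : (u *m (M *m a)) 0 0 != 0 -> an u (fun z => nu z 0 i).
  by move=> ua; exact: an_scaled_linear.
have nuZ d u : d != 0 -> nu (d *: u) = nu u.
  move=> d0; rewrite /nu.
  have -> : (d *: u *m (M *m a)) 0 0 = d * (u *m (M *m a)) 0 0 by rewrite -scalemxAl mxE.
  rewrite -scalemxAl scalerA; congr (_ *: _).
  by rewrite invfM mulrA mulrAC mulrVK ?unitfE// mulrC.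
pose U := [set L | exists u, [/\ u != 0, L = <[u]>%VS, (u *m (M *m a)) 0 0 != 0 & near_pt e v (nu u)]].
have Uu u : u != 0 -> U <[u]>%VS -> (u *m (M *m a)) 0 0 != 0 /\ near_pt e v (nu u).
  move=> u0 [u' [u'0 /(vline_eqP _ u'0)[d d0 ->] ua vu]]; rewrite nuZ// -scalemxAl mxE.
  by rewrite mulf_neq0.
have locU u : u != 0 -> U <[u]>%VS -> locally u (fun y => y != 0 -> U <[y]>%VS).
  move=> u0 /(Uu u u0)[ua vu].
  have l1 := locally_comp (fun i => nua u i ua) (locally_near_pt vu e0).
  have l2 : locally u (fun z => (z *m (M *m a)) 0 0 != 0).
    by have := an_neq0 (an_linear u (M *m a)) ua.
  by apply: locallyS (locallyI l1 l2) => y [vy ya] y0; exists y.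
have oU : is_open (projective_space C n) U.
  by apply/open_projective; split=> // L' [u [u0 -> _ _]]; exists u.
(* Any generator of the line serves, by the homogeneity of [nu]. *)
pose rep (L' : {vspace V}) : V := get [set u | u != 0 /\ L' = <[u]>%VS].
have repE u : u != 0 -> nu (rep <[u]>%VS) = nu u.
  move=> u0; rewrite /rep; have : [set u' | u' != 0 /\ <[u]>%VS = <[u']>%VS] u by [].
  by move/getI => /= [r0 /(vline_eqP _ r0)[d d0 E]]; rewrite -(nuZ _ _ d0) -E.
exists U, (fun L' => F (nu (rep L'))); split=> //.
- exists v0; split=> //; first by rewrite mulmxA Mv0.
  by rewrite /nu mulmxA Mv0 divff// scale1r; exact: near_pt_refl.
- move=> u [[_ u0] Uu0].
  exists [set y | y != 0 /\ U <[y]>%VS], (fun y => F (nu y)); split=> //.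
  + apply/open_locally => y [y0 Uy].
    by apply: locallyS (locallyI (locally_neq0 y0) (locU y y0 Uy)) => z [z0 /(_ z0)].
  + move=> y [y0 /(Uu y y0)[ya vy]]; apply: an_analytic_at => //.
    apply: an_compose => //; first by move=> i; exact: nua.
    by case: (He _ vy).
  + by move=> y [y0 _] _; rewrite /= repE.
- move=> L' [u [u0 -> ua vu]] [/points_DP[u' u'D uu'] Wu].
  have uD : coneD u by apply/(domDP u0); rewrite uu'; apply/domDP => //; exact: coneD_neq0.
  rewrite /= repE//; have [_ <-] := He _ vu.
  + by rewrite /nu orbZ ?mulf_neq0 ?invr_eq0// Morb.
  + by apply: coneDZ; [rewrite mulf_neq0 ?invr_eq0|exact: MD].
  + by rewrite /nu -scalemxAl mxE -mulmxA divfK.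
  + by rewrite /nu orbZ ?mulf_neq0 ?invr_eq0// Morb.
Qed.

Lemma hol_X_sub W W' (f : set {vspace V} -> C) : W' `<=` W -> hol X W f -> hol X W' f.
Proof.
move=> W'W fW L [XL WL]; have [|U [F [oU UL FU fF]]] := fW L; first by split=> //; exact: W'W.
by exists U, F; split=> // y Uy [Xy Wy]; apply: fF => //; split=> //; exact: W'W.
Qed.

Lemma open_XP W x : is_open X W -> W x -> exists2 v, coneD v & x = orb v.
Proof. by move=> [WX _] /WX/points_XP. Qed.

Lemma open_XI W W' : is_open X W -> is_open X W' -> is_open X (W `&` W').
Proof.
move=> oW oW'; apply: open_X => [x [Wx _]|v vD [Wv W'v]]; first exact: open_XP oW Wx.
have := locallyI (open_X_locally oW vD Wv) (open_X_locally oW' vD W'v).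
by apply: locallyS => y [Wy W'y] yD; split; [exact: Wy|exact: W'y].
Qed.

Lemma open_orbits (P : V -> Prop) : (forall y, coneD y -> P y -> locally y P) ->
  is_open X [set x | exists y, [/\ coneD y, P y & x = orb y]].
Proof.
move=> oP; apply: open_X => [x [y [yD _ ->]]|w wD [y [yD Py wy]]]; first by exists y.
have [g [c [ga c0 wg]]] := orb_eqP (coneD_neq0 yD) wy.
pose M z : V := c^-1 *: (z *m extC g).
have Mw : M w = y by rewrite /M wg scalerA mulVf// scale1r.
have Ma i : an w (fun z => M z 0 i).
  apply: an_ext (anZ c^-1 (an_mulmx (extC g) w i)).
  by apply: locallyT => z; rewrite [RHS]mxE.
have := oP y yD Py; rewrite -Mw => /(locally_comp Ma).
apply: locallyS => z Pz zD; exists (M z); split=> //.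
  by apply: coneDZ; [rewrite invr_eq0|exact: coneD_Aut].
by rewrite /M orbZ ?invr_eq0// orb_Aut.
Qed.

Lemma open_points : is_open X (points X).
Proof.
have := @open_orbits (fun=> True) (fun y _ _ => locallyT y (fun=> I)).
congr is_open; apply/seteqP; split=> x /=.
  by move=> [y [yD _ ->]]; apply/points_XP; exists y.
by move/points_XP => [y yD ->]; exists y.
Qed.

Lemma analytic_germ_eq x A B : analytic_germ X x A -> germ_eq X x A B -> analytic_germ X x B.
Proof.
move=> [U [k [f [oU Ux fU AU]]]] [[U1 [oU1 U1x AB]] [U2 [oU2 U2x BA]]].
exists (U `&` (U1 `&` U2)), k, f; split=> //.
- by apply: open_XI => //; exact: open_XI.
- by move=> i; apply: hol_X_sub (fU i); exact: subIsetl.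
- apply/seteqP; split=> y.
  + move=> [By [Uy [U1y U2y]]]; have : (A `&` U) y by split=> //; apply: BA.
    by rewrite AU => -[_ H]; split.
  + move=> [[Uy [U1y U2y]] H]; split=> //; apply: AB; split=> //.
    by have [] : (A `&` U) y by rewrite AU; split.
Qed.

Lemma analytic_germI x A B : analytic_germ X x A -> analytic_germ X x B -> analytic_germ X x (A `&` B).
Proof.
move=> [U [k [f [oU Ux fU AU]]]] [U' [k' [f' [oU' U'x fU' BU']]]].
exists (U `&` U'), (k + k')%N, (fun i => match fintype.split i with inl j => f j | inr j => f' j end).
split=> //; first exact: open_XI.
  move=> i; case: (fintype.split i) => j; [apply: hol_X_sub (fU j)|apply: hol_X_sub (fU' j)].
    exact: subIsetl.
  exact: subIsetr.
apply/seteqP; split=> y.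
- move=> [[Ay By] [Uy U'y]]; split=> // i.
  have [_ HA] : [set y | U y /\ forall i, f i y = 0] y by rewrite -AU; split.
  have [_ HB] : [set y | U' y /\ forall i, f' i y = 0] y by rewrite -BU'; split.
  by case: (fintype.split i).
- move=> [[Uy U'y] H].
  have [Ay _] : (A `&` U) y.
    by rewrite AU; split=> // i; have := H (unsplit (inl i)); rewrite unsplitK.
  have [By _] : (B `&` U') y.
    by rewrite BU'; split=> // i; have := H (unsplit (inr i)); rewrite unsplitK.
  by [].
Qed.

Lemma locally_pair v w (P : 'rV[C]_(n + n) -> Prop) : locally (row_mx v w) P ->
  exists2 e : C, 0 < e & forall y z, near_pt e v y -> near_pt e w z -> P (row_mx y z).
Proof.
move=> [e e0 H]; exists e => // y z vy wz; apply: H => i; rewrite !mxE.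
by case: (fintype.split i).
Qed.

Lemma an_form k (A : 'M[C]_n) (M M' : 'M[C]_(k, n)) (u : 'rV[C]_k) :
  an u (fun z : 'rV[C]_k => bform A (z *m M) (z *m M')).
Proof.
apply: (@an_ext _ _ _ (fun z : 'rV[C]_k => \sum_(i <- index_enum 'I_n) (z *m (M *m A)) 0 i * (z *m M') 0 i)).
  apply: locallyT => z; rewrite /bform mulmxA [RHS]mxE; apply: eq_bigr => i _.
  by congr (_ * _); rewrite [RHS]mxE.
apply: an_sum => i _; apply: anM.
  apply: an_ext (an_linear u (col i (M *m A))); apply: locallyT => z.
  by rewrite !mxE; apply: eq_bigr => j _; rewrite !mxE.
apply: an_ext (an_linear u (col i M')); apply: locallyT => z.
by rewrite !mxE; apply: eq_bigr => j _; rewrite !mxE.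
Qed.

Lemma form_real v : formC G v (conjV v) \is Num.real.
Proof. by apply/CrealP; rewrite -formC_conj conjVK formC_sym. Qed.

Lemma locally_form_ge v : 0 < formC G v (conjV v) ->
  locally v (fun y => formC G v (conjV v) / 2 <= formC G y (conjV y)).
Proof.
set s := formC G v (conjV v) => s0; have s2 : 0 < s / 2 by rewrite divr_gt0.
(* Conjugation is not analytic, so continuity is taken from the bilinear form in two independent
   arguments, at the pair of [v] and [conjV v]. *)
pose F (z : 'rV[C]_(n + n)) := bform (extC G) (z *m col_mx 1%:M 0) (z *m col_mx 0 1%:M).
have Fa : an (row_mx v (conjV v)) F by exact: an_form.
have FE y z : F (row_mx y z) = formC G y z.
  by rewrite /F !mul_row_col !mulmx0 !mulmx1 addr0 add0r.
have [e e0 He] := locally_pair (an_continuous Fa s2).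
exists e => // y vy; have := He y (conjV y) vy; rewrite !FE => H.
have {}H := H _; rewrite -/s in H.
have {H} : `|formC G y (conjV y) - s| <= s / 2.
  by apply: H => i; rewrite !mxE -rmorphB norm_conjC.
rewrite real_ler_norml ?realB ?form_real// => /andP[H _].
rewrite -(subrK s (formC _ _ _)); apply: le_trans (_ : - (s / 2) + s <= _); last by rewrite lerD2r.
by rewrite {3}(splitr s) addKr.
Qed.

Lemma locally_pos v : 0 < formC G v (conjV v) -> locally v (fun y => 0 < formC G y (conjV y)).
Proof.
move=> s0; apply: locallyS (locally_form_ge s0) => y; apply: lt_le_trans.
by rewrite divr_gt0.
Qed.

(** If [g] moves the line of [v], some 2 by 2 minor of the pair [v *m extC g], [v] is non-zero, and
    it remains so for nearby pairs. *)
Lemma locally_proportional v (g : 'M[int]_n) : coneD v -> (forall c, v *m extC g <> c *: v) ->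
  exists2 e : C, 0 < e & forall y z c, near_pt e v y -> near_pt e v z -> z <> c *: (y *m extC g).
Proof.
move=> vD ng; have v0 := coneD_neq0 vD.
have [j vj] : exists j, v 0 j != 0.
  apply: contrapT => K; case/eqP: v0; apply/rowP => i; rewrite mxE.
  by apply/eqP/negPn/negP => vi; apply: K; exists i.
have [i vi] : exists i, (v *m extC g) 0 i * v 0 j - (v *m extC g) 0 j * v 0 i != 0.
  apply: contrapT => K; apply: (ng ((v *m extC g) 0 j / v 0 j)); apply/rowP => i.
  rewrite [RHS]mxE mulrAC; apply: (mulIf vj); rewrite divfK//; apply/eqP.
  by rewrite -subr_eq0; apply/negPn/negP => vi; apply: K; exists i.
pose F (z : 'rV[C]_(n + n)) := (z *m col_mx (extC g) 0) 0 i * (z *m col_mx 0 1%:M) 0 j -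
   (z *m col_mx (extC g) 0) 0 j * (z *m col_mx 0 1%:M) 0 i.
have lin (M : 'M[C]_(n + n, n)) l : an (row_mx v v) (fun z : 'rV[C]_(n + n) => (z *m M) 0 l).
  apply: an_ext (an_linear (row_mx v v) (col l M)); apply: locallyT => z.
  by rewrite !mxE; apply: eq_bigr => a _; rewrite !mxE.
have Fa : an (row_mx v v) F by apply: anB; apply: anM; exact: lin.
have FE y z : F (row_mx y z) = (y *m extC g) 0 i * z 0 j - (y *m extC g) 0 j * z 0 i.
  by rewrite /F !mul_row_col !mulmx0 !mulmx1 addr0 add0r.
have Fv : F (row_mx v v) != 0 by rewrite FE.
have [e e0 He] := locally_pair (an_neq0 Fa Fv).
exists e => // y z c vy vz zy; have := He y z vy vz; rewrite FE zy.
set t := y *m _; have E k : (c *: t) 0 k = c * t 0 k by rewrite mxE.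
by rewrite !E mulrCA [X in _ - X]mulrCA [t 0 j * _]mulrC subrr eqxx.
Qed.

(** Proper discontinuity on the period domain, stated on the cone over it; the scalar [c] is there
    because only lines matter. *)
Definition Aut_locally_finite := forall v, coneD v -> exists (S : seq 'M[int]_n) (e : C), 0 < e /\
  forall y z g c, near_pt e v y -> near_pt e v z -> coneD y -> coneD z -> Aut G g ->
    z = c *: (y *m extC g) -> g \in S.

(** The finitely many elements of [S0] outside the stabiliser of the line of [v] are excluded one by
    one by shrinking the polydisc. *)
Lemma slice v : Aut_locally_finite -> coneD v -> exists S : seq 'M[int]_n, [/\ uniq S,
  (forall g, g \in S <-> Aut G g /\ exists c, v *m extC g = c *: v) &
  exists2 e : C, 0 < e & forall y z g c, near_pt e v y -> near_pt e v z -> coneD y -> coneD z -> Aut G g ->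
    z = c *: (y *m extC g) -> g \in S].
Proof.
move=> Alf vD; have [S0 [e [e0 HS]]] := Alf v vD.
pose Q g := Aut G g /\ exists c, v *m extC g = c *: v.
pose S := undup [seq g <- S0 | `[< Q g >]].
have SP g : g \in S <-> Q g.
  rewrite mem_undup mem_filter; split=> [/andP[/asboolP//]|Qg].
  apply/andP; split; first exact/asboolP.
  case: Qg => ga [c vc]; have c0 : c != 0.
    apply: contraTneq (coneD_neq0 (coneD_Aut ga vD)) => c0.
    by rewrite vc c0 scale0r eqxx.
  apply: (HS v v g c^-1) => //; try exact: near_pt_refl.
  by rewrite vc scalerA mulVf// scale1r.
exists S; split=> //; first exact: undup_uniq.
have H g : g \in S0 -> locally v (fun=> True) -> exists2 d : C, 0 < d &
    forall y z c, near_pt d v y -> near_pt d v z -> coneD y -> coneD z -> Aut G g ->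
    z = c *: (y *m extC g) -> g \in S.
  move=> _ _; have [Qg|nQ] := pselect (Q g).
    by exists 1 => // *; apply/SP.
  have [ga|nga] := pselect (Aut G g); last by exists 1.
  have [c vc|d d0 Hd] := locally_proportional (g := g) vD; first by apply: nQ; split=> //; exists c.
  by exists d => // y z c vy vz _ _ _ zy; case: (Hd y z c vy vz).
have {}H : exists2 d : C, 0 < d & forall g, g \in S0 ->
    forall y z c, near_pt d v y -> near_pt d v z -> coneD y -> coneD z -> Aut G g ->
    z = c *: (y *m extC g) -> g \in S.
  apply: (@finite_min _ _ S0 (fun g d => forall y z c, near_pt d v y -> near_pt d v z -> coneD y -> coneD z ->
    Aut G g -> z = c *: (y *m extC g) -> g \in S)).
    by move=> g gS; apply: H => //; exact: locallyT.
  by move=> g d d' dd' Hd y z c vy vz; apply: Hd; [exact: near_ptW vy|exact: near_ptW vz].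
case: H => d d0 Hd; have [d2 d20 [dd de]] := min_pos d0 e0.
exists d2 => // y z g c vy vz yD zD ga zy.
apply: (Hd g _ y z c) => //; [|exact: near_ptW vy|exact: near_ptW vz].
by apply: (HS y z g c) => //; [exact: near_ptW vy|exact: near_ptW vz].
Qed.

(** * The chart at [v] and the stabiliser of its line *)

Section LocalStructure.
Variables (v : V) (S : seq 'M[int]_n).
Hypotheses (vD : coneD v) (S_uniq : uniq S).
Hypothesis SP : forall g, g \in S <-> Aut G g /\ exists c, v *m extC g = c *: v.
Hypothesis S_slice : exists2 e : C, 0 < e &
  forall y z g c, near_pt e v y -> near_pt e v z -> coneD y -> coneD z -> Aut G g ->
    z = c *: (y *m extC g) -> g \in S.

Local Notation s := (formC G v (conjV v)).
Local Notation vb := (conjV v).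

Let s_gt0 : 0 < s. Proof. by case: vD. Qed.
Let s_neq0 : s != 0. Proof. by rewrite gt_eqF. Qed.
Let vv : formC G v v = 0. Proof. by case: vD. Qed.
Let vbvb : formC G vb vb = 0. Proof. by rewrite formC_conj vv rmorph0. Qed.
Let vbv : formC G vb v = s. Proof. exact: formC_sym. Qed.

(** The projection to the orthogonal complement of the plane of [v] and [vb]; these two vectors are
    isotropic and pair to [s]. *)
Definition tau u : V := u - (formC G u vb / s) *: v - (formC G u v / s) *: vb.

(* The chart of the quadric at v, extended to a polynomial retraction of the ambient space. *)
Definition kap u : V := v + tau u - (formC G (tau u) (tau u) / (2 * s)) *: vb.

Lemma formCNl u w : formC G (- u) w = - formC G u w.
Proof. exact: bformNl. Qed.

Lemma formCNr u w : formC G u (- w) = - formC G u w.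
Proof. exact: bformNr. Qed.

Let formCE := (formCDl, formCDr, formCZl, formCZr, formCNl, formCNr, vv, vbvb, vbv).

Lemma tau_v u : formC G (tau u) v = 0.
Proof. by rewrite /tau !formCE mulr0 subr0 divfK// subrr. Qed.

Lemma tau_vb u : formC G (tau u) vb = 0.
Proof. by rewrite /tau !formCE mulr0 subr0 divfK// subrr. Qed.

Lemma kap_isotropic u : formC G (kap u) (kap u) = 0.
Proof.
rewrite /kap; move: (tau u) (tau_v u) (tau_vb u) => t tv tvb.
rewrite !formCE [formC G v t]formC_sym [formC G vb t]formC_sym tv tvb.
by field.
Qed.

Lemma kap_vb u : formC G (kap u) vb = s.
Proof. rewrite /kap; move: (tau u) (tau_vb u) => t tvb.
by rewrite !formCE tvb mulr0 subr0 addr0. Qed.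

Lemma kap_id y : formC G y y = 0 -> formC G y vb = s -> kap y = y.
Proof.
move=> yy ys; have tE : tau y = y - v - (formC G y v / s) *: vb.
  by rewrite /tau ys divff// scale1r.
have -> : kap y = v + tau y - (formC G (tau y) (tau y) / (2 * s)) *: vb by [].
have -> : formC G (tau y) (tau y) = - 2 * formC G y v.
  rewrite tE !formCE yy ys [formC G v y]formC_sym [formC G vb y]formC_sym ys.
  by field.
rewrite tE addrA [v + _]addrC subrK -addrA -opprD -scalerDl.
rewrite [X in X *: _](_ : _ = 0) ?scale0r ?subr0//.
by field.
Qed.

Lemma kap_v : kap v = v.
Proof. exact: kap_id. Qed.

Lemma kapK u : kap (kap u) = kap u.
Proof. by apply: kap_id; [exact: kap_isotropic|exact: kap_vb]. Qed.

Lemma an_formC (w u : V) : an u (fun z => formC G z w).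
Proof.
by apply: an_ext (an_linear u (extC G *m w^T)); apply: locallyT => z; rewrite /formC /bform mulmxA.
Qed.

Lemma an_rowD (f g : V -> V) u i : an u (fun z => f z 0 i) -> an u (fun z => g z 0 i) ->
  an u (fun z => (f z + g z) 0 i).
Proof. by move=> fa ga; apply: an_ext (anD fa ga); apply: locallyT => z; rewrite [RHS]mxE. Qed.

Lemma an_rowZ (f : V -> C) (g : V -> V) u i : an u f -> an u (fun z => g z 0 i) ->
  an u (fun z => (f z *: g z) 0 i).
Proof. by move=> fa ga; apply: an_ext (anM fa ga); apply: locallyT => z; rewrite [RHS]mxE. Qed.

Lemma an_rowN (f : V -> V) u i : an u (fun z => f z 0 i) -> an u (fun z => (- f z) 0 i).
Proof. by move=> fa; apply: an_ext (anN fa); apply: locallyT => z; rewrite [RHS]mxE. Qed.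

Lemma an_formC_comp (f g : V -> V) u : (forall i, an u (fun z => f z 0 i)) ->
  (forall i, an u (fun z => g z 0 i)) -> an u (fun z => formC G (f z) (g z)).
Proof.
move=> fa ga; apply: (@an_ext _ _ _ (fun z => \sum_(j <- index_enum 'I_n)
   (\sum_(i <- index_enum 'I_n) f z 0 i * extC G i j) * g z 0 j)).
  apply: locallyT => z; rewrite /formC /bform [RHS]mxE; apply: eq_bigr => j _.
  by rewrite [_ 0 j in RHS]mxE [_^T _ _]mxE.
apply: an_sum => j _; apply: anM => //; apply: an_sum => i _; apply: anM => //.
exact: an_cst.
Qed.

Lemma an_tau u i : an u (fun z => tau z 0 i).
Proof.
apply: an_rowD; first (apply: an_rowD; first exact: an_coord).
  apply: an_rowN; apply: an_rowZ; last exact: an_cst.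
  by apply: anM; [exact: an_formC|exact: an_cst].
apply: an_rowN; apply: an_rowZ; last exact: an_cst.
by apply: anM; [exact: an_formC|exact: an_cst].
Qed.

Lemma an_kap u i : an u (fun z => kap z 0 i).
Proof.
apply: an_rowD; first (apply: an_rowD; [exact: an_cst|exact: an_tau]).
apply: an_rowN; apply: an_rowZ; last exact: an_cst.
apply: anM; last exact: an_cst.
by apply: an_formC_comp => j; exact: an_tau.
Qed.

Lemma locally_kap P : locally v P -> locally v (fun u => P (kap u)).
Proof. by move=> Pv; apply: locally_comp; [exact: an_kap|rewrite kap_v]. Qed.

Lemma locally_kapD : locally v (fun u => coneD (kap u)).
Proof.
by apply: locallyS (locally_kap (locally_pos s_gt0)) => u; split=> //; exact: kap_isotropic.
Qed.

Definition normz y : V := (s / formC G y vb) *: y.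

Lemma an_normz y i : formC G y vb != 0 -> an y (fun z => normz z 0 i).
Proof.
move=> y0; apply: an_rowZ; last exact: an_coord.
by apply: anM; [exact: an_cst|apply: anV => //; exact: an_formC].
Qed.

Lemma normzP y : coneD y -> formC G y vb != 0 ->
  [/\ coneD (normz y), formC G (normz y) vb = s & orb (normz y) = orb y].
Proof.
move=> yD y0; have c0 : s / formC G y vb != 0 by rewrite mulf_neq0// invr_eq0.
split; [exact: coneDZ| |exact: orbZ].
by rewrite formCZl divfK.
Qed.

Lemma normz_id y : formC G y vb = s -> normz y = y.
Proof. by move=> ys; rewrite /normz ys divff// scale1r. Qed.

Definition slice_nbhd (e : C) := [set x | exists y,
   [/\ coneD y, formC G y vb != 0 /\ near_pt e v (normz y) & x = orb y]].

Lemma open_slice_nbhd e : 0 < e -> is_open X (slice_nbhd e).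
Proof.
move=> e0; apply: open_orbits => y yD [y0 vy].
have l0 : locally y (fun z => formC G z vb != 0) := an_neq0 (an_formC vb y) y0.
have := locally_comp (fun i => an_normz i y0) (locally_near_pt vy e0).
by move=> l1; apply: locallyS (locallyI l0 l1) => z.
Qed.

Lemma slice_nbhdP e x : slice_nbhd e x <->
  exists y, [/\ coneD y, formC G y vb = s, near_pt e v y & x = orb y].
Proof.
split=> [[y [yD [y0 vy] ->]]|[y [yD ys vy ->]]].
  by have [H1 H2 H3] := normzP yD y0; exists (normz y).
by exists y; split=> //; rewrite normz_id// ys.
Qed.

(** [kap] fixes the slice pointwise, and the orbits of slice points near [v] fill a neighbourhood of
    [orb v]; inclusions of germs on the quotient thus become inclusions near [v] in affine space. *)
Lemma germ_leP A B : germ_le X (orb v) A B <-> locally v (fun u => A (orb (kap u)) -> B (orb (kap u))).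
Proof.
split=> [[U [oU Uv AB]]|[e e0 H]].
  have := locallyI (locally_kap (open_X_locally oU vD Uv)) locally_kapD.
  by apply: locallyS => u [H uD] Au; apply: AB; split=> //; exact: H.
exists (slice_nbhd e); split; first exact: open_slice_nbhd.
  by apply/slice_nbhdP; exists v; split=> //; exact: near_pt_refl.
move=> x [Ax /slice_nbhdP[y [yD ys vy xy]]].
have := H y vy; rewrite kap_id// -?xy; last by case: yD.
exact.
Qed.

(** The local extensions are meaningful only on the cone. Composition with [kap] retains just these
    values and makes the equations constant on the fibres of [kap]. *)
Lemma analytic_germ_local A : analytic_germ X (orb v) A -> exists k (F : 'I_k -> V -> C),
  [/\ forall i, an v (F i), forall i u, F i (kap u) = F i u &
      locally v (fun u => A (orb (kap u)) <-> forall i, F i u = 0)].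
Proof.
move=> [U [k [f [oU Uv fU AU]]]].
have [F HF] := choice (fun i => let: ex_intro2 F a b := hol_X_an (fU i) oU vD Uv in ex_intro _ F (conj a b)).
exists k, (fun i u => F i (kap u)); split=> [i|i u|].
- apply: an_compose => //; first exact: an_kap.
  by rewrite kap_v; case: (HF i).
- by rewrite kapK.
have := locallyI (locally_kap (locallyI (open_X_locally oU vD Uv) (locally_fin (fun i => proj2 (HF i))))) locally_kapD.
apply: locallyS => u [[Uu Fu] uD].
have E : A (orb (kap u)) <-> (A `&` U) (orb (kap u)).
  by split=> [Au|[]//]; split=> //; exact: Uu.
rewrite E AU; split=> [[_ H] i|H]; first by have [_ <-] := Fu i uD.
by split=> [|i]; [exact: Uu|have [_ ->] := Fu i uD].
Qed.


(** On the stabiliser this is the character by which [g] scales [v], recovered by pairing with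
    [vb]. *)
Definition chi (g : 'M[int]_n) := formC G (v *m extC g) vb / s.

Definition act g u : V := (chi g)^-1 *: (u *m extC g).

Lemma stab_Aut g : g \in S -> Aut G g.
Proof. by case/SP. Qed.

Lemma stab_chi g : g \in S -> v *m extC g = chi g *: v.
Proof. by case/SP => _ [c cE]; rewrite /chi cE formCZl mulfK. Qed.

Lemma chi_neq0 g : g \in S -> chi g != 0.
Proof.
move=> gS; have := coneD_neq0 (coneD_Aut (stab_Aut gS) vD); apply: contra_neq => c0.
by rewrite stab_chi// c0 scale0r.
Qed.

Lemma stab1 : 1%:M \in S.
Proof.
apply/SP; split; first exact: lattice_isom_id.
by exists 1; rewrite map_mx1 mulmx1 scale1r.
Qed.

Lemma stabM g h : g \in S -> h \in S -> g *m h \in S.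
Proof.
move=> gS hS; apply/SP; split; first exact: lattice_isom_mul (stab_Aut gS) (stab_Aut hS).
exists (chi g * chi h); rewrite map_mxM mulmxA stab_chi// -scalemxAl stab_chi//.
by rewrite scalerA.
Qed.

Lemma chiM g h : g \in S -> h \in S -> chi (g *m h) = chi g * chi h.
Proof.
by move=> gS hS; rewrite {1}/chi map_mxM mulmxA stab_chi// -scalemxAl formCZl -mulrA.
Qed.

Lemma stabV g : g \in S -> invmx g \in S.
Proof.
move=> gS; have ga := stab_Aut gS; apply/SP; split; first exact: lattice_isom_inv.
exists (chi g)^-1; have c0 := chi_neq0 gS.
have : v *m extC g *m extC (invmx g) = v.
  by rewrite -mulmxA -map_mxM mulmxV ?map_mx1 ?mulmx1//; case: ga.
rewrite stab_chi// -scalemxAl => /(congr1 (fun z => (chi g)^-1 *: z)).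
by rewrite scalerA mulVf// scale1r.
Qed.

Lemma actM g h u : g \in S -> h \in S -> act h (act g u) = act (g *m h) u.
Proof.
move=> gS hS; rewrite /act chiM// map_mxM mulmxA -scalemxAl scalerA.
by rewrite mulrC -invfM.
Qed.

Lemma act1 u : act 1%:M u = u.
Proof. by rewrite /act /chi map_mx1 !mulmx1 divff// invr1 scale1r. Qed.

Lemma act_v g : g \in S -> act g v = v.
Proof. by move=> gS; rewrite /act stab_chi// scalerA mulVf ?chi_neq0// scale1r. Qed.

(** Invariance of the hermitian form forces [chi g] to have absolute value 1, so the action
    normalised to fix [v] also preserves the linear form that cuts out the slice. *)
Lemma act_slice g u : g \in S -> formC G (act g u) vb = formC G u vb.
Proof.
move=> gS; have cc : chi g * Num.conj (chi g) = 1.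
  have := formC_Aut v vb (stab_Aut gS).
  rewrite -conjV_mul stab_chi// conjVZ formCZl formCZr mulrA.
  by rewrite -{2}(mul1r s) => /(mulIf s_neq0).
have vbg : vb = chi g *: (vb *m extC g).
  by rewrite -conjV_mul stab_chi// conjVZ scalerA cc scale1r.
rewrite {1}vbg /act formCZl formCZr mulrA mulVf ?chi_neq0// mul1r.
exact: formC_Aut (stab_Aut gS).
Qed.

Lemma act_orb g u : g \in S -> orb (act g u) = orb u.
Proof.
by move=> gS; rewrite orbZ ?invr_eq0 ?chi_neq0// (orb_Aut _ (stab_Aut gS)).
Qed.

Lemma an_act g u i : an u (fun z => act g z 0 i).
Proof.
by apply: an_ext (anZ (chi g)^-1 (an_mulmx (extC g) u i)); apply: locallyT => z; rewrite [RHS]mxE.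
Qed.

Lemma locally_act P : locally v P -> locally v (fun u => forall g, g \in S -> P (act g u)).
Proof.
move=> Pv; apply: locally_seq => g gS; apply: locally_comp => [i|]; first exact: an_act.
by rewrite act_v.
Qed.

(** Local finiteness places in [S] the element that carries [y] to [z] up to a scalar; the slice
    condition then forces this scalar to be the one built into [act]. *)
Lemma orb_slice : exists2 e : C, 0 < e & forall y z, coneD y -> coneD z ->
  formC G y vb = s -> formC G z vb = s -> near_pt e v y -> near_pt e v z -> orb y = orb z ->
  exists2 g, g \in S & z = act g y.
Proof.
have [e e0 He] := S_slice; exists e => // y z yD zD ys zs vy vz yz.
have [g [c [ga c0 yg]]] := orb_eqP (coneD_neq0 zD) yz.
have zE : z = c^-1 *: (y *m extC g) by rewrite yg scalerA mulVf// scale1r.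
have gS : g \in S := He y z g c^-1 vy vz yD zD ga zE.
exists g => //; have k0 := chi_neq0 gS.
have : formC G (act g y) vb = s by rewrite act_slice.
rewrite /act yg scalerA formCZl zs -[in RHS](mul1r s) => /(mulIf s_neq0) ->.
by rewrite scale1r.
Qed.

Lemma stab_prod (T : comNzRingType) (f : 'M[int]_n -> T) g : g \in S ->
  \prod_(h <- S) f (g *m h) = \prod_(h <- S) f h.
Proof.
move=> gS; have gu : g \in unitmx by case: (stab_Aut gS).
rewrite -(big_map (fun h => g *m h) predT f); apply: perm_big; apply: uniq_perm => //.
  by rewrite map_inj_uniq// => a b /(congr1 (mulmx (invmx g))); rewrite !mulKmx.
move=> h; apply/mapP/idP => [[k kS ->]|hS]; first exact: stabM.
by exists (invmx g *m h); [apply: stabM => //; exact: stabV|rewrite mulKVmx].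
Qed.

(** With [N = size r], the polynomial [p] has degree at most [N] and at least [N + 2] distinct
    zeros, so it is 0; each [f j] is then a root of the [N]-th power of the variable. *)
Lemma prod_subr_eq0 (T : fieldType) (I : eqType) (r : seq I) (f : I -> T) (t : nat -> T) : injective t ->
  (forall i : 'I_(size r).+2, \prod_(j <- r) (t i - f j) - t i ^+ size r = 0) ->
  forall j, j \in r -> f j = 0.
Proof.
move=> tinj H j jr.
pose p : {poly T} := \prod_(j <- r) ('X - (f j)%:P) - 'X^(size r).
have p0 : p = 0.
  apply: (@roots_geq_poly_eq0 _ p [seq t i | i <- iota 0 (size r).+2]).
  - apply/allP => x; case/mapP => i; rewrite mem_iota => /andP[_ ir] ->; apply/rootP.
    have := H (Ordinal ir); rewrite /p hornerD hornerN hornerXn horner_prod => <- /=.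
    by congr (_ - _); apply: eq_bigr => k _; rewrite hornerXsubC.
  - by rewrite map_inj_uniq// iota_uniq.
  - rewrite size_map size_iota; apply: leq_trans (size_polyD _ _) _.
    rewrite size_polyN size_polyXn size_prod_XsubC geq_max !leqnSn ?leqnn//.
have := congr1 (fun q : {poly T} => q.[f j]) p0.
rewrite /p horner0 hornerD hornerN hornerXn horner_prod (big_rem j jr)/= hornerXsubC subrr mul0r sub0r.
by move/eqP; rewrite oppr_eq0 expf_eq0 => /andP[_ /eqP].
Qed.

(* The functions prod_g (t - Phi (g u)) - t^N are invariant, and for enough
   values of t they vanish simultaneously only where all Phi (g u) do. *)
Lemma descend (Phi : V -> C) : an v Phi -> exists2 A, analytic_germ X (orb v) A &
  locally v (fun u => A (orb (kap u)) <-> forall g, g \in S -> Phi (act g (kap u)) = 0).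
Proof.
move=> Pa; have [e1 e10 He1] := orb_slice.
have l1 : locally v (near_pt e1 v) by exists e1.
have [e e0 He] := locallyI l1 (locally_act (an_open Cmono Pa)).
pose N := size S.
pose good x y := [/\ coneD y, formC G y vb = s, near_pt e v y & x = orb y].
pose rep x : V := get (good x).
have repP x : slice_nbhd e x -> good x (rep x).
  by move/slice_nbhdP => [y yx]; apply: (@getI _ (good x) y).
have uniqP x y z : good x y -> good x z -> exists2 g, g \in S & z = act g y.
  move=> [yD ys vy xy] [zD zs vz xz]; apply: He1 => //; [by case: (He y vy)|by case: (He z vz)|].
  by rewrite -xy.
pose F (t : C) y := \prod_(g <- S) (t - Phi (act g y)) - t ^+ N.
have FS t g y : g \in S -> F t (act g y) = F t y.
  move=> gS; rewrite /F -(stab_prod (fun h => t - Phi (act h y)) gS); congr (_ - _).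
  by rewrite big_seq [RHS]big_seq; apply: eq_bigr => h hS; rewrite actM.
(* [f] is computed on an arbitrary slice representative; by the invariance [FS] its value does not
   depend on the choice. *)
pose f t x := F t (rep x).
have fE t x y : good x y -> f t x = F t y.
  move=> xy; have sx : slice_nbhd e x by apply/slice_nbhdP; exists y.
  by have [g gS ->] := uniqP _ _ _ (repP x sx) xy; rewrite FS.
exists [set x | slice_nbhd e x /\ forall g, g \in S -> Phi (act g (rep x)) = 0].
  exists (slice_nbhd e), N.+2, (fun i => f i%:R); split.
  - exact: open_slice_nbhd.
  - by apply/slice_nbhdP; exists v; split=> //; exact: near_pt_refl.
  - move=> i; apply: hol_X => x xU; have xr := repP x xU; have [rD rs vr xo] := xr.
    have aE y : (y *m (extC G *m vb^T)) 0 0 = formC G y vb by rewrite /formC /bform mulmxA.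
    exists (rep x), (F i%:R), (extC G *m vb^T); split=> //.
    + by rewrite aE rs.
    + apply: anB; last exact: an_cst.
      apply: an_prod => g gS; apply: anB; first exact: an_cst.
      apply: an_compose => //; first by move=> j; exact: an_act.
      by case: (He _ vr) => _; exact.
    + apply: locallyS (locally_near_pt vr e0) => y vy yD; rewrite !aE rs => ys _.
      by apply: fE.
  - apply/seteqP; split=> x.
    + move=> [[xU H] _]; split=> // i.
      rewrite /f /F; under eq_big_seq => g gS do rewrite H// subr0.
      by rewrite big_const_seq count_predT iter_mulr_1 subrr.
    + move=> [xU H]; split=> //; split=> // g gS.
      apply: (prod_subr_eq0 (t := fun i => i%:R) (f := fun g => Phi (act g (rep x)))) gS => [i j /eqP|i].
        by rewrite eqr_nat => /eqP.
      exact: H.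
have le : locally v (near_pt e v) by exists e.
apply: locallyS (locallyI (locally_kap le) locally_kapD) => u [vu uD].
have gu : good (orb (kap u)) (kap u) by split=> //; exact: kap_vb.
have xU : slice_nbhd e (orb (kap u)) by apply/slice_nbhdP; exists (kap u).
have [g gS E] := uniqP _ _ _ (repP _ xU) gu.
split=> [[_ H] h hS|H]; first by rewrite E actM// H// stabM.
split=> // h hS; have := H (invmx g *m h) (stabM (stabV gS) hS).
move: E; set r := rep _ => E; rewrite E actM ?(stabM (stabV gS) hS)// mulKVmx//.
by case: (stab_Aut gS).
Qed.


Definition root (l : 'rV[int]_n) := bform G l l = -1.

Definition lam (l : 'rV[int]_n) u := formC G u (extC l).

Local Notation Z := (divH_mod_Gamma C G).

Lemma lam_Aut l g u : Aut G g -> lam l (u *m extC g) = lam (l *m invmx g) u.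
Proof.
move=> ga; rewrite /lam -(formC_Aut u (extC (l *m invmx g)) ga); congr (formC _ _ _).
by rewrite map_mxM -mulmxA -map_mxM mulVmx ?map_mx1 ?mulmx1//; case: ga.
Qed.

Lemma root_Aut l g : Aut G g -> root l -> root (l *m invmx g).
Proof. by move=> /lattice_isom_inv[_ H] rl; rewrite /root H. Qed.

Lemma divHP y : coneD y -> Z (orb y) <-> exists2 l, root l & lam l y = 0.
Proof.
move=> yD; have y0 := coneD_neq0 yD; split.
- move=> [L [l rl [LD [u [LE ul]]]] Ly].
  have u0 : u != 0.
    apply/eqP => u0; case: LD => w [wE wD wp].
    have := memv_line w; rewrite -wE LE u0 => /vlineP[k wk].
    by have := coneD_neq0 (conj wD wp : coneD w); rewrite wk scaler0 eqxx.
  have [|g [c [ga c0 yg]]] := @orb_eqP y u u0; first by rewrite -Ly LE.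
  exists (l *m invmx g); first exact: root_Aut.
  by rewrite -lam_Aut// yg /lam formCZl ul mulr0.
- move=> [l rl ly]; exists <[y]>%VS => //; exists l => //.
  by split; [apply/domDP|exists y].
Qed.

Variable L : seq 'rV[int]_n.
Hypothesis LP : forall l, l \in L <-> root l /\ lam l v = 0.
Hypothesis L_local : locally v (fun y => coneD y -> forall l, root l -> lam l y = 0 -> l \in L).

Lemma lam_vb l : lam l v = 0 -> lam l vb = 0.
Proof. by move=> lv; rewrite /lam -(conjV_int l) formC_conj -/(lam l v) lv rmorph0. Qed.

(** The vector [l] is real, so it is orthogonal to [vb] as well as to [v], and [kap u] differs from
    [u] by a combination of these two. *)
Lemma lam_kap l u : lam l v = 0 -> lam l (kap u) = lam l u.
Proof.
move=> lv; have lvb := lam_vb lv; rewrite /lam in lv lvb *.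
by rewrite /kap /tau !formCE lv lvb !mulr0 !subr0 add0r.
Qed.

Lemma an_lam l u : an u (lam l).
Proof. exact: an_formC. Qed.

Lemma lam_act l g u : g \in S -> lam l (act g u) = (chi g)^-1 * lam (l *m invmx g) u.
Proof. by move=> gS; rewrite /act /lam formCZl -/(lam _ _) lam_Aut//; exact: stab_Aut. Qed.

Lemma L_stab l g : l \in L -> g \in S -> l *m invmx g \in L.
Proof.
move=> /LP[rl lv] gS; apply/LP; split; first exact: root_Aut (stab_Aut gS) rl.
have := lam_act l v gS; rewrite act_v// lv => /esym/eqP.
by rewrite mulf_eq0 invr_eq0 (negPf (chi_neq0 gS)) => /eqP.
Qed.

Definition covers (ls : seq 'rV[int]_n) u := exists2 l, l \in ls & exists2 g, g \in S & lam l (act g u) = 0.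

(** The product over the stabiliser has an invariant zero set, so the condition of [descend] for all
    [g] reduces to the condition for the identity. *)
Lemma germ_of_roots ls : exists2 A, analytic_germ X (orb v) A &
  locally v (fun u => A (orb (kap u)) <-> covers ls (kap u)).
Proof.
have [|A Aa HA] := @descend (fun u => \prod_(l <- ls) \prod_(g <- S) lam l (act g u)).
  apply: an_prod => l _; apply: an_prod => g _; apply: an_compose => //; last exact: an_lam.
  by move=> i; exact: an_act.
exists A => //; apply: locallyS HA => u ->; split=> [H|[l lls [g gS lg]] h hS].
  have := H _ stab1; rewrite act1 => /eqP.
  rewrite prodf_seq_eq0 => /hasP[l lls /= ]; rewrite prodf_seq_eq0 => /hasP[g gS /eqP lg].
  by exists l => //; exists g.
apply/eqP; rewrite prodf_seq_eq0; apply/hasP; exists l => //=.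
rewrite prodf_seq_eq0; apply/hasP; exists (invmx h *m g); first exact: stabM (stabV hS) gS.
by rewrite /= actM ?stabM ?stabV// mulKVmx ?lg//; case: (stab_Aut hS).
Qed.

Lemma Z_local : locally v (fun u => Z (orb (kap u)) <-> covers L (kap u)).
Proof.
apply: locallyS (locallyI (locally_kap L_local) locally_kapD) => u [Lu uD].
rewrite divHP//; split=> [[l rl lu]|[l /LP[rl _] [g gS lg]]].
  by exists l; [exact: Lu|exists 1%:M; rewrite ?act1//; exact: stab1].
exists (l *m invmx g); first exact: root_Aut (stab_Aut gS) rl.
by move: lg; rewrite lam_act// => /eqP; rewrite mulf_eq0 invr_eq0 (negPf (chi_neq0 gS)) => /eqP.
Qed.

Lemma germ_eqP A B : germ_eq X (orb v) A B <-> locally v (fun u => A (orb (kap u)) <-> B (orb (kap u))).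
Proof.
split=> [[/germ_leP ab /germ_leP ba]|H].
  by apply: locallyS (locallyI ab ba) => u [].
by split; apply/germ_leP; apply: locallyS H => u [].
Qed.

Lemma analytic_germ_Z : analytic_germ X (orb v) Z.
Proof.
have [A Aa HA] := germ_of_roots L; apply: analytic_germ_eq Aa _; apply/germ_eqP.
by apply: locallyS (locallyI HA Z_local) => u [-> ->].
Qed.

(** * Irreducible germs and their codimension *)

Lemma locally_analytic_germ A : analytic_germ X (orb v) A -> locally_analytic v (fun u => A (orb (kap u))).
Proof. by move=> /analytic_germ_local[k [F [Fa _ H]]]; exists k, F. Qed.

Lemma irreducible_points : irreducible_germ X (orb v) (points X).
Proof.
split; first by apply/points_XP; exists v.
  exists (points X), 0%N, (fun _ _ => 0); split=> //.
  - exact: open_points.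
  - by apply/points_XP; exists v.
  - by case.
  - by apply/seteqP; split=> x /= [] // ? _; split=> // -[].
move=> A1 A2 /locally_analytic_germ a1 /locally_analytic_germ a2 /germ_eqP E.
have ptu : locally v (fun u => points X (orb (kap u))).
  by apply: locallyS locally_kapD => u uD; apply/points_XP; exists (kap u).
have [||H|H] := @local_cover _ _ v (fun=> True) _ _ Cmono Ccomp _ a1 a2.
- by [].
- by apply: locallyS (locallyI E ptu) => u [Eu pu] _; apply/Eu.
- by left; apply/germ_eqP; apply: locallyS (locallyI H ptu) => u [Hu pu]; split=> // _; exact: Hu.
- by right; apply/germ_eqP; apply: locallyS (locallyI H ptu) => u [Hu pu]; split=> // _; exact: Hu.
Qed.

(** The hyperplane germ is irreducible by [local_cover]. A set of orbits that contains the image of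
    the hyperplane contains the images of its translates by the stabiliser, so one hyperplane
    decides about all of [A]. *)
Lemma irreducible_root l A : l \in L -> analytic_germ X (orb v) A ->
  locally v (fun u => A (orb (kap u)) <-> covers [:: l] (kap u)) -> irreducible_germ X (orb v) A.
Proof.
move=> /LP[rl lv] Aa HA; split=> //.
  have := locally_pt HA; rewrite kap_v => ->; exists l; rewrite ?mem_head//.
  by exists 1%:M; [exact: stab1|rewrite act1].
have half B : germ_le X (orb v) B A -> locally v (fun u => lam l u = 0 -> B (orb (kap u))) ->
    germ_eq X (orb v) A B.
  move=> BA H; split=> //; apply/germ_leP.
  have lk := locally_kap (locally_act H).
  apply: locallyS (locallyI HA lk) => u [-> Hu] [_ /[!inE]/eqP-> [g gS lg]].
  have := Hu g gS lg; rewrite kap_id ?act_orb//.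
    by rewrite /act formCZl formCZr (formC_Aut _ _ (stab_Aut gS)) kap_isotropic !mulr0.
  by rewrite act_slice// kap_vb.
move=> A1 A2 a1 a2 E.
have E1 : germ_le X (orb v) A1 A.
  by apply/germ_leP; case: E => _ /germ_leP; apply: locallyS => u H ?; apply: H; left.
have E2 : germ_le X (orb v) A2 A.
  by apply/germ_leP; case: E => _ /germ_leP; apply: locallyS => u H ?; apply: H; right.
have [||H|H] := @local_cover _ _ v (fun u => lam l u = 0) _ _ Cmono Ccomp _
   (locally_analytic_germ a1) (locally_analytic_germ a2).
- move=> u w t lu lw; rewrite /lam formCDl formCZl formCDl formCNl -!/(lam _ _) lu lw.
  by rewrite subrr mulr0 addr0.
- move/germ_eqP : E => E; apply: locallyS (locallyI E HA) => u [Eu Hu] lu.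
  apply/Eu/Hu; exists l; rewrite ?mem_head//; exists 1%:M; first exact: stab1.
  by rewrite act1 lam_kap.
- by left; exact: half.
- by right; exact: half.
Qed.

Lemma germ_le_trans A B D : germ_le X (orb v) A B -> germ_le X (orb v) B D -> germ_le X (orb v) A D.
Proof.
move=> /germ_leP ab /germ_leP bd; apply/germ_leP.
by apply: locallyS (locallyI ab bd) => u [H1 H2] /H1 /H2.
Qed.

Lemma irreducible_le_union A B D : irreducible_germ X (orb v) A ->
  analytic_germ X (orb v) B -> analytic_germ X (orb v) D -> germ_le X (orb v) A (B `|` D) ->
  germ_le X (orb v) A B \/ germ_le X (orb v) A D.
Proof.
move=> [Av Aa Airr] Ba Da /germ_leP AD.
have [|||[H _]|[H _]] := Airr (A `&` B) (A `&` D).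
- exact: analytic_germI.
- exact: analytic_germI.
- apply/germ_eqP; apply: locallyS AD => u H; split=> [Au|[[]|[]]//].
  by case: (H Au) => ?; [left|right].
- by left; apply: germ_le_trans H _; apply/germ_leP; apply: locallyT => u [].
- by right; apply: germ_le_trans H _; apply/germ_leP; apply: locallyT => u [].
Qed.

Lemma irreducible_le_root ls A : irreducible_germ X (orb v) A ->
  locally v (fun u => A (orb (kap u)) -> covers ls (kap u)) ->
  exists2 l, l \in ls & locally v (fun u => A (orb (kap u)) -> covers [:: l] (kap u)).
Proof.
move=> Airr; elim: ls => [|l ls IH] H.
  by exfalso; have := locally_pt H; rewrite kap_v; case: Airr => Av _ _ /(_ Av)[].
have [B Ba HB] := germ_of_roots [:: l]; have [D Da HD] := germ_of_roots ls.
have [||K] := irreducible_le_union Airr Ba Da.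
- apply/germ_leP; apply: locallyS (locallyI H (locallyI HB HD)) => u [Hu [Bu Du]] /Hu.
  move=> [l']; rewrite inE => /predU1P[->|l'ls] lg; [left; apply/Bu|right; apply/Du].
    by exists l; rewrite ?mem_head.
  by exists l'.
- move=> /germ_leP K; exists l; rewrite ?mem_head//.
  by apply: locallyS (locallyI K HB) => u [Ku [Bu _]] /Ku.
have [|l' l'ls H'] := IH.
  by move/germ_leP : K => K; apply: locallyS (locallyI K HD) => u [Ku [Du _]] /Ku.
by exists l' => //; rewrite inE l'ls orbT.
Qed.

(** Moving [v] by a small multiple of [l] changes [lam l] by that multiple of the norm -1; [N] keeps
    the displacement inside the polydisc. *)
Lemma lam_not_locally0 l : root l -> lam l v = 0 -> ~ locally v (fun u => lam l u = 0).
Proof.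
move=> rl lv [e e0 H].
have [N lN] : exists N : C, 0 < N /\ forall i, `|extC l 0 i| < N.
  exists (1 + \sum_i `|extC l 0 i|); split; first by apply: ltr_wpDr => //; exact: sumr_ge0.
  move=> i; rewrite (bigD1 i)//= addrCA ltrDl; apply: ltr_wpDr => //; exact: sumr_ge0.
case: lN => N0 lN; have := H (v + (e / N) *: extC l).
rewrite /lam formCDl formCZl -/(lam l v) lv add0r /formC bform_map rl => K.
have /eqP : e / N * (-1)%:~R = 0 :> C.
  apply: K => i; rewrite !mxE addrAC subrr add0r normrM gtr0_norm ?divr_gt0//.
  by have := lN i; rewrite mxE => ?; rewrite mulrAC ltr_pdivrMr// ltr_pM2l.
by rewrite rmorphN rmorph1 mulrN1 oppr_eq0 mulf_eq0 invr_eq0 !gt_eqF.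
Qed.

Lemma an_prod_locally0 (I : eqType) (r : seq I) (f : I -> V -> C) : (forall i, i \in r -> an v (f i)) ->
  locally v (fun u => \prod_(i <- r) f i u = 0) -> exists2 i, i \in r & locally v (fun u => f i u = 0).
Proof.
elim: r => [|i r IH] fa H.
  by have := locally_pt H; rewrite big_nil => /eqP; rewrite oner_eq0.
have [|||K|K] := @an_integral _ _ v (f i) (fun u => \prod_(j <- r) f j u) Cmono Ccomp.
- by apply: fa; exact: mem_head.
- by apply: an_prod => j jr; apply: fa; rewrite inE jr orbT.
- by apply: locallyS H => u; rewrite big_cons.
- by exists i; rewrite ?mem_head.
have [j jr|j jr Hj] := IH _ K; first by apply: fa; rewrite inE jr orbT.
by exists j => //; rewrite inE jr orbT.
Qed.

Lemma covers_not_everything l : l \in L -> ~ locally v (fun u => covers [:: l] (kap u)).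
Proof.
move=> lL H.
have [g _||g gS K] := @an_prod_locally0 _ S (fun g u => lam l (act g (kap u))).
- apply: (an_compose Cmono (g := fun z => lam l (act g z)) (M := kap)) => [i|]; first exact: an_kap.
  by apply: (an_compose Cmono (g := lam l) (M := act g)) => [i|]; [exact: an_act|exact: an_lam].
- apply: locallyS H => u [l' /[!inE]/eqP-> [g gS lg]].
  by apply/eqP; rewrite prodf_seq_eq0; apply/hasP; exists g => //=; apply/eqP.
have /LP[rl' lv'] := L_stab lL gS.
apply: (lam_not_locally0 rl' lv'); apply: locallyS K => u.
by rewrite lam_act// lam_kap// => /eqP; rewrite mulf_eq0 invr_eq0 (negPf (chi_neq0 gS)) => /eqP.
Qed.

Lemma lam_col l u : lam l u = (u *m (extC G *m (extC l)^T)) 0 0.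
Proof. by rewrite /lam /formC /bform mulmxA. Qed.

(** An equation [F i] of [B] that is not locally zero is [lam l ^+ m * h] with [h] not vanishing on
    the hyperplane. Outside the translates of the hyperplane [B] lies in the descended zero set [D]
    of [h], so irreducibility puts [B] into [A] or into [D]: the former contradicts strictness, the
    latter makes [h] vanish on the hyperplane. *)
Lemma root_maximal l A B : l \in L -> locally v (fun u => A (orb (kap u)) <-> covers [:: l] (kap u)) ->
  germ_lt X (orb v) A B -> irreducible_germ X (orb v) B -> locally v (fun u => B (orb (kap u))).
Proof.
move=> lL HA [/germ_leP AB nBA] Birr; have /LP[rl lv] := lL.
have [k [F [Fa Fk HB]]] : exists k (F : 'I_k -> V -> C),
  [/\ forall i, an v (F i), forall i u, F i (kap u) = F i u &
      locally v (fun u => B (orb (kap u)) <-> forall i, F i u = 0)].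
  by apply: analytic_germ_local; case: Birr.
have [allF|/existsNP[i nFi]] := pselect (forall i, locally v (fun u => F i u = 0)).
  by apply: locallyS (locallyI HB (locally_fin allF)) => u [Bu Fu]; apply/Bu.
exfalso; pose a : 'cV[C]_n := extC G *m (extC l)^T.
have a0 : a != 0.
  apply/eqP => a0; apply: (lam_not_locally0 rl lv); apply: locallyT => u.
  by rewrite lam_col -/a a0 mulmx0 mxE.
have [//|[m [h [ha Fh nh]]]] := an_factor_linear Cmono Ccomp (Fa i) a0 (etrans (esym (lam_col l v)) lv).
have {}Fh : locally v (fun u => F i u = lam l u ^+ m * h u).
  by apply: locallyS Fh => u ->; rewrite lam_col.
(* Both [F i] and [lam l] are invariant under [kap]; cancelling [lam l ^+ m] gives the same for
   [h]. *)
have hk : locally v (fun u => h (kap u) = h u).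
  have hka : an v (fun u => h (kap u)).
    by apply: an_compose => // [j|]; [exact: an_kap|rewrite kap_v].
  have [||||K] := @an_integral _ _ v (fun u => lam l u ^+ m) (fun u => h (kap u) - h u) Cmono Ccomp.
  - by apply: anX; exact: an_lam.
  - by apply: anB.
  - apply: locallyS (locallyI Fh (locally_kap Fh)) => u [E1 E2].
    by rewrite mulrBr -{1}(lam_kap u lv) -E1 -E2 Fk subrr.
  - move=> K; exfalso; apply: (lam_not_locally0 rl lv).
    by apply: locallyS K => u /eqP; rewrite expf_eq0 => /andP[_ /eqP].
  by apply: locallyS K => u /eqP; rewrite subr_eq0 => /eqP.
have [D Da HD] := descend ha.
have [A' A'a HA'] := germ_of_roots [:: l].
have [|/germ_leP K|/germ_leP K] := irreducible_le_union Birr A'a Da.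
- apply/germ_leP.
  have BF : locally v (fun u => forall g, g \in S -> B (orb (kap (act g (kap u)))) ->
      F i (act g (kap u)) = 0 /\ F i (act g (kap u)) = lam l (act g (kap u)) ^+ m * h (act g (kap u))).
    have := locally_kap (locally_act (locallyI HB Fh)).
    apply: locallyS => u Hu g gS Bg; case: (Hu g gS) => [[Bu _] Fu].
    by split=> //; exact: Bu.
  apply: locallyS (locallyI BF (locallyI HA' HD)) => u [Hu [A'u Du]] Bu.
  have [cu|ncu] := pselect (covers [:: l] (kap u)); first by left; apply/A'u.
  right; apply/Du => g gS.
  have [|F0] := Hu g gS.
    rewrite kap_id ?act_orb//.
      by rewrite /act formCZl formCZr (formC_Aut _ _ (stab_Aut gS)) kap_isotropic !mulr0.
    by rewrite act_slice// kap_vb.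
  rewrite F0 => /esym/eqP; rewrite mulf_eq0 expf_eq0 => /orP[/andP[_ /eqP lg]|/eqP//].
  by exfalso; apply: ncu; exists l; rewrite ?mem_head//; exists g.
- apply: nBA; apply/germ_leP; apply: locallyS (locallyI K (locallyI HA HA')) => u [Ku [Au A'u]] Bu.
  by apply/Au/A'u/Ku.
- apply: nh; apply: locallyS (locallyI (locallyI AB K) (locallyI (locallyI HA HD) hk)).
  move=> u [[ABu Ku] [[Au Du] hu]]; rewrite -lam_col => lu.
  have := (Du.1 (Ku (ABu (Au.2 _)))) 1%:M stab1; rewrite act1 hu; apply.
  exists l; rewrite ?mem_head//; exists 1%:M; first exact: stab1.
  by rewrite act1 lam_kap.
Qed.

(** A component lies in the germ of a single root, hence equals it. The germ of the whole quotient
    gives a chain of length one, and a longer chain is excluded because the first germ above is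
    already full. *)
Lemma codim_component A : germ_component X (orb v) Z A -> germ_codim X (orb v) A 1.
Proof.
move=> [Airr /germ_leP AZ Amax].
have [|l lL Al] := irreducible_le_root Airr (ls := L).
  by apply: locallyS (locallyI AZ Z_local) => u [Hu [Zu _]] /Hu.
have [B Ba HB] := germ_of_roots [:: l].
have Birr := irreducible_root lL Ba HB.
have BZ : germ_le X (orb v) B Z.
  apply/germ_leP; apply: locallyS (locallyI HB Z_local) => u [Bu Zu] /Bu[l' /[!inE]/eqP-> H].
  by apply/Zu; exists l.
have AB : germ_le X (orb v) A B.
  by apply/germ_leP; apply: locallyS (locallyI Al HB) => u [Au Bu] Ax; apply/Bu/Au.
have /germ_eqP E := Amax B Birr BZ AB.
have HA : locally v (fun u => A (orb (kap u)) <-> covers [:: l] (kap u)).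
  by apply: locallyS (locallyI E HB) => u [-> ->].
have ptu : locally v (fun u => points X (orb (kap u))).
  by apply: locallyS locally_kapD => u uD; apply/points_XP; exists (kap u).
split.
- split=> //; exists (points X).
    split; first by apply/germ_leP; apply: locallyS ptu.
    move=> /germ_leP K; apply: (covers_not_everything lL).
    by apply: locallyS (locallyI K (locallyI HA ptu)) => u [Ku [Au pu]]; apply/Au/Ku.
  by split=> //; exact: irreducible_points.
- move=> [_ [B1 AB1 [B1irr [B2 [_ nB] _]]]].
  have full := root_maximal lL HA AB1 B1irr.
  by apply: nB; apply/germ_leP; apply: locallyS full.
Qed.

End LocalStructure.

Definition roots_locally_finite := forall v, coneD v -> exists L : seq 'rV[int]_n,
  locally v (fun y => coneD y -> forall l, root l -> lam l y = 0 -> l \in L).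

Lemma root_stabilizer v : roots_locally_finite -> coneD v -> exists L : seq 'rV[int]_n,
  (forall l, l \in L <-> root l /\ lam l v = 0) /\
  locally v (fun y => coneD y -> forall l, root l -> lam l y = 0 -> l \in L).
Proof.
move=> rlf vD; have [L0 HL0] := rlf v vD.
pose L := [seq l <- L0 | `[< root l /\ lam l v = 0 >]].
have LP l : l \in L <-> root l /\ lam l v = 0.
  rewrite mem_filter; split=> [/andP[/asboolP//]|[rl lv]].
  apply/andP; split; first exact/asboolP.
  by have := locally_pt HL0; apply.
exists L; split=> //.
have H l : l \in L0 -> locally v (fun y => coneD y -> root l -> lam l y = 0 -> l \in L).
  move=> _; have [/eqP lv|lv] := boolP (lam l v == 0).
    by apply: locallyT => y _ rl _; apply/LP.
  by apply: locallyS (an_neq0 (an_formC _ _) lv) => y /eqP.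
apply: locallyS (locallyI HL0 (locally_seq H)) => y [H1 H2] yD l rl ly.
by apply: (H2 l) => //; exact: H1.
Qed.

Local Notation Z := (divH_mod_Gamma C G).

Lemma divisor_analytic_codim1 : Aut_locally_finite -> roots_locally_finite ->
  analytic_subset X Z /\ pure_codim X Z 1.
Proof.
move=> Alf rlf; have Zpts x : Z x -> points X x.
  move=> [L [l _ [LD _]] <-]; exists L => //; split=> //.
  by case: LD => w [-> w0 wp]; apply/points_projective; exists w => //; apply: coneD_neq0.
split; first split=> // x /points_XP[v vD ->].
  have [S [S_uniq SP S_slice]] := slice Alf vD; have [L [LP L_local]] := root_stabilizer rlf vD.
  by apply: (analytic_germ_Z vD S_uniq SP S_slice LP L_local).
move=> x A Zx; have /points_XP[v vD ->] := Zpts x Zx.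
have [S [S_uniq SP S_slice]] := slice Alf vD; have [L [LP L_local]] := root_stabilizer rlf vD.
exact: (codim_component vD S_uniq SP S_slice LP L_local).
Qed.

Lemma analytic_subset_along Y (gam : C -> V) t : analytic_subset X Y ->
  (forall t i, an (const_mx t : 'rV[C]_1) (fun z : 'rV[C]_1 => gam (z 0 0) 0 i)) ->
  (forall t, unit_itv t -> coneD (gam t)) -> unit_itv t ->
  analytic_along gam (fun t => Y (orb (gam t))) t.
Proof.
move=> [_ Ya] ga gD t01; have tD := gD t t01.
have [|U [k [f [oU Ut fU YU]]]] := Ya (orb (gam t)); first by apply/points_XP; exists (gam t).
have Fex i : exists F, an (gam t) F /\ locally (gam t) (fun y => coneD y -> U (orb y) /\ f i (orb y) = F y).
  by have [F] := hol_X_an (fU i) oU tD Ut; exists F.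
have [F HF] := choice Fex; exists k, F; split; first by move=> i; case: (HF i).
pose Q y := (coneD y -> U (orb y)) /\ forall i, coneD y -> U (orb y) /\ f i (orb y) = F i y.
have l1 : locally (gam t) Q := locallyI (open_X_locally oU tD Ut) (locally_fin (fun i => proj2 (HF i))).
have [e e0 He] : locally (const_mx t : 'rV[C]_1) (fun z : 'rV[C]_1 => Q (gam (z 0 0))).
  by apply: (locally_comp (P := Q) (M := fun z : 'rV[C]_1 => gam (z 0 0)) (ga t)); rewrite mxE.
exists e => // s s01 st; have sD := gD s s01.
have [|Us Fs] := He (const_mx s); first by apply: near_pt1; rewrite !mxE.
rewrite mxE in Us Fs.
have -> : Y (orb (gam s)) <-> (Y `&` U) (orb (gam s)).
  by split=> [Ys|[]//]; split=> //; exact: Us.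
rewrite YU; split=> [[_ H] i|H]; first by have [_ <-] := Fs i sD.
by split=> [|i]; [exact: Us|have [_ ->] := Fs i sD].
Qed.

Lemma irreducible_of_convex (T : V -> Prop) (kappa : V -> V) :
  (forall u i, an u (fun z => kappa z 0 i)) -> (forall u, T u -> coneD (kappa u)) ->
  (forall u w t, T u -> T w -> unit_itv t -> T (u + t *: (w - u))) -> (exists u, T u) ->
  (forall x, Z x <-> exists2 u, T u & x = orb (kappa u)) -> irreducible_subset X Z.
Proof.
move=> ka kD Tconv [u0 Tu0] ZT; split; first by exists (orb (kappa u0)); apply/ZT; exists u0.
move=> Z1 Z2 a1 a2 ZE.
have part Y Y' : Z = Y `|` Y' -> (forall u, T u -> Y (orb (kappa u))) -> Z = Y.
  move=> E H; apply/seteqP; split=> x; first by move/ZT => [u Tu ->]; exact: H.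
  by move=> Yx; rewrite E; left.
have [H|/existsNP[p /not_implyP[Tp n1]]] := pselect (forall u, T u -> Z1 (orb (kappa u))).
  by left; exact: part ZE H.
right; apply: (part Z2 Z1); first by rewrite ZE setUC.
move=> q Tq; apply: contrapT => n2.
pose gam (t : C) := kappa (p + t *: (q - p)).
have gT t : unit_itv t -> T (p + t *: (q - p)) by exact: Tconv.
have gD t : unit_itv t -> coneD (gam t) by move/gT; exact: kD.
have ga t i : an (const_mx t : 'rV[C]_1) (fun z : 'rV[C]_1 => gam (z 0 0) 0 i).
  apply: (an_compose Cmono (g := fun y => kappa y 0 i) (M := fun z : 'rV[C]_1 => p + z 0 0 *: (q - p))) => // j.
  apply: (@an_ext _ _ _ (fun z : 'rV[C]_1 => p 0 j + z 0 0 * (q - p) 0 j)).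
    by apply: locallyT => z; rewrite !mxE.
  apply: anD; first exact: an_cst.
  by apply: anM; [exact: an_coord|exact: an_cst].
have [|||K|K] := @path_cover C Cmono Ccomp n gam (fun t => Z1 (orb (gam t))) (fun t => Z2 (orb (gam t))) ga.
- by move=> t t01; exact: analytic_subset_along.
- by move=> t t01; exact: analytic_subset_along.
- move=> t t01; have : Z (orb (gam t)) by apply/ZT; exists (p + t *: (q - p)) => //; exact: gT.
  by rewrite ZE.
- by apply: n1; have := K 0; rewrite /gam scale0r addr0; apply; rewrite /unit_itv lexx ler01.
- by apply: n2; have := K 1; rewrite /gam scale1r addrC subrK; apply; rewrite /unit_itv lexx ler01.
Qed.

End Period.

(** * Orbits of roots under Eichler transformations *)

Section Eichler.
Variables (n : nat) (G : 'M[int]_n).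
Hypothesis Gsym : G^T = G.
Local Notation b := (bform G).
Implicit Types x y e w : 'rV[int]_n.

(** The integer [k] stands for half the norm of [w], so that the matrix is integral. *)
Definition eichler_mx e w (k : int) : 'M[int]_n :=
  1%:M + G *m e^T *m w - G *m w^T *m e - k *: (G *m e^T *m e).

Lemma mul_pairing x e w : x *m (G *m e^T *m w) = b x e *: w.
Proof. by rewrite !mulmxA [x *m G *m e^T]mx11_scalar mul_scalar_mx. Qed.

Lemma eichlerE e w k x : x *m eichler_mx e w k = x + b x e *: w - b x w *: e - (k * b x e) *: e.
Proof.
by rewrite /eichler_mx !mulmxDr !mulmxN mulmx1 -scalemxAr !mul_pairing scalerA.
Qed.

Lemma eichler_pairing e w k x y :
  b (x *m eichler_mx e w k) y = b x y + b x e * b w y - b x w * b e y - k * b x e * b e y.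
Proof. by rewrite eichlerE !(bformDl, bformNl, bformZl). Qed.

Lemma eichler_Aut e w k : b e e = 0 -> b e w = 0 -> b w w = 2 * k -> Aut G (eichler_mx e w k).
Proof.
move=> ee ew ww; have we : b w e = 0 by rewrite bform_sym.
have iso w' k' x y : b e w' = 0 -> b w' w' = 2 * k' ->
    b (x *m eichler_mx e w' k') (y *m eichler_mx e w' k') = b x y.
  move=> ew' ww'; have w'e : b w' e = 0 by rewrite bform_sym.
  rewrite eichler_pairing; set y' := y *m _.
  have y'E z : b z y' = b z y + b y e * b z w' - b y w' * b z e - k' * b y e * b z e.
    rewrite bform_sym// eichler_pairing [b y z]bform_sym// [b w' z]bform_sym// [b e z]bform_sym//.
  rewrite !y'E ee ew' w'e ww' [b e y]bform_sym// [b w' y]bform_sym//; ring.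
split; last by move=> x y; exact: iso.
(* The inverse transformation replaces [w] by [- w], which has the same norm. *)
have H : eichler_mx e w k *m eichler_mx e (- w) k = 1%:M.
  apply/row_matrixP => i; rewrite !rowE mulmxA mulmx1; set x := delta_mx _ _.
  rewrite [LHS]eichlerE bformNr !eichler_pairing ee ew we ww eichlerE.
  by apply/rowP => j; rewrite !mxE; ring.
by case: (mulmx1_unit H).
Qed.

Definition equiv x y := exists2 g, Aut G g & y = x *m g.

Lemma equiv_refl x : equiv x x.
Proof. by exists 1%:M; [exact: lattice_isom_id|rewrite mulmx1]. Qed.

Lemma equiv_trans y x z : equiv x y -> equiv y z -> equiv x z.
Proof.
move=> [g ga ->] [h ha ->]; exists (g *m h); first exact: lattice_isom_mul ha.
by rewrite mulmxA.
Qed.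

Lemma equiv_norm x y : equiv x y -> b y y = b x x.
Proof. by move=> [g [_ H] ->]; rewrite H. Qed.

Lemma equiv_eichler x e w k : b e e = 0 -> b e w = 0 -> b w w = 2 * k ->
  exists2 x', equiv x x' & forall y, b x' y = b x y + b x e * b w y - b x w * b e y - k * b x e * b e y.
Proof.
move=> ee ew ww; exists (x *m eichler_mx e w k); last by move=> y; exact: eichler_pairing.
by exists (eichler_mx e w k) => //; exact: eichler_Aut.
Qed.

End Eichler.

(* A decomposition of the lattice as the sum of two hyperbolic planes <e1, f1>,
   <e2, f2> and a negative definite lattice with orthonormal basis u. *)
Record frame n (G : 'M[int]_n) := Frame {
  fr_e1 : 'rV[int]_n; fr_f1 : 'rV[int]_n; fr_e2 : 'rV[int]_n; fr_f2 : 'rV[int]_n;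
  fr_u : 'I_8 -> 'rV[int]_n;
  fr_e1e1 : bform G fr_e1 fr_e1 = 0; fr_f1f1 : bform G fr_f1 fr_f1 = 0; fr_e1f1 : bform G fr_e1 fr_f1 = 1;
  fr_e2e2 : bform G fr_e2 fr_e2 = 0; fr_f2f2 : bform G fr_f2 fr_f2 = 0; fr_e2f2 : bform G fr_e2 fr_f2 = 1;
  fr_e1e2 : bform G fr_e1 fr_e2 = 0; fr_e1f2 : bform G fr_e1 fr_f2 = 0;
  fr_f1e2 : bform G fr_f1 fr_e2 = 0; fr_f1f2 : bform G fr_f1 fr_f2 = 0;
  fr_e1u : forall k, bform G fr_e1 (fr_u k) = 0; fr_f1u : forall k, bform G fr_f1 (fr_u k) = 0;
  fr_e2u : forall k, bform G fr_e2 (fr_u k) = 0; fr_f2u : forall k, bform G fr_f2 (fr_u k) = 0;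
  fr_uu : forall k l, bform G (fr_u k) (fr_u l) = - (k == l)%:R;
  fr_decomp : forall x, x = bform G x fr_f1 *: fr_e1 + bform G x fr_e1 *: fr_f1
     + bform G x fr_f2 *: fr_e2 + bform G x fr_e2 *: fr_f2 - \sum_k bform G x (fr_u k) *: fr_u k }.

(** * A Euclidean algorithm on the coordinates of a root *)

Section FrameOrbit.
Variables (n : nat) (G : 'M[int]_n) (F : frame G).
Hypothesis Gsym : G^T = G.
Local Notation b := (bform G).
Local Notation e1 := (fr_e1 F).
Local Notation f1 := (fr_f1 F).
Local Notation e2 := (fr_e2 F).
Local Notation f2 := (fr_f2 F).
Local Notation u := (fr_u F).
Implicit Types x y : 'rV[int]_n.

Let bC x y : b x y = b y x. Proof. exact: bform_sym. Qed.
Let f1e1 : b f1 e1 = 1. Proof. by rewrite bC (fr_e1f1 F). Qed.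
Let f2e2 : b f2 e2 = 1. Proof. by rewrite bC (fr_e2f2 F). Qed.
Let e2e1 : b e2 e1 = 0. Proof. by rewrite bC (fr_e1e2 F). Qed.
Let f2e1 : b f2 e1 = 0. Proof. by rewrite bC (fr_e1f2 F). Qed.
Let e2f1 : b e2 f1 = 0. Proof. by rewrite bC (fr_f1e2 F). Qed.
Let f2f1 : b f2 f1 = 0. Proof. by rewrite bC (fr_f1f2 F). Qed.
Let ue1 k : b (u k) e1 = 0. Proof. by rewrite bC (fr_e1u F). Qed.
Let uf1 k : b (u k) f1 = 0. Proof. by rewrite bC (fr_f1u F). Qed.
Let ue2 k : b (u k) e2 = 0. Proof. by rewrite bC (fr_e2u F). Qed.
Let uf2 k : b (u k) f2 = 0. Proof. by rewrite bC (fr_f2u F). Qed.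

Let table := (fr_e1e1 F, fr_f1f1 F, fr_e1f1 F, fr_e2e2 F, fr_f2f2 F, fr_e2f2 F, fr_e1e2 F, fr_e1f2 F,
  fr_f1e2 F, fr_f1f2 F, fr_e1u F, fr_f1u F, fr_e2u F, fr_f2u F, f1e1, f2e2, e2e1, f2e1, e2f1, f2f1,
  ue1, uf1, ue2, uf2).

Definition uvec (c : 'I_8 -> int) : 'rV[int]_n := \sum_k c k *: u k.

Lemma bform_suml (I : Type) (r : seq I) (f : I -> 'rV[int]_n) y :
  b (\sum_(i <- r) f i) y = \sum_(i <- r) b (f i) y.
Proof.
elim: r => [|i r IH]; first by rewrite !big_nil bform0l.
by rewrite !big_cons bformDl IH.
Qed.

Lemma uvecE c y : b (uvec c) y = \sum_k c k * b (u k) y.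
Proof. by rewrite /uvec bform_suml; apply: eq_bigr => k _; rewrite bformZl. Qed.

Lemma uvec_u c k : b (uvec c) (u k) = - c k.
Proof.
rewrite uvecE (bigD1 k)//= (fr_uu F) eqxx mulrN1 big1 ?addr0// => l lk.
by rewrite (fr_uu F) (negPf lk) oppr0 mulr0.
Qed.

Lemma uvec_uvec c : b (uvec c) (uvec c) = - \sum_k c k ^+ 2.
Proof.
rewrite uvecE -sumrN; apply: eq_bigr => k _; rewrite bC uvec_u mulrN expr2//.
Qed.

Lemma uvec0 c y : (forall k, b (u k) y = 0) -> b (uvec c) y = 0.
Proof. by move=> H; rewrite uvecE big1// => k _; rewrite H mulr0. Qed.

Let uve1 c : b (uvec c) e1 = 0. Proof. by apply: uvec0 => k; rewrite table. Qed.
Let uvf1 c : b (uvec c) f1 = 0. Proof. by apply: uvec0 => k; rewrite table. Qed.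
Let uve2 c : b (uvec c) e2 = 0. Proof. by apply: uvec0 => k; rewrite table. Qed.
Let uvf2 c : b (uvec c) f2 = 0. Proof. by apply: uvec0 => k; rewrite table. Qed.

(** The evenness required for an Eichler transformation along [uvec c], whose norm is minus this
    sum. *)
Definition even_vec (c : 'I_8 -> int) := exists k, \sum_i c i ^+ 2 = 2 * k.

Lemma bform_decomp x y : b x y = b x f1 * b e1 y + b x e1 * b f1 y + b x f2 * b e2 y + b x e2 * b f2 y
  - \sum_k b x (u k) * b (u k) y.
Proof.
rewrite {1}(fr_decomp F x) !(bformDl, bformNl, bformZl) bform_suml.
by congr (_ - _); apply: eq_bigr => k _; rewrite bformZl.
Qed.

Lemma norm_decomp x : b x x = 2 * (b x f1 * b x e1) + 2 * (b x f2 * b x e2) - \sum_k b x (u k) ^+ 2.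
Proof.
rewrite {1}bform_decomp [b e1 x]bC [b f1 x]bC [b e2 x]bC [b f2 x]bC.
rewrite (eq_bigr (fun k => b x (u k) ^+ 2)) => [|k _]; last by rewrite [b (u k) x]bC expr2.
by ring.
Qed.

Lemma pairing_inj x y : b x e1 = b y e1 -> b x f1 = b y f1 -> b x e2 = b y e2 -> b x f2 = b y f2 ->
  (forall k, b x (u k) = b y (u k)) -> x = y.
Proof.
move=> E1 E2 E3 E4 E5; rewrite (fr_decomp F x) (fr_decomp F y) E1 E2 E3 E4.
by congr (_ - _); apply: eq_bigr => k _; rewrite E5.
Qed.

Local Notation equiv := (equiv G).

(** This move and the next three combine an isotropic vector of the first hyperbolic plane with a
    multiple of one of the second, so [k = 0]. Each shifts one pairing per plane by a multiple of a
    pairing with the other plane. *)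
Lemma move_ee x t : exists2 x', equiv x x' &
  [/\ b x' f1 = b x f1 - t * b x e2, b x' e1 = b x e1, b x' f2 = b x f2 + t * b x e1,
      b x' e2 = b x e2 & forall k, b x' (u k) = b x (u k)].
Proof.
have [|||x' xx' H] := @equiv_eichler _ _ Gsym x e1 (t *: e2) 0; rewrite ?bformZl ?bformZr ?table ?mulr0//.
by exists x' => //; split=> [||||k]; rewrite H ?bformZl ?bformZr !table; ring.
Qed.

Lemma move_fe x t : exists2 x', equiv x x' &
  [/\ b x' f1 = b x f1, b x' e1 = b x e1 - t * b x e2, b x' f2 = b x f2 + t * b x f1,
      b x' e2 = b x e2 & forall k, b x' (u k) = b x (u k)].
Proof.
have [|||x' xx' H] := @equiv_eichler _ _ Gsym x f1 (t *: e2) 0; rewrite ?bformZl ?bformZr ?table ?mulr0//.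
by exists x' => //; split=> [||||k]; rewrite H ?bformZl ?bformZr !table; ring.
Qed.

Lemma move_ef x t : exists2 x', equiv x x' &
  [/\ b x' f1 = b x f1 - t * b x f2, b x' e1 = b x e1, b x' f2 = b x f2,
      b x' e2 = b x e2 + t * b x e1 & forall k, b x' (u k) = b x (u k)].
Proof.
have [|||x' xx' H] := @equiv_eichler _ _ Gsym x e1 (t *: f2) 0; rewrite ?bformZl ?bformZr ?table ?mulr0//.
by exists x' => //; split=> [||||k]; rewrite H ?bformZl ?bformZr !table; ring.
Qed.

Lemma move_ff x t : exists2 x', equiv x x' &
  [/\ b x' f1 = b x f1, b x' e1 = b x e1 - t * b x f2, b x' f2 = b x f2,
      b x' e2 = b x e2 + t * b x f1 & forall k, b x' (u k) = b x (u k)].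
Proof.
have [|||x' xx' H] := @equiv_eichler _ _ Gsym x f1 (t *: f2) 0; rewrite ?bformZl ?bformZr ?table ?mulr0//.
by exists x' => //; split=> [||||k]; rewrite H ?bformZl ?bformZr !table; ring.
Qed.

Lemma move_e2u x c : even_vec c -> b x e2 = 0 -> exists2 x', equiv x x' &
  [/\ b x' f1 = b x f1, b x' f2 = b x f2 - \sum_k c k * b x (u k) & b x' e2 = 0].
Proof.
move=> [k ck] x0.
have [|||x' xx' H] := @equiv_eichler _ _ Gsym x e2 (uvec c) (- k); rewrite ?table//.
- by rewrite bC uve2.
- by rewrite uvec_uvec ck mulrN.
exists x' => //; split; rewrite H x0 !table ?uvf1 ?uvf2 ?uve2.
- by ring.
- by rewrite [b x (uvec c)]bC uvecE; under eq_bigr do rewrite [b (u _) x]bC; ring.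
- by ring.
Qed.

Lemma move_f1u x c : even_vec c -> exists2 x', equiv x x' &
  [/\ b x' f1 = b x f1, b x' f2 = b x f2, b x' e2 = b x e2 & forall k, b x' (u k) = b x (u k) - b x f1 * c k].
Proof.
move=> [k ck].
have [|||x' xx' H] := @equiv_eichler _ _ Gsym x f1 (uvec c) (- k); rewrite ?table//.
- by rewrite bC uvf1.
- by rewrite uvec_uvec ck mulrN.
exists x' => //; split=> [|||j]; rewrite H !table ?uvf1 ?uvf2 ?uve2 ?uvec_u; ring.
Qed.

Lemma move_e1u x c : even_vec c -> b x e1 = 0 -> exists2 x', equiv x x' &
  [/\ b x' f1 = b x f1 - \sum_k c k * b x (u k), b x' e1 = 0, b x' f2 = b x f2, b x' e2 = b x e2 &
   forall k, b x' (u k) = b x (u k)].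
Proof.
move=> [k ck] x0.
have [|||x' xx' H] := @equiv_eichler _ _ Gsym x e1 (uvec c) (- k); rewrite ?table//.
- by rewrite bC uve1.
- by rewrite uvec_uvec ck mulrN.
exists x' => //; split=> [||||j]; rewrite H x0 !table ?uvf1 ?uvf2 ?uve2 ?uve1 ?uvec_u; try ring.
by rewrite [b x (uvec c)]bC uvecE; under eq_bigr do rewrite [b (u _) x]bC; ring.
Qed.

Lemma sum_delta (f : 'I_8 -> int) i : \sum_k (k == i)%:R * f k = f i.
Proof.
rewrite (bigD1 i)//= eqxx mul1r big1 ?addr0// => k ki.
by rewrite (negPf ki) mul0r.
Qed.

(** A single [u i] has odd norm; sums of two of them are the simplest vectors allowed in an Eichler
    transformation. *)
Definition pair_vec (i j : 'I_8) k : int := (k == i)%:R + (k == j)%:R.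

Lemma pair_vec_even i j : even_vec (pair_vec i j).
Proof.
exists (1 + (i == j)%:R).
rewrite (eq_bigr (fun k => (k == i)%:R * (1 + (k == j)%:R * 2) + (k == j)%:R * 1)) => [|k _].
  by rewrite big_split/= !sum_delta; ring.
by rewrite /pair_vec; case: (k == i); case: (k == j).
Qed.

Lemma pair_vec_sum i j f : \sum_k pair_vec i j k * f k = f i + f j.
Proof.
rewrite (eq_bigr (fun k => (k == i)%:R * f k + (k == j)%:R * f k)) => [|k _]; last by rewrite mulrDl.
by rewrite big_split/= !sum_delta.
Qed.

Lemma equiv_f1_neq0 x : b x x = -1 -> exists2 x', equiv x x' & b x' f1 != 0.
Proof.
move=> xx; have [A0|] := eqVneq (b x f1) 0; last by exists x => //; exact: equiv_refl.
have caseC y : b y f1 = 0 -> b y f2 != 0 -> exists2 x', equiv y x' & b x' f1 != 0.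
  move=> yf1 yf2; have [x' yx' [x'f1 _ _ _ _]] := move_ef y 1; exists x' => //.
  by rewrite x'f1 yf1 mul1r sub0r oppr_eq0.
have [C0|] := eqVneq (b x f2) 0; last exact: caseC.
have [D0|D0] := eqVneq (b x e2) 0; last first.
  have [x' yx' [x'f1 _ _ _ _]] := move_ee x 1; exists x' => //.
  by rewrite x'f1 A0 mul1r sub0r oppr_eq0.
have [B0|B0] := eqVneq (b x e1) 0; last first.
  have [y xy [yf1 _ yf2 _ _]] := move_ee x 1.
  have [||z yz zf1] := caseC y; first by rewrite yf1 A0 D0; ring.
    by rewrite yf2 C0 mul1r add0r.
  by exists z => //; exact: equiv_trans yz.
have [i Li] : exists i, b x (u i) != 0.
  apply: contrapT => H; move: xx; rewrite norm_decomp A0 C0 big1 => [|k _]; first by lia.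
  by have [->|xk] := eqVneq (b x (u k)) 0; [rewrite expr0n|case: H; exists k].
have [x' xx' [x'f1 _ _ _ _]] := move_e1u (pair_vec_even i i) B0; exists x' => //.
by rewrite x'f1 A0 pair_vec_sum; lia.
Qed.

Definition decreases x := exists2 x', equiv x x' & b x' f1 != 0 /\ (`|b x' f1| < `|b x f1|)%N.

Lemma decreases_equiv x y : equiv x y -> b y f1 = b x f1 -> decreases y -> decreases x.
Proof. by move=> xy E [z yz H]; exists z; [exact: equiv_trans yz|rewrite -E]. Qed.

Lemma small_modz (a c : int) : a != 0 -> ~~ (a %| c)%Z -> (0 < (c %% a)%Z)%R /\ (c %% a)%Z < `|a|.
Proof.
move=> a0 ac; rewrite ltz_mod// lt_neqAle modz_ge0// andbT; split=> //.
by rewrite eq_sym; apply: contra ac => /eqP ?; apply/dvdz_mod0P.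
Qed.

(** Dividing [a - 1] instead of [a] gives a remainder between 1 and [r], so the new pairing is
    non-zero. *)
Lemma decreases_mod (a r : int) : 0 < r -> r < `|a| ->
  a - (((a - 1) %/ r)%Z) * r != 0 /\ (`|(a - (((a - 1) %/ r)%Z) * r)%R| < `|a|)%N.
Proof.
move=> r0 ra; have r0' : r != 0 by rewrite gt_eqF.
have -> : a - ((a - 1) %/ r)%Z * r = ((a - 1) %% r)%Z + 1 by rewrite {1}/modz; ring.
have h1 := modz_ge0 (a - 1) r0'; have h2 := ltz_mod (a - 1) r0'.
by split; lia.
Qed.

(** Two Euclidean steps: the pairing with [f2] is reduced modulo the pairing with [f1], then the
    latter modulo the non-zero remainder. *)
Lemma decreasesC x : b x f1 != 0 -> ~~ (b x f1 %| b x f2)%Z -> decreases x.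
Proof.
move=> A0 AC; have [r0 rA] := small_modz A0 AC.
have [y xy [yf1 _ yf2 _ _]] := move_fe x (- (b x f2 %/ b x f1)%Z).
have yf2r : b y f2 = (b x f2 %% b x f1)%Z by rewrite yf2 /modz; ring.
have [z yz [zf1 _ _ _ _]] := move_ef y (((b y f1 - 1) %/ b y f2)%Z).
exists z; first exact: equiv_trans yz.
by rewrite zf1 yf1; apply: decreases_mod; rewrite yf2r.
Qed.

Lemma decreasesD x : b x f1 != 0 -> ~~ (b x f1 %| b x e2)%Z -> decreases x.
Proof.
move=> A0 AC; have [r0 rA] := small_modz A0 AC.
have [y xy [yf1 _ _ ye2 _]] := move_ff x (- (b x e2 %/ b x f1)%Z).
have ye2r : b y e2 = (b x e2 %% b x f1)%Z by rewrite ye2 /modz; ring.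
have [z yz [zf1 _ _ _ _]] := move_ee y (((b y f1 - 1) %/ b y e2)%Z).
exists z; first exact: equiv_trans yz.
by rewrite zf1 yf1; apply: decreases_mod; rewrite ye2r.
Qed.

Lemma equiv_clear x : b x f1 != 0 -> (b x f1 %| b x f2)%Z -> (b x f1 %| b x e2)%Z ->
  exists2 y, equiv x y & [/\ b y f1 = b x f1, b y f2 = 0 & b y e2 = 0].
Proof.
move=> A0 AC AD.
have [y xy [yf1 _ yf2 ye2 _]] := move_fe x (- (b x f2 %/ b x f1)%Z).
have [z yz [zf1 _ zf2 ze2 _]] := move_ff y (- (b x e2 %/ b x f1)%Z).
exists z; first exact: equiv_trans yz.
by rewrite zf1 yf1 zf2 yf2 ze2 ye2 yf1 !mulNr !divzK// !subrr.
Qed.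

(** A pairing with [e1], or a sum of two pairings with the [u k], that is not divisible by [b x f1]
    is moved into the pairing with [f2], where [decreasesC] applies. If everything is divisible, the
    norm equation makes [b x f1] divide 1. *)
Lemma root_decreases x : b x x = -1 -> b x f1 != 0 -> (`|b x f1| != 1)%N -> decreases x.
Proof.
move=> xx A0 A1.
have [AC|] := boolP (b x f1 %| b x f2)%Z; last exact: decreasesC.
have [AD|] := boolP (b x f1 %| b x e2)%Z; last exact: decreasesD.
have [y xy [yf1 yf2 ye2]] := equiv_clear A0 AC AD.
apply: (decreases_equiv xy yf1); have yy := equiv_norm xy; move: yy A0 A1; rewrite xx -yf1 => yy A0 A1.
have [AB|AB] := boolP (b y f1 %| b y e1)%Z; last first.
  have [z yz [zf1 _ zf2 _ _]] := move_ee y 1.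
  have zf1' : b z f1 = b y f1 by rewrite zf1 ye2; ring.
  apply: (decreases_equiv yz zf1'); apply: decreasesC; first by rewrite zf1'.
  by rewrite zf1' zf2 yf2 mul1r add0r.
apply: contrapT => nd.
have AL i j : (b y f1 %| b y (u i) + b y (u j))%Z.
  apply: contrapT => /negP AL; apply: nd.
  have [z yz [zf1 zf2 _]] := move_e2u (pair_vec_even i j) ye2.
  apply: (decreases_equiv yz zf1); apply: decreasesC; first by rewrite zf1.
  by rewrite zf1 zf2 yf2 pair_vec_sum sub0r rpredN.
have : (b y f1 %| 1)%Z; last by rewrite dvdz1; apply/negP.
have -> : 1%Z = \sum_k b y (u k) ^+ 2 - 2 * b y e1 * b y f1.
  by have := norm_decomp y; rewrite yy yf2 => H; lia.
(* Divisibility is known only for sums of two pairings, so each square is compared with the one at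
   [ord0]; the eight squares left over again contain such a sum as a factor. *)
have -> : \sum_k b y (u k) ^+ 2 = \sum_k (b y (u k) - b y (u ord0)) * (b y (u k) + b y (u ord0))
    + 4 * b y (u ord0) * (b y (u ord0) + b y (u ord0)).
  by rewrite !big_ord_recl !big_ord0; ring.
apply: rpredB; last exact: dvdz_mull.
by apply: rpredD; [apply: rpred_sum => k _|]; exact: dvdz_mull.
Qed.

Lemma equiv_f1_unit x : b x x = -1 -> exists2 y, equiv x y & (`|b y f1| = 1)%N.
Proof.
move=> xx; have [x0 xx0 A0] := equiv_f1_neq0 xx.
suff H m z : (`|b z f1| <= m)%N -> b z z = -1 -> b z f1 != 0 -> exists2 y, equiv z y & (`|b y f1| = 1)%N.
  have [|y x0y yf1] := H _ x0 (leqnn _) _ A0; first by rewrite (equiv_norm xx0).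
  by exists y => //; exact: equiv_trans x0y.
elim: m z => [|m IH] z zm zz z0; first by move: z0; lia.
have [z1|z1] := eqVneq `|b z f1|%N 1%N; first by exists z => //; exact: equiv_refl.
have [z' zz' [z'0 z'z]] := root_decreases zz z0 z1.
have [||//|y z'y yf1] := IH z'; first by move: z'z zm; lia.
  by rewrite (equiv_norm zz').
by exists y => //; exact: equiv_trans z'y.
Qed.

Theorem root_equiv x : b x x = -1 -> equiv x (u ord0).
Proof.
move=> xx; have [x1 xx1 A1] := equiv_f1_unit xx.
have A2 : b x1 f1 * b x1 f1 = 1 by move: A1; nia.
have A0 : b x1 f1 != 0 by move: A1; lia.
have dv c : (b x1 f1 %| c)%Z by apply/dvdzP; exists (c * b x1 f1); rewrite -mulrA A2 mulr1.
have [x2 x12 [x2f1 x2f2 x2e2]] := equiv_clear A0 (dv _) (dv _).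
have xx2 := equiv_trans xx1 x12; move: A2 A0; rewrite -x2f1 => A2 A0.
set A := b x2 f1 in A2 A0.
have x2n : \sum_k b x2 (u k) ^+ 2 = 1 + 2 * (A * b x2 e1).
  by have := norm_decomp x2; rewrite (equiv_norm xx2) xx x2f2 -/A => H; lia.
(* Tuned so that the pairings with the [u k] become those of [u ord0]. As [A] is a unit, only
   evenness restricts the choice, and the norm -1 provides it. *)
pose c1 k := A * (b x2 (u k) + (k == ord0)%:R).
have [|x3 x23 [x3f1 x3f2 x3e2 x3u]] := @move_f1u x2 c1.
  exists (1 + A * b x2 e1 + b x2 (u ord0)).
  rewrite (eq_bigr (fun k => b x2 (u k) ^+ 2 + (k == ord0)%:R * (2 * b x2 (u k) + 1))) => [|k _].
    by rewrite big_split/= x2n sum_delta; ring.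
  by rewrite /c1 exprMn [A ^+ 2]A2 mul1r; case: (k == _); rewrite ?mulr1n ?mulr0n; ring.
have {}x3u k : b x3 (u k) = - (k == ord0)%:R by rewrite x3u -/A /c1 mulrA A2; ring.
have xx3 := equiv_trans xx2 x23; have x3e1 : b x3 e1 = 0.
  have := norm_decomp x3; rewrite (equiv_norm xx3) xx x3f1 x3f2 x2f2 -/A.
  under eq_bigr do rewrite x3u sqrrN expr2; rewrite sum_delta eqxx => H.
  have {}H : A * b x3 e1 = 0 by lia.
  by move/eqP: H; rewrite mulf_eq0 (negPf A0) => /eqP.
(* Only the pairing [A] with [f1] is left to cancel, by the entry [- A] at [ord0]. The entry 1 at
   [i1] makes the norm even and has no other effect, since [x3] pairs to 0 with [u i1]. *)
pose i1 : 'I_8 := lift ord0 ord0.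
pose c2 k := - A * (k == ord0)%:R + (k == i1)%:R.
have [|x4 x34 [x4f1 x4e1 x4f2 x4e2 x4u]] := @move_e1u x3 c2 _ x3e1.
  exists 1; rewrite (eq_bigr (fun k => (k == ord0)%:R * 1 + (k == i1)%:R * 1)) => [|k _].
    by rewrite big_split/= !sum_delta.
  rewrite /c2; have [->|_] := eqVneq k ord0; first by rewrite !mulr1 addr0 sqrrN [_ ^+ 2]A2.
  by case: (k == i1); rewrite mulr0.
have -> : u ord0 = x4; last exact: equiv_trans x34.
apply: pairing_inj; rewrite ?table ?x4e1// ?x4f1 ?x4f2 ?x4e2 ?x3f1 ?x3f2 ?x3e2 ?x2f2 ?x2e2//.
  rewrite -/A; under eq_bigr do rewrite x3u mulrN mulrC -mulNr mulNr.
  by rewrite sumrN sum_delta /c2 eqxx (_ : (ord0 == i1) = false)// mulr1n mulr0n; ring.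
by move=> k; rewrite x4u x3u (fr_uu F) eq_sym.
Qed.

End FrameOrbit.

(** * Majorants and the tube domain *)

Section FrameComplex.
Variables (C : numClosedFieldType) (n : nat) (G : 'M[int]_n) (F : frame G).
Hypothesis Gsym : G^T = G.
Local Notation V := 'rV[C]_n.
Local Notation extC := (map_mx (intr : int -> C)).
Local Notation e1 := (fr_e1 F).
Local Notation f1 := (fr_f1 F).
Local Notation e2 := (fr_e2 F).
Local Notation f2 := (fr_f2 F).
Local Notation u := (fr_u F).
Local Notation L := (lam G).
Local Notation coneD := (coneD G).
Implicit Types (x y v : V) (w l : 'rV[int]_n).

Lemma frame_expand x : x = L f1 x *: extC e1 + L e1 x *: extC f1 + L f2 x *: extC e2
  + L e2 x *: extC f2 - \sum_k L (u k) x *: extC (u k).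
Proof.
have H : 1%:M = G *m f1^T *m e1 + G *m e1^T *m f1 + G *m f2^T *m e2 + G *m e2^T *m f2
    - \sum_k G *m (u k)^T *m u k.
  apply/row_matrixP => i; rewrite !rowE mulmx1 mulmxBr !mulmxDr !mul_pairing mulmx_sumr.
  rewrite {1}(fr_decomp F (delta_mx 0 i)); congr (_ - _); apply: eq_bigr => k _.
  by rewrite mul_pairing.
have P l l' : x *m (extC G *m extC l^T *m extC l') = L l x *: extC l'.
  by rewrite -matrix.map_trmx !mulmxA [x *m _ *m _]mx11_scalar mul_scalar_mx.
rewrite -{1}(mulmx1 x) -(map_mx1 (intr : int -> C)) H map_mxB !map_mxD !map_mxM.
rewrite mulmxBr !mulmxDr !P; congr (_ - _).
rewrite raddf_sum/= mulmx_sumr; apply: eq_bigr => k _.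
by rewrite !map_mxM P.
Qed.

Lemma formC_suml (I : Type) (r : seq I) (f : I -> V) y :
  formC G (\sum_(i <- r) f i) y = \sum_(i <- r) formC G (f i) y.
Proof.
elim: r => [|i r IH]; first by rewrite !big_nil -(scale0r 0) formCZl mul0r.
by rewrite !big_cons formCDl IH.
Qed.

Lemma formC_frame x y : formC G x y = L f1 x * L e1 y + L e1 x * L f1 y + L f2 x * L e2 y + L e2 x * L f2 y
  - \sum_k L (u k) x * L (u k) y.
Proof.
rewrite {1}(frame_expand x) formCDl formCNl !formCDl !formCZl formC_suml.
rewrite ![formC G (extC _) y](formC_sym Gsym); congr (_ - _); apply: eq_bigr => k _.
by rewrite formCZl (formC_sym Gsym).
Qed.

Lemma lam_conj l x : L l (conjV x) = Num.conj (L l x).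
Proof. by rewrite /lam -formC_conj conjV_int. Qed.

Lemma lamD l x y : L l (x + y) = L l x + L l y. Proof. exact: formCDl. Qed.
Lemma lamZ l c x : L l (c *: x) = c * L l x. Proof. exact: formCZl. Qed.
Lemma lamDl l w x : L (l + w) x = L l x + L w x.
Proof. by rewrite /lam map_mxD formCDr. Qed.
Lemma lam_int l w : L l (extC w) = (bform G w l)%:~R.
Proof. by rewrite /lam /formC bform_map. Qed.

Definition frame_norm x := `|L e1 x| ^+ 2 + `|L f1 x| ^+ 2 + `|L e2 x| ^+ 2 + `|L f2 x| ^+ 2
  + \sum_k `|L (u k) x| ^+ 2.

(** The vectors [e1 + f1] and [e2 + f2] carry the two positive directions: their squares added to
    minus the hermitian form give a positive definite reference norm, independent of any point of
    the domain. *)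
Lemma frame_normE x : frame_norm x =
  `|L (e1 + f1) x| ^+ 2 + `|L (e2 + f2) x| ^+ 2 - formC G x (conjV x).
Proof.
rewrite /frame_norm formC_frame !lam_conj !lamDl !normCK !rmorphD/=.
under eq_bigr do rewrite normCK.
under [in RHS]eq_bigr do rewrite lam_conj.
by ring.
Qed.

Lemma frame_norm_ge0 x : 0 <= frame_norm x.
Proof. by rewrite /frame_norm !addr_ge0// ?sumr_ge0// => *; rewrite exprn_ge0. Qed.

(** * Positivity of the majorant and the Cauchy-Schwarz inequality *)

Section Majorant.
Variable v : V.
Hypothesis vD : coneD v.
Local Notation vb := (conjV v).
Local Notation s := (formC G v vb).

Let s_gt0 : 0 < s. Proof. by case: vD. Qed.
Let s_neq0 : s != 0. Proof. exact: lt0r_neq0. Qed.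
Let vv : formC G v v = 0. Proof. by case: vD. Qed.
Let vbvb : formC G vb vb = 0. Proof. by rewrite formC_conj vv rmorph0. Qed.
Let vbv : formC G vb v = s. Proof. by rewrite formC_sym. Qed.
Let sJ : Num.conj s = s. Proof. by apply/CrealP/form_real. Qed.

Definition maj y x := (2 / formC G y (conjV y)) * (`|formC G x y| ^+ 2 + `|formC G x (conjV y)| ^+ 2)
  - formC G x (conjV x).

Let conj_pair x : formC G v (conjV x) = Num.conj (formC G x vb).
Proof. by rewrite -formC_conj conjVK (formC_sym Gsym). Qed.
Let conj_pairb x : formC G vb (conjV x) = Num.conj (formC G x v).
Proof. by rewrite -formC_conj (formC_sym Gsym). Qed.

(* The signature is (2, _): a third vector of positive norm would give a
   nonzero combination orthogonal to the two vectors [e1 + f1] and [e2 + f2]. *)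
Lemma orthogonal_form_le0 x : formC G x v = 0 -> formC G x vb = 0 -> formC G x (conjV x) <= 0.
Proof.
move=> xv xvb; rewrite real_leNgt ?form_real ?real0//; apply/negP => x0.
pose l (i : 'I_2) := if i == 0 then e1 + f1 else e2 + f2.
pose p (i : 'I_3) := if i == 0 then v else if i == 1 then vb else x.
pose M : 'M[C]_(3, 2) := \matrix_(i, j) L (l j) (p i).
have /rowV0Pn[a /sub_kermxP aM a0] : kermx M != 0.
  rewrite kermx_eq0; apply/negP => /eqP rM.
  by have := rank_leq_col M; rewrite rM.
pose y := a 0 0 *: v + a 0 1 *: vb + a 0 2 *: x.
have yl j : L (l j) y = 0.
  have := congr1 (fun N : 'rV_2 => N 0 j) aM; rewrite !mxE !big_ord_recl big_ord0 !mxE/= => E.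
  rewrite /y !lamD !lamZ -E addr0 -!addrA; congr (_ * _ + (_ * _ + _ * _)).
    by congr (a 0 _); apply: val_inj.
  by congr (a 0 _); apply: val_inj.
have yn : formC G y (conjV y) <= 0.
  have := frame_normE y; have := yl 0; have := yl 1; rewrite /l/= => -> ->.
  rewrite normr0 expr0n addr0 add0r => E.
  by rewrite -oppr_ge0 -E frame_norm_ge0.
have yE : formC G y (conjV y) = `|a 0 0| ^+ 2 * s + `|a 0 1| ^+ 2 * s + `|a 0 2| ^+ 2 * formC G x (conjV x).
  rewrite /y !conjVD !conjVZ conjVK !(formCDl, formCDr, formCZl, formCZr) vv vbvb vbv xv xvb.
  rewrite (conj_pair x) (conj_pairb x) xv xvb conjC0 !normCK; ring.
move: yn; rewrite yE => yn; case/eqP: a0.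
have : formC G y (conjV y) == 0 by rewrite eq_le yE yn !addr_ge0 ?mulr_ge0 ?exprn_ge0 ?(ltW s_gt0) ?(ltW x0).
rewrite yE !paddr_eq0 ?addr_ge0 ?mulr_ge0 ?exprn_ge0 ?(ltW s_gt0) ?(ltW x0)// !mulf_eq0 !orbb !normr_eq0.
rewrite (negPf s_neq0) (gt_eqF x0) !orbF => /andP[/andP[/eqP E0 /eqP E1] /eqP E2].
apply/rowP => i; rewrite mxE; case: i => [[|[|[|//]]] i].
- by rewrite -E0; congr (a 0 _); apply: val_inj.
- by rewrite -E1; congr (a 0 _); apply: val_inj.
- by rewrite -E2; congr (a 0 _); apply: val_inj.
Qed.

(** Separates the contribution of the plane of [v] and [vb] from that of its complement, whose sign
    is given by [orthogonal_form_le0]. *)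
Lemma maj_tau x : maj v x = (`|formC G x v| ^+ 2 + `|formC G x vb| ^+ 2) / s
  - formC G (tau G v x) (conjV (tau G v x)).
Proof.
have tE : tau G v x = x + (- (formC G x vb / s)) *: v + (- (formC G x v / s)) *: vb by rewrite !scaleNr.
have -> : formC G (tau G v x) (conjV (tau G v x)) = formC G (tau G v x) (conjV x).
  rewrite {2}tE !conjVD !conjVZ conjVK !formCDr !formCZr.
  by rewrite (tau_v Gsym vD) (tau_vb vD) !mulr0 !addr0.
rewrite tE !formCDl !formCZl (conj_pair x) (conj_pairb x) /maj !normCK.
by field.
Qed.

Lemma maj_ge0 x : 0 <= maj v x.
Proof.
rewrite maj_tau addr_ge0 ?divr_ge0 ?addr_ge0 ?exprn_ge0 ?(ltW s_gt0)//.
by rewrite oppr_ge0 orthogonal_form_le0 ?(tau_v Gsym vD) ?(tau_vb vD).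
Qed.

(** Twice the projection of [w] to the plane of [v] and [vb], minus [w]: an orthogonal reflection,
    which represents the functional [L w] in the hermitian product of the majorant. *)
Definition refl w : V := (2 / s * L w vb) *: v + (2 / s * L w v) *: vb - extC w.

Lemma maj_sub_refl x w t : maj v (x - t *: refl w) =
  maj v x - Num.conj t * L w x - t * Num.conj (L w x) + t * Num.conj t * maj v (extC w).
Proof.
have wx y : formC G (extC w) y = L w y by rewrite (formC_sym Gsym).
have sJ2 : Num.conj (2 / s) = 2 / s by rewrite fmorph_div/= sJ conjC_nat.
have cE z : Num.conj (2 / s * z) = 2 / s * Num.conj z by rewrite rmorphM/= sJ2.
have rJ : conjV (refl w) = refl w.
  rewrite /refl -scaleN1r !conjVD !conjVZ conjVK conjV_int !cE -!lam_conj conjVK rmorphN1.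
  by congr (_ + _); exact: addrC.
have wxb : L w vb = Num.conj (L w v) by exact: lam_conj.
have rx y : formC G (refl w) y = 2 / s * L w vb * formC G y v + 2 / s * L w v * formC G y vb - L w y.
  by rewrite /refl !formCDl !formCZl formCNl wx (formC_sym Gsym v y) (formC_sym Gsym vb y).
have rv : formC G (refl w) v = L w v by rewrite rx vv (formC_sym Gsym v) vbv; field.
have rvb : formC G (refl w) vb = L w vb by rewrite rx vbvb vbv; field.
have rr : formC G (refl w) (refl w) = (bform G w w)%:~R.
  have -> : formC G (refl w) (refl w) = 2 / s * L w vb * L w v + 2 / s * L w v * L w vb - L w (refl w).
    by rewrite rx rv rvb.
  by rewrite [L w (refl w)]rx !wx lam_int; ring.
move: (refl w) rJ rx rv rvb rr => r rJ rx rv rvb rr.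
rewrite /maj -scaleNr conjVD conjVZ rJ !(formCDl, formCDr, formCZl, formCZr) !wx rv rvb rr.
rewrite [formC G x r](formC_sym Gsym) !rx conjV_int lam_int ![formC G (conjV x) _](formC_sym Gsym) (conj_pair x) (conj_pairb x) !lam_conj.
rewrite !normCK !(rmorphD, rmorphM, rmorphN)/= !conjCK; by field.
Qed.

(** The Cauchy-Schwarz inequality, from positivity at [x - t *: refl w] with [t = L w x / c]. A
    bound [c] in place of the exact majorant can be kept uniform as [v] varies. *)
Lemma maj_pairing w x c : 0 < c -> maj v (extC w) <= c -> `|L w x| ^+ 2 <= c * maj v x.
Proof.
move=> c0 wc; have cn : c != 0 by exact: lt0r_neq0.
have cJ : Num.conj c = c by apply/CrealP/gtr0_real.
have := maj_ge0 (x - (L w x / c) *: refl w).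
rewrite maj_sub_refl fmorph_div/= cJ.
have -> : maj v x - (L w x)^* / c * L w x - L w x / c * (L w x)^* + L w x / c * ((L w x)^* / c) * maj v (extC w)
   = (c * maj v x - `|L w x| ^+ 2 + `|L w x| ^+ 2 * ((maj v (extC w) - c) / c)) / c.
  by rewrite normCK; field.
rewrite pmulr_lge0 ?invr_gt0// => H; rewrite -subr_ge0; apply: le_trans H _.
by rewrite gerDl mulr_ge0_le0 ?exprn_ge0// pmulr_lle0 ?invr_gt0// subr_le0.
Qed.

(** By [frame_normE] the reference norm consists of two pairings, bounded by Cauchy-Schwarz, and of
    minus the hermitian form, which the majorant dominates. *)
Lemma frame_norm_le_maj c1 c2 x : 0 < c1 -> 0 < c2 -> maj v (extC (e1 + f1)) <= c1 ->
  maj v (extC (e2 + f2)) <= c2 -> frame_norm x <= (c1 + c2 + 1) * maj v x.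
Proof.
move=> c10 c20 h1 h2; rewrite frame_normE !mulrDl mul1r !lerD ?maj_pairing//.
by rewrite /maj lerDr mulr_ge0 ?divr_ge0 ?(ltW s_gt0)// addr_ge0 ?exprn_ge0.
Qed.

Lemma maj_local_bound w : exists2 c : C, 0 < c & locally v (fun y => coneD y -> maj y (extC w) <= c).
Proof.
have H1 := locally_form_ge Gsym s_gt0.
have H2 := an_continuous (an_lam G w v) ltr01.
have wx y : formC G (extC w) y = L w y by rewrite (formC_sym Gsym).
exists (2 / (s / 2) * ((`|L w v| + 1) ^+ 2 + (`|L w v| + 1) ^+ 2) + `|(bform G w w)%:~R : C|).
  rewrite ltr_wpDr// mulr_gt0 ?divr_gt0// addr_gt0// exprn_gt0// ltr_wpDl//.
apply: locallyS (locallyI H1 H2) => y [ys yl] [_ y0].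
have yw : `|L w y| <= `|L w v| + 1.
  by rewrite -(subrK (L w v) (L w y)) addrC; apply: le_trans (ler_normD _ _) _; rewrite lerD2l.
have yw2 : `|L w y| ^+ 2 <= (`|L w v| + 1) ^+ 2 by rewrite ler_pXn2r// nnegrE addr_ge0.
rewrite /maj !wx conjV_int lam_int lam_conj norm_conjC; apply: lerD.
  rewrite ler_pM ?divr_ge0 ?(ltW y0) ?addr_ge0 ?exprn_ge0 ?lerD//.
  by rewrite ler_pM2l// lef_pV2 ?posrE ?divr_gt0.
by rewrite -normrN real_ler_norm// realN intr_real.
Qed.

Lemma maj_Aut x g : Aut G g -> maj (v *m extC g) (x *m extC g) = maj v x.
Proof. by move=> ga; rewrite /maj !conjV_mul !(formC_Aut _ _ ga). Qed.

Lemma majZ c x : c != 0 -> maj (c *: v) x = maj v x.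
Proof.
move=> c0; rewrite /maj !conjVZ !(formCZl, formCZr) !normrM !exprMn norm_conjC [`|c| ^+ 2]normCK; field.
by rewrite s_neq0 conjC_eq0 c0.
Qed.

(** The value does not depend on the point, so the roots orthogonal to points near [v] have bounded
    reference norm. *)
Lemma maj_root l : root G l -> L l v = 0 -> maj v (extC l) = 1.
Proof.
move=> ll lv; rewrite /maj !(formC_sym Gsym (extC l)) -![formC G _ (extC l)]/(L l _).
by rewrite lam_conj lv conjC0 normr0 expr0n addr0 mulr0 conjV_int lam_int ll; ring.
Qed.

End Majorant.

Lemma frame_norm_local_bound v : coneD v -> exists2 c : C, 0 < c &
  locally v (fun y => coneD y -> forall x, frame_norm x <= c * maj y x).
Proof.
move=> vD; have [c1 c10 H1] := maj_local_bound vD (e1 + f1).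
have [c2 c20 H2] := maj_local_bound vD (e2 + f2).
exists (c1 + c2 + 1); first by rewrite !addr_gt0.
by apply: locallyS (locallyI H1 H2) => y [h1 h2] yD x; rewrite frame_norm_le_maj ?h1 ?h2.
Qed.

Lemma pairing_le_frame_norm x : [/\ `|L e1 x| ^+ 2 <= frame_norm x, `|L f1 x| ^+ 2 <= frame_norm x,
  `|L e2 x| ^+ 2 <= frame_norm x, `|L f2 x| ^+ 2 <= frame_norm x &
  forall k, `|L (u k) x| ^+ 2 <= frame_norm x].
Proof.
have sq z : 0 <= `|z : C| ^+ 2 by rewrite exprn_ge0.
have S0 (P : pred 'I_8) : 0 <= \sum_(k | P k) `|L (u k) x| ^+ 2 by apply: sumr_ge0.
rewrite /frame_norm; split=> [||||k].
- by rewrite -!addrA lerDl !addr_ge0.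
- by rewrite -!addrA addrCA lerDl !addr_ge0.
- by rewrite -addrA [X in _ <= X + _]addrC -addrA lerDl !addr_ge0.
- by rewrite [X in _ <= X + _]addrC -addrA lerDl !addr_ge0.
- by rewrite (bigD1 k)//= addrCA lerDl !addr_ge0.
Qed.

(** * Local finiteness of the roots and of the isometry group *)

Hypothesis Cmono : monotone_cauchy C.

Lemma square_bounded (c : C) : exists N : nat, forall m : int, (m%:~R : C) ^+ 2 <= c -> (`|m| <= N)%N.
Proof.
(* If [c] bounded all natural numbers, they would form a Cauchy sequence, whereas their steps are
   1. *)
have [N Nc] : exists N : nat, ~ ((N%:R : C) <= c).
  apply: contrapT => /forallNP H.
  have Hc N : (N%:R : C) <= c by apply: contrapT; exact: H.
  have half0 : 0 < (2^-1 : C) by rewrite invr_gt0.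
  have H1 (i j : nat) : (i <= j)%N -> (i%:R : C) <= j%:R by rewrite ler_nat.
  have H2 (i : nat) : 0 <= (i%:R : C) <= c by rewrite ler0n Hc.
  have [N /(_ N N.+1)] := @Cmono (fun N => N%:R) c H1 H2 2^-1 half0.
  rewrite leqnn leqnSn -natr1 opprD addrA subrr sub0r normrN normr1 => /(_ isT isT).
  by rewrite invr_ge1 ?unitfE ?pnatr_eq0// lern1.
exists N => m mc; rewrite leqNgt; apply/negP => Nm; apply: Nc; apply: le_trans mc.
rewrite -rmorphXn/= (_ : N%:R = N%:Z%:~R :> C)// ler_int; move: Nm; nia.
Qed.

Lemma finite_frame_norm (c : C) : exists s : seq 'rV[int]_n,
  forall w, frame_norm (extC w) <= c -> w \in s.
Proof.
have [N HN] := square_bounded c; pose M := (N + N)%N.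
pose dec (i : 'I_M.+1) : int := i%:Z - N%:Z.
pose enc (m : int) : 'I_M.+1 := inord `|m + N%:Z|.
have encK m : (`|m| <= N)%N -> dec (enc m) = m by move=> mN; rewrite /dec inordK; lia.
pose vec (t : 'I_M.+1 * 'I_M.+1 * 'I_M.+1 * 'I_M.+1 * {ffun 'I_8 -> 'I_M.+1}) : 'rV[int]_n :=
  dec t.1.1.1.1 *: e1 + dec t.1.1.1.2 *: f1 + dec t.1.1.2 *: e2 + dec t.1.2 *: f2 - \sum_k dec (t.2 k) *: u k.
exists [seq vec t | t <- enum predT] => w wc.
have bound l : `|L l (extC w)| ^+ 2 <= frame_norm (extC w) -> (`|bform G w l| <= N)%N.
  move=> H; apply: HN; apply: le_trans wc; apply: le_trans H.
  by rewrite lam_int real_normK ?intr_real.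
have [/bound b1 /bound b2 /bound b3 /bound b4 b5] := pairing_le_frame_norm (extC w).
apply/mapP; exists (enc (bform G w f1), enc (bform G w e1), enc (bform G w f2), enc (bform G w e2),
   [ffun k => enc (bform G w (u k))]); rewrite ?mem_enum// /vec/=.
rewrite !encK// [LHS](fr_decomp F); congr (_ - _); apply: eq_bigr => k _.
by rewrite ffunE encK//; exact: bound (b5 k).
Qed.

Theorem roots_finite_local : roots_locally_finite C G.
Proof.
move=> v vD; have [c c0 H] := frame_norm_local_bound vD.
have [s Hs] := finite_frame_norm c.
exists s; apply: locallyS H => y H yD l rl ly; apply: Hs.
by apply: le_trans (H yD _) _; rewrite maj_root// mulr1.
Qed.

Lemma finite_matrices (s : seq 'rV[int]_n) : exists t : seq 'M[int]_n,
  forall g, (forall i, row i g \in s) -> g \in t.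
Proof.
pose mx (f : {ffun 'I_n -> 'I_(size s).+1}) := \matrix_(i < n) nth 0 s (f i).
exists [seq mx f | f <- enum predT] => g gs.
apply/mapP; exists [ffun i => inord (index (row i g) s)]; first by rewrite mem_enum.
apply/row_matrixP => i; rewrite rowK ffunE inordK ?nth_index//.
by rewrite ltnS index_size.
Qed.

(** The rows of [g] are the images of the basis vectors, and invariance of the majorant carries its
    bound from [y] to [z]; a bounded reference norm leaves finitely many rows. *)
Theorem Aut_finite_local : Aut_locally_finite C G.
Proof.
move=> v vD; have [c c0 H] := frame_norm_local_bound vD.
have [k k0 Hk] : exists2 k : C, 0 < k & locally v (fun y => coneD y ->
    forall i, maj y (extC (delta_mx 0 i : 'rV[int]_n)) <= k).
  have Hi i : exists2 k : C, 0 < k & locally v (fun y => coneD y -> maj y (extC (delta_mx 0 i : 'rV[int]_n)) <= k).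
    exact: maj_local_bound.
  have [f Hf] := choice (fun i => let: ex_intro2 k k0 Hk := Hi i in ex_intro _ k (conj k0 Hk)).
  exists (1 + \sum_i f i).
    by rewrite ltr_pwDl// sumr_ge0// => i _; case: (Hf i) => /ltW.
  have := locally_fin (fun i => (Hf i).2); apply: locallyS => y yH yD i.
  apply: le_trans (yH i yD) _; rewrite (bigD1 i)//= addrCA lerDl addr_ge0// sumr_ge0// => j _.
  by case: (Hf j) => /ltW.
have [s Hs] := finite_frame_norm (c * k); have [t Ht] := finite_matrices s.
have [e e0 He] := locallyI H Hk; exists t, e; split=> // y z g a vy vz yD zD ga zE.
apply: Ht => i; apply: Hs; have [Hz _] := He z vz; have [_ Hy] := He y vy.
apply: le_trans (Hz zD _) _; rewrite ler_pM2l//.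
have a0 : a != 0.
  by apply: contraTneq (coneD_neq0 zD) => a0; rewrite zE a0 scale0r eqxx.
rewrite zE majZ//; last exact: coneD_Aut.
by rewrite rowE map_mxM maj_Aut//; exact: Hy.
Qed.

(** * The tube domain parametrising H / Gamma *)

Lemma divH_coneD (x : set {vspace V}) : divH_mod_Gamma C G x -> exists2 y : V, coneD y & x = orb G y.
Proof. by move=> [N [l _ [[w [-> w0 wp]] _]] <-]; exists w. Qed.

Lemma equiv_root_lam l y : root G l -> L l y = 0 -> coneD y ->
  exists y', [/\ coneD y', orb G y' = orb G y & L (u ord0) y' = 0].
Proof.
move=> rl ly yD; have [g ga uE] := root_equiv F Gsym rl.
exists (y *m extC g); split; [exact: coneD_Aut|exact: orb_Aut|].
by rewrite lam_Aut// uE mulmxK//; case: ga.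
Qed.

(** An isotropic vector orthogonal to [y] would have majorant 0, while the majorant dominates the
    reference norm up to a constant. *)
Lemma lam_neq0 y w : coneD y -> bform G w w = 0 -> frame_norm (extC w) != 0 -> L w y != 0.
Proof.
move=> yD ww; apply: contra_neq => wy; have [c c0 /locally_pt H] := frame_norm_local_bound yD.
have majw : maj y (extC w) = 0.
  rewrite /maj !(formC_sym Gsym (extC w)) -![formC G _ (extC w)]/(L w _).
  by rewrite lam_conj wy conjC0 normr0 expr0n addr0 mulr0 conjV_int lam_int ww subrr.
by apply/eqP; rewrite eq_le frame_norm_ge0 andbT; apply: le_trans (H yD _) _; rewrite majw mulr0.
Qed.

Lemma e1_neq0 y : coneD y -> L e1 y != 0.
Proof.
move=> yD; apply: lam_neq0; rewrite ?(fr_e1e1 F)//.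
have [_ H _ _ _] := pairing_le_frame_norm (extC e1); apply: lt0r_neq0; apply: lt_le_trans H.
by rewrite lam_int (fr_e1f1 F) normr1 expr1n.
Qed.

(** Minus the identity on the plane of [e2] and [f2], the identity on its complement; it reverses
    the imaginary parts of [L e2] and [L f2], whose sign distinguishes the two components. *)
Definition flip_mx : 'M[int]_n := 1%:M - 2 *: (G *m f2^T *m e2 + G *m e2^T *m f2).

Lemma flipE (x : 'rV[int]_n) : x *m flip_mx = x - 2 *: (bform G x f2 *: e2 + bform G x e2 *: f2).
Proof. by rewrite /flip_mx mulmxBr mulmx1 -scalemxAr mulmxDr !mul_pairing. Qed.

Lemma flip_flip (x : 'rV[int]_n) : x *m flip_mx *m flip_mx = x.
Proof.
have f2e2 : bform G f2 e2 = 1 by rewrite bform_sym// (fr_e2f2 F).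
rewrite [LHS]flipE flipE !(bformDl, bformNl, bformZl) !scaler_nat.
rewrite (fr_e2e2 F) (fr_f2f2 F) (fr_e2f2 F) f2e2; apply/rowP => j; rewrite !mxE; ring.
Qed.

Lemma flip_Aut : Aut G flip_mx.
Proof.
have f2e2 : bform G f2 e2 = 1 by rewrite bform_sym// (fr_e2f2 F).
split; last first.
  move=> x y; rewrite !flipE !(bformDl, bformDr, bformNl, bformNr, bformZl, bformZr).
  rewrite (fr_e2e2 F) (fr_f2f2 F) (fr_e2f2 F) f2e2 [bform G e2 y]bform_sym// [bform G f2 y]bform_sym//.
  ring.
have H : flip_mx *m flip_mx = 1%:M.
  by apply/row_matrixP => i; rewrite !rowE mulmxA flip_flip mulmx1.
by case: (mulmx1_unit H).
Qed.

Lemma lam_flip l y : L l (y *m extC flip_mx) = L (l *m flip_mx) y.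
Proof.
by rewrite -{1}(flip_flip l) /lam map_mxM formC_Aut//; exact: flip_Aut.
Qed.

(* The tube domain at the cusp [e1], cut by the orthogonal complement of the root [u 0]. *)
Definition tube_quad (z : V) : C := 2 * (L f2 z * L e2 z) - \sum_(k | k != ord0) L (u k) z ^+ 2.

(** The affine chart [L e1 = 1] on the vectors orthogonal to [u ord0], where isotropy determines the
    coefficient of [e1]. Only the pairings of [z] with [e2], [f2] and the other [u k] matter. *)
Definition tube_map (z : V) : V := - (tube_quad z / 2) *: extC e1 + extC f1 + L f2 z *: extC e2 + L e2 z *: extC f2
  - \sum_(k | k != ord0) L (u k) z *: extC (u k).

(** The imaginary part lies inside one nappe of the light cone of a hyperbolic plane plus seven
    negative directions. *)
Definition tube (z : V) := [/\ 0 < 'Im (L f2 z), 0 < 'Im (L e2 z) &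
  \sum_(k | k != ord0) 'Im (L (u k) z) ^+ 2 < 2 * ('Im (L f2 z) * 'Im (L e2 z))].

Lemma an_tube_map z i : an z (fun y => tube_map y 0 i).
Proof.
pose P y := - (tube_quad y / 2) * extC e1 0 i + extC f1 0 i + L f2 y * extC e2 0 i + L e2 y * extC f2 0 i
  + -1 * \sum_(k <- [seq k <- index_enum 'I_8 | k != ord0]) L (u k) y * extC (u k) 0 i.
apply: (@an_ext _ _ _ P).
  apply: locallyT => y; rewrite /P /tube_map !mxE summxE big_filter mulN1r.
  by congr (_ - _); apply: eq_bigr => k _; rewrite !mxE.
have aL l : an z (L l) by exact: an_lam.
have aS k : an z (fun y => L (u k) y ^+ 2).
  by apply: an_ext (anM (aL (u k)) (aL (u k))); apply: locallyT => y; rewrite expr2.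
have aQ : an z tube_quad.
  apply: (@an_ext _ _ _ (fun y => 2 * (L f2 y * L e2 y) +
      -1 * \sum_(k <- [seq k <- index_enum 'I_8 | k != ord0]) L (u k) y ^+ 2)).
    by apply: locallyT => y; rewrite big_filter mulN1r.
  by apply: anD; apply: anM; try exact: an_cst; [exact: anM|apply: an_sum].
apply: anD; last by apply: anM; [exact: an_cst|apply: an_sum => k _; apply: anM; rewrite //; exact: an_cst].
apply: anD; last by apply: anM => //; exact: an_cst.
apply: anD; last by apply: anM => //; exact: an_cst.
apply: anD; last exact: an_cst.
apply: anM; last exact: an_cst.
apply: (@an_ext _ _ _ (fun y => (- 2^-1) * tube_quad y)).
  by apply: locallyT => y; rewrite mulNr mulrC.
by apply: anM => //; exact: an_cst.
Qed.

(** The reversed Cauchy-Schwarz inequality in the forward light cone, obtained from a sum of squares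
    after multiplication by [2 * (p1 * p2)]. *)
Lemma light_cone_pairing (K : numFieldType) (I : finType) (P : pred I) (p1 q1 p2 q2 : K) (m1 m2 : I -> K) :
  (forall k, m1 k \is Num.real) -> (forall k, m2 k \is Num.real) -> 0 < p1 -> 0 < p2 ->
  \sum_(k | P k) m1 k ^+ 2 < 2 * (p1 * q1) -> \sum_(k | P k) m2 k ^+ 2 < 2 * (p2 * q2) ->
  \sum_(k | P k) m1 k * m2 k < p1 * q2 + p2 * q1.
Proof.
move=> r1 r2 p10 p20 h1 h2.
have p12 : 0 < 2 * (p1 * p2) by rewrite !mulr_gt0.
rewrite -(ltr_pM2l p12).
have H : 0 <= \sum_(k | P k) (p2 * m1 k - p1 * m2 k) ^+ 2.
  by apply: sumr_ge0 => k _; rewrite real_exprn_even_ge0// realB// realM// gtr0_real.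
have E : \sum_(k | P k) (p2 * m1 k - p1 * m2 k) ^+ 2 =
    p2 ^+ 2 * \sum_(k | P k) m1 k ^+ 2 + p1 ^+ 2 * \sum_(k | P k) m2 k ^+ 2
    - 2 * (p1 * p2) * \sum_(k | P k) m1 k * m2 k.
  rewrite !mulr_sumr -big_split -sumrB/=; apply: eq_bigr => k _; ring.
rewrite E subr_ge0 in H; apply: le_lt_trans H _.
have -> : 2 * (p1 * p2) * (p1 * q2 + p2 * q1) = p2 ^+ 2 * (2 * (p1 * q1)) + p1 ^+ 2 * (2 * (p2 * q2)) by ring.
by apply: ltrD; rewrite ltr_pM2l// exprn_gt0.
Qed.

Lemma tube_convex (z w : V) t : tube z -> tube w -> unit_itv t -> tube (z + t *: (w - z)).
Proof.
move=> [p10 q10 h1] [p20 q20 h2] /andP[t0 t1].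
have tr : t \is Num.real by exact: ger0_real.
have s0 : 0 <= 1 - t by rewrite subr_ge0.
have LE l : 'Im (L l (z + t *: (w - z))) = (1 - t) * 'Im (L l z) + t * 'Im (L l w).
  by rewrite lamD lamZ lamD -scaleN1r lamZ mulN1r raddfD/= ImMl// raddfB/=; ring.
have pos (a b : C) : 0 < a -> 0 < b -> 0 < (1 - t) * a + t * b.
  move=> a0 b0; have := s0; rewrite le_eqVlt => /predU1P[E|s0'].
    by rewrite -E mul0r add0r (_ : t = 1) ?mul1r//; apply/eqP; rewrite eq_sym -subr_eq0 -E.
  by rewrite ltr_pwDl ?mulr_gt0// mulr_ge0// ltW.
split; rewrite ?LE ?pos//.
rewrite (eq_bigr (fun k => (1 - t) ^+ 2 * 'Im (L (u k) z) ^+ 2 + t ^+ 2 * 'Im (L (u k) w) ^+ 2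
   + 2 * ((1 - t) * t) * ('Im (L (u k) z) * 'Im (L (u k) w)))) => [|k _]; last by rewrite LE; ring.
rewrite !big_split/= -!mulr_sumr.
have h3 := light_cone_pairing (fun k => Creal_Im (L (u k) z)) (fun k => Creal_Im (L (u k) w)) p10 p20 h1 h2.
rewrite -subr_gt0 in h1; rewrite -subr_gt0 in h2; rewrite -subr_gt0 in h3; rewrite -subr_gt0.
(* The expression is quadratic in [t], and its Bernstein coefficients are the positive quantities of
   [h1], [h3], [h2]; it is therefore a twofold convex combination of them. *)
apply: lt_le_trans (pos _ _ (pos _ _ h1 h3) (pos _ _ h3 h2)) _.
by rewrite le_eqVlt; apply/orP; left; apply/eqP; ring.
Qed.

Lemma lam_sum (I : Type) (r : seq I) (P : pred I) (f : I -> V) l :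
  L l (\sum_(i <- r | P i) f i) = \sum_(i <- r | P i) L l (f i).
Proof. by rewrite -big_filter /lam formC_suml big_filter. Qed.

Lemma lam_tube_map z : [/\ L e1 (tube_map z) = 1, L f1 (tube_map z) = - (tube_quad z / 2),
  L f2 (tube_map z) = L f2 z, L e2 (tube_map z) = L e2 z &
  forall k, L (u k) (tube_map z) = if k == ord0 then 0 else L (u k) z].
Proof.
have LN l (x : V) : L l (- x) = - L l x by exact: formCNl.
have LE l : L l (tube_map z) = - (tube_quad z / 2) * (bform G e1 l)%:~R + (bform G f1 l)%:~R
    + L f2 z * (bform G e2 l)%:~R + L e2 z * (bform G f2 l)%:~R
    - \sum_(k | k != ord0) L (u k) z * (bform G (u k) l)%:~R.
  rewrite /tube_map lamD LN lam_sum !lamD !lamZ !lam_int; congr (_ - _).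
  by apply: eq_bigr => k _; rewrite lamZ lam_int.
have bC (x y : 'rV[int]_n) : bform G x y = bform G y x by exact: bform_sym.
split=> [||||k]; rewrite LE.
- rewrite (fr_e1e1 F) [bform G f1 _]bC (fr_e1f1 F) [bform G e2 _]bC (fr_e1e2 F) [bform G f2 _]bC (fr_e1f2 F).
  by rewrite big1 ?subr0 ?mulr0 ?addr0 ?add0r// => k _; rewrite bC (fr_e1u F) mulr0.
- rewrite (fr_e1f1 F) (fr_f1f1 F) [bform G e2 _]bC (fr_f1e2 F) [bform G f2 _]bC (fr_f1f2 F).
  by rewrite big1 ?subr0 ?mulr0 ?addr0 ?mulr1// => k _; rewrite bC (fr_f1u F) mulr0.
- rewrite (fr_e1f2 F) (fr_f1f2 F) (fr_e2f2 F) (fr_f2f2 F).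
  by rewrite big1 ?subr0 ?mulr0 ?addr0 ?add0r ?mulr1// => k _; rewrite bC (fr_f2u F) mulr0.
- rewrite (fr_e1e2 F) (fr_f1e2 F) (fr_e2e2 F) [bform G f2 _]bC (fr_e2f2 F).
  by rewrite big1 ?subr0 ?mulr0 ?addr0 ?add0r ?mulr1// => k _; rewrite bC (fr_e2u F) mulr0.
rewrite (fr_e1u F) (fr_f1u F) (fr_e2u F) (fr_f2u F) !mulr0 !add0r.
have -> : \sum_(j | j != ord0) L (u j) z * (bform G (u j) (u k))%:~R =
   - \sum_(j | j != ord0) (if j == k then L (u k) z else 0).
  rewrite -sumrN; apply: eq_bigr => j _; rewrite (fr_uu F).
  by case: eqVneq => [->|]; rewrite ?mulrN1z ?mulrN1// oppr0 mulr0 oppr0.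
rewrite opprK -big_mkcondr; have [->|k0] := eqVneq k ord0.
  by rewrite big1// => j /andP[/negP nj jj].
by rewrite (bigD1 k) ?k0 ?eqxx//= big1 ?addr0// => j /andP[/andP[_ ->]].
Qed.

Lemma tube_map_isotropic z : formC G (tube_map z) (tube_map z) = 0.
Proof.
have [E1 F1 F2 E2 U] := lam_tube_map z; rewrite formC_frame E1 F1 F2 E2.
rewrite [X in _ - X](bigD1 ord0)//= U eqxx mul0r add0r.
rewrite (eq_bigr (fun k => L (u k) z ^+ 2)) => [|k /negPf k0]; last by rewrite U k0 expr2.
by rewrite /tube_quad; field.
Qed.

Lemma tube_map_norm z : formC G (tube_map z) (conjV (tube_map z)) =
  2 * (2 * ('Im (L f2 z) * 'Im (L e2 z)) - \sum_(k | k != ord0) 'Im (L (u k) z) ^+ 2).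
Proof.
have [E1 F1 F2 E2 U] := lam_tube_map z; rewrite formC_frame !lam_conj E1 F1 F2 E2 conjC1.
rewrite [X in _ - X](bigD1 ord0)//= U eqxx mul0r add0r.
rewrite (eq_bigr (fun k => L (u k) z * (L (u k) z)^*)) => [|k /negPf k0]; last by rewrite lam_conj U k0.
have Im2 (a b : C) : 'Im a * 'Im b = - ((a^* - a) * (b^* - b)) / 4.
  by rewrite !ImE; have := sqrCi C; rewrite expr2 => i2; field: i2.
have -> : \sum_(k | k != ord0) 'Im (L (u k) z) ^+ 2 =
    4^-1 * (2 * \sum_(k | k != ord0) L (u k) z * (L (u k) z)^*
     - \sum_(k | k != ord0) L (u k) z ^+ 2 - Num.conj (\sum_(k | k != ord0) L (u k) z ^+ 2)).
  rewrite rmorph_sum/= mulr_sumr -!sumrB mulr_sumr; apply: eq_bigr => k _.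
  by rewrite expr2 Im2 rmorphXn/=; field.
rewrite Im2 /tube_quad !(rmorphN, rmorphD, rmorphM, fmorphV, rmorph_nat)/=; by field.
Qed.

Lemma tube_map_coneD z : tube z -> coneD (tube_map z).
Proof.
move=> [_ _ H]; split; first exact: tube_map_isotropic.
by rewrite tube_map_norm mulr_gt0// subr_gt0.
Qed.

Lemma tube_map_id y : coneD y -> L e1 y = 1 -> L (u ord0) y = 0 -> tube_map y = y.
Proof.
move=> [yy _] ye1 yu0; have E : \sum_k L (u k) y * L (u k) y = \sum_(k | k != ord0) L (u k) y ^+ 2.
  by rewrite (bigD1 ord0)//= yu0 mul0r add0r.
rewrite formC_frame E ye1 in yy.
have yf1 : L f1 y = - (tube_quad y / 2).
  rewrite /tube_quad; set S := \sum_(k | _) _ in yy *.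
  have -> : L f1 y = (L f1 y * 1 + 1 * L f1 y + L f2 y * L e2 y + L e2 y * L f2 y - S) / 2
     - (2 * (L f2 y * L e2 y) - S) / 2 by field.
  by rewrite yy mul0r add0r.
rewrite [RHS]frame_expand yf1 ye1 scale1r [in RHS](bigD1 ord0)//= yu0 scale0r add0r.
by [].
Qed.

Lemma divH_tube (x : set {vspace V}) : divH_mod_Gamma C G x <-> exists2 z, tube z & x = orb G (tube_map z).
Proof.
split; last first.
  move=> [z zT ->]; apply/(divHP (tube_map_coneD zT)); exists (u ord0).
    by rewrite /root (fr_uu F) eqxx.
  by have [_ _ _ _ ->] := lam_tube_map z; rewrite eqxx.
move=> Zx; have [y yD xE] := divH_coneD Zx; rewrite xE in Zx *.
have /(divHP yD)[l rl ly] := Zx.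
(* Transitivity on roots allows the root [u ord0]; scaling then brings the point into the chart
   [L e1 = 1]. *)
have [y1 [y1D <- y1u]] := equiv_root_lam rl ly yD.
have y1e := e1_neq0 y1D; have c0 : (L e1 y1)^-1 != 0 by rewrite invr_neq0.
rewrite -(orbZ G y1 c0); set y2 := _ *: y1.
have y2D : coneD y2 by exact: coneDZ.
have y2e : L e1 y2 = 1 by rewrite lamZ mulVf.
have y2u : L (u ord0) y2 = 0 by rewrite lamZ y1u mulr0.
have := tube_map_norm y2; rewrite (tube_map_id y2D y2e y2u) => nE.
have : 0 < formC G y2 (conjV y2) by case: y2D.
rewrite nE pmulr_rgt0// subr_gt0 => H.
have pq : 0 < 'Im (L f2 y2) * 'Im (L e2 y2).
  rewrite -(pmulr_rgt0 _ (ltr0n C 2)); apply: le_lt_trans H; apply: sumr_ge0 => k _.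
  by rewrite real_exprn_even_ge0// Creal_Im.
have [p0|p0] := real_ltP (real0 C) (Creal_Im (L f2 y2)).
  exists y2; last by rewrite tube_map_id.
  by split=> //; rewrite -(pmulr_rgt0 _ p0).
have p0' : 'Im (L f2 y2) < 0.
  by rewrite lt_neqAle p0 andbT; apply: contraTneq pq => ->; rewrite mul0r ltxx.
have q0' : 'Im (L e2 y2) < 0 by rewrite -(nmulr_rgt0 _ p0').
(* Both imaginary parts are negative here, opposite to the tube; the flip changes their signs and
   fixes the other pairings. *)
pose y3 := y2 *m extC flip_mx.
have bC (v w : 'rV[int]_n) : bform G v w = bform G w v by exact: bform_sym.
have fixed l' : bform G l' f2 = 0 -> bform G l' e2 = 0 -> L l' y3 = L l' y2.
  by move=> h1 h2; rewrite /y3 lam_flip flipE h1 h2 !scale0r addr0 scaler0 subr0.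
have LN l' : L (- l') y2 = - L l' y2 by rewrite /lam map_mxN formCNr.
have y3f : L f2 y3 = - L f2 y2.
  rewrite /y3 lam_flip flipE (fr_f2f2 F) bC (fr_e2f2 F) scale0r add0r scale1r -LN.
  by congr (L _ _); rewrite scaler_nat mulr2n opprD addrA subrr sub0r.
have y3e : L e2 y3 = - L e2 y2.
  rewrite /y3 lam_flip flipE (fr_e2e2 F) (fr_e2f2 F) scale0r addr0 scale1r -LN.
  by congr (L _ _); rewrite scaler_nat mulr2n opprD addrA subrr sub0r.
have y3u k : L (u k) y3 = L (u k) y2 by apply: fixed; rewrite bC ?(fr_e2u F) ?(fr_f2u F).
have y3D : coneD y3 by apply: coneD_Aut => //; exact: flip_Aut.
exists y3; last first.
  rewrite tube_map_id// ?y3u//; first by rewrite orb_Aut//; exact: flip_Aut.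
  by rewrite fixed// (fr_e1f2 F, fr_e1e2 F).
split; rewrite ?y3f ?y3e ?raddfN/= ?oppr_gt0// mulrNN.
by under eq_bigr do rewrite y3u.
Qed.

Lemma tube_nonempty : exists z, tube z.
Proof.
exists ('i *: (extC e2 + extC f2)).
have LE l : L l ('i *: (extC e2 + extC f2)) = 'i * (bform G e2 l + bform G f2 l)%:~R.
  by rewrite lamZ lamD !lam_int rmorphD.
have f2e2 : bform G f2 e2 = 1 by rewrite bform_sym// (fr_e2f2 F).
rewrite /tube !LE (fr_e2f2 F) (fr_f2f2 F) (fr_e2e2 F) f2e2 addr0 add0r mulr1 Im_i mulr1.
split; rewrite ?ltr01// big1 ?mulr1 ?ltr0n// => k _.
by rewrite LE (fr_e2u F) (fr_f2u F) addr0 mulr0 raddf0 expr0n.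
Qed.

End FrameComplex.

(** * The complex numbers *)

Section ComplexNumbers.
Variable R : realType.

Lemma real_cauchy_lim (u : nat -> R) :
  (forall e : R, 0 < e -> exists N, forall i j, (N <= i)%N -> (N <= j)%N -> `|u i - u j| <= e) ->
  exists l, forall e : R, 0 < e -> exists N, forall i, (N <= i)%N -> `|u i - l| <= e.
Proof.
move=> H; have /cauchy_cvg/cvg_ex[/= l ul] : cauchy (u @ \oo).
  apply: cauchy_exP => e e0; have [N HN] := H (e / 2) (divr_gt0 e0 (ltr0n R 2)).
  exists (u N); exists N => // i Ni; rewrite /ball/=.
  by apply: le_lt_trans (HN _ _ (leqnn N) Ni) _; rewrite gtr_pMr// invf_lt1// ltr1n.
exists l => e e0; have /cvgrPdist_le/(_ e e0)[N _ HN] := ul.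
by exists N => i Ni; rewrite distrC; exact: HN.
Qed.

Lemma real_monotone_cauchy (u : nat -> R) M : (forall i j, (i <= j)%N -> u i <= u j) -> (forall i, u i <= M) ->
  forall e : R, 0 < e -> exists N, forall i j, (N <= i)%N -> (N <= j)%N -> `|u i - u j| <= e.
Proof.
move=> umono uM e e0; have uc : cvgn u.
  apply: nondecreasing_is_cvgn; first by move=> i j; exact: umono.
  by exists M => _ [i _ <-].
have /cvgrPdist_le/(_ (e / 2) (divr_gt0 e0 (ltr0n R 2)))[N _ HN] := uc.
exists N => i j Ni Nj; rewrite -(subrK (limn u) (u i)) -addrA (splitr e).
apply: le_trans (ler_normD _ _) _; apply: lerD; last exact: HN.
by rewrite distrC; exact: HN.
Qed.

Lemma normc_ge_Im (x : R[i]) : (`|complex.Im x|%:C)%C <= `|x|.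
Proof. by rewrite normc_def lecR -sqrtr_sqr ler_wsqrtr// lerDr sqr_ge0. Qed.

Lemma normc_le_ReIm (x : R[i]) : `|x| <= ((`|complex.Re x| + `|complex.Im x|)%:C)%C.
Proof.
rewrite normc_def lecR -[leRHS]ger0_norm ?addr_ge0// -sqrtr_sqr ler_wsqrtr//.
by rewrite sqrrD !real_normK ?num_real// addrAC lerDl mulrn_wge0// mulr_ge0.
Qed.

Lemma posc_real (e : R[i]) : 0 < e -> exists2 r : R, 0 < r & e = (r%:C)%C.
Proof.
case: e => a b; rewrite ltcE/= => /andP[/eqP-> a0].
by exists a.
Qed.

Lemma complex_seq_complete : seq_complete R[i].
Proof.
move=> u uC; have part (p : R[i] -> R) : (forall x y, p (x - y) = p x - p y) ->
    (forall x, ((`|p x|%:C)%C : R[i]) <= `|x|) ->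
    exists l, forall e : R, 0 < e -> exists N, forall i, (N <= i)%N -> `|p (u i) - l| <= e.
  move=> pB pn; apply: real_cauchy_lim => e e0.
  have [|N HN] := uC ((e%:C)%C : R[i]); first by rewrite ltcR.
  by exists N => i j Ni Nj; rewrite -lecR -pB; apply: le_trans (pn _) (HN _ _ Ni Nj).
have [||a Ha] := part (@complex.Re R); [by case=> ? ? [? ?]|exact: normc_ge_Re|].
have [||b Hb] := part (@complex.Im R); [by case=> ? ? [? ?]|exact: normc_ge_Im|].
exists (Complex a b) => e /posc_real[r r0 ->].
have [N HN] := Ha (r / 2) (divr_gt0 r0 (ltr0n R 2)); have [N' HN'] := Hb (r / 2) (divr_gt0 r0 (ltr0n R 2)).
exists (maxn N N') => i; rewrite geq_max => /andP[Ni N'i].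
apply: le_trans (normc_le_ReIm _) _; rewrite lecR (splitr r).
by move: (HN i Ni) (HN' i N'i); case: (u i) => x y /= h1 h2; exact: lerD.
Qed.

(** Positivity forces the terms to be real, which reduces the claim to bounded monotone real
    sequences. *)
Lemma complex_monotone_cauchy : monotone_cauchy R[i].
Proof.
move=> u M umono uM e /posc_real[r r0 ->].
have ui i : complex.Im (u i) = 0 by have /andP[] := uM i; rewrite lecE => /andP[/eqP].
have [||N HN] := @real_monotone_cauchy (fun i => complex.Re (u i)) (complex.Re M) _ _ r r0.
- by move=> i j /umono; rewrite lecE => /andP[].
- by move=> i; have /andP[_] := uM i; rewrite lecE => /andP[].
exists N => i j Ni Nj; apply: le_trans (normc_le_ReIm _) _; rewrite lecR.
move: (HN i j Ni Nj) (ui i) (ui j); case: (u i) (u j) => [a b] [a' b']/= h -> ->.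
by rewrite subrr normr0 addr0.
Qed.

End ComplexNumbers.

(** * The lattice I_{2,10} *)

Lemma frame_isom n (G G' g : 'M[int]_n) : lattice_isom G G' g -> frame G' -> frame G.
Proof.
move=> [gu gG] F; have Gg x y : bform G (x *m invmx g) y = bform G' x (y *m g) by rewrite -gG mulmxKV.
have GG x y : bform G (x *m invmx g) (y *m invmx g) = bform G' x y by rewrite -gG !mulmxKV.
have Gx x w : bform G x (w *m invmx g) = bform G' (x *m g) w by rewrite -gG mulmxKV.
refine (@Frame _ _ (fr_e1 F *m invmx g) (fr_f1 F *m invmx g) (fr_e2 F *m invmx g) (fr_f2 F *m invmx g)
  (fun k => fr_u F k *m invmx g) _ _ _ _ _ _ _ _ _ _ _ _ _ _ _ _); rewrite ?GG.
all: try by case: F.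
- by move=> k; rewrite GG (fr_e1u F).
- by move=> k; rewrite GG (fr_f1u F).
- by move=> k; rewrite GG (fr_e2u F).
- by move=> k; rewrite GG (fr_f2u F).
- by move=> k l; rewrite GG (fr_uu F).
move=> x; rewrite !Gx; under eq_bigr do rewrite Gx.
rewrite -[LHS](mulmxK gu) {1}(fr_decomp F (x *m g)) mulmxBl !mulmxDl -!scalemxAl mulmx_suml.
by congr (_ - _); apply: eq_bigr => k _; rewrite -scalemxAl.
Qed.

Lemma lattice_IE p q (x y : 'rV[int]_(p + q)) :
  bform (lattice_I p q) x y = \sum_(i < p + q) (-1) ^+ (p <= i)%N * (x 0 i * y 0 i).
Proof.
rewrite /bform /lattice_I mul_mx_diag mxE; apply: eq_bigr => i _; rewrite !mxE.
case: splitP => j ij; rewrite mxE ij.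
  by rewrite leqNgt ltn_ord expr0 mulr1 mul1r.
by rewrite leq_addr expr1 mulN1r mulrN1 mulNr.
Qed.

Definition row12 (s : seq int) : 'rV[int]_(2 + 10) := \row_j s`_j.

Lemma lattice_I_row12 x s : bform (lattice_I 2 10) x (row12 s) =
  let X i := x 0 (inord i) in
  X 0%N * s`_0 + X 1%N * s`_1 - X 2%N * s`_2 - X 3%N * s`_3 - X 4%N * s`_4 - X 5%N * s`_5 - X 6%N * s`_6
  - X 7%N * s`_7 - X 8%N * s`_8 - X 9%N * s`_9 - X 10%N * s`_10 - X 11%N * s`_11.
Proof.
rewrite lattice_IE (eq_bigr (fun i : 'I_(2 + 10) => (-1) ^+ (2 <= i)%N * (x 0 (inord i) * s`_i))) => [|i _].
  by rewrite /= !big_ord_recl big_ord0 /=; ring.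
by rewrite mxE inord_val.
Qed.

(** In a block of one positive and two negative basis vectors, (1,1,0) and (1,0,1) span a hyperbolic
    plane whose complement is generated by (1,1,1), of norm -1. Two such blocks give the cases 0 and
    1; the other six vectors are the remaining basis vectors. *)
Definition root_row (k : 'I_8) : 'rV[int]_(2 + 10) := row12
  (if k == 0%N :> nat then [:: 1; 0; 1; 1] else if k == 1%N :> nat then [:: 0; 1; 0; 0; 1; 1]
   else ncons (k + 4) 0 [:: 1]).

Lemma lattice_I_frame : frame (lattice_I 2 10).
Proof.
have row12E (s : seq int) (i : nat) : (i < 12)%N -> row12 s 0 (inord i) = s`_i by move=> i12; rewrite mxE inordK.
refine (@Frame _ _ (row12 [:: 1; 0; 1]) (row12 [:: 1; 0; 0; 1]) (row12 [:: 0; 1; 0; 0; 1])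
  (row12 [:: 0; 1; 0; 0; 0; 1]) root_row _ _ _ _ _ _ _ _ _ _ _ _ _ _ _ _).
all: try by rewrite lattice_I_row12 /= !row12E.
all: try by move=> k; rewrite lattice_I_row12 /= !row12E//; case: k => [[|[|[|[|[|[|[|[|//]]]]]]]] ?].
- by move=> [[|[|[|[|[|[|[|[|//]]]]]]]] ?] [[|[|[|[|[|[|[|[|//]]]]]]]] ?];
    rewrite lattice_I_row12 /= !row12E.
move=> x; rewrite !lattice_I_row12 !big_ord_recl big_ord0 !lattice_I_row12 /=.
apply/rowP => -[j j12]; rewrite !mxE.
have -> : x 0 (Ordinal j12) = x 0 (inord j) by congr (x 0 _); apply: val_inj; rewrite /= inordK.
do 12! [case: j j12 => [|j] j12; first by rewrite /=; ring].
by [].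
Qed.

Lemma lattice_isom_sym n (G G' g : 'M[int]_n) : lattice_isom G G' g -> G'^T = G' -> G^T = G.
Proof. by move=> /lattice_isomP[_ <-] G's; rewrite !trmx_mul trmxK G's mulmxA. Qed.

Theorem corollary3 (R : realType) (G : 'M[int]_(2 + 10))
    (hG : isometric G (lattice_I 2 10)) :
  irreducible_divisor (space_D_mod_Gamma R[i] G) (divH_mod_Gamma R[i] G).
Proof.
have [g gG] := hG; pose F := frame_isom gG lattice_I_frame.
have Gsym : G^T = G by apply: (lattice_isom_sym gG); exact: tr_diag_mx.
have Cmono := @complex_monotone_cauchy R; have Ccomp := @complex_seq_complete R.
have [Han Hcodim] := divisor_analytic_codim1 Cmono Ccomp Gsym
  (Aut_finite_local F Gsym Cmono) (roots_finite_local F Gsym Cmono).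
split=> //; apply: (irreducible_of_convex Cmono Ccomp _ _ _ (tube_nonempty R[i] F Gsym)).
- by move=> u i; exact: (an_tube_map F).
- exact: tube_map_coneD.
- exact: tube_convex.
- exact: divH_tube.
Qed.
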